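(* Let $\gamma \in \mathbb{C}$ with $\gamma \neq 0$, and let $\psi$ be analytic on an open neighborhood of $\overline{\mathbb{D}}$. Set $\Psi(z)=\gamma\bar{z}+\psi(z)$. Assume that (a') $\Psi$ is sense-reversing on $\overline{\mathbb{D}}$, i.e., $|\gamma| > |\psi'(z)|$ for all $z \in \overline{\mathbb{D}}$; (b') $\psi$ is such that the family of eigenvectors $\{f_\lambda\}_{\lambda \in \Psi(\mathbb{D})}$ of $T_\Psi$, given by $$f_\lambda(z) = \exp\left( - \int_{0}^{z} \frac{\omega\psi'(\omega) + 2(\psi(\omega)-\lambda)}{\gamma + \omega(\psi(\omega) - \lambda)} \, d\omega \right),\qquad z\in\mathbb{D},$$ spans a dense subspace of $L_A^2(\mathbb{D})$; (c') $\mathbb{D} \cap \Psi(\mathbb{D}) \neq \emptyset$ and $(\mathbb{C} \setminus \overline{\mathbb{D}}) \cap \Psi(\mathbb{D}) \neq \emptyset$. Then the Toeplitz operator $T_{\Psi}$ is hypercyclic on $L_A^2(\mathbb{D})$.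
   Context: $\mathbb{D} = \{z \in \mathbb{C} : |z| < 1\}$ and $\overline{\mathbb{D}}$ is its closure. The Bergman space $L_A^2(\mathbb{D}) = L^2(\mathbb{D}, dA) \cap \mathcal{H}(\mathbb{D})$ consists of the analytic functions on $\mathbb{D}$ that are square-integrable with respect to the normalized area measure $dA(z) = \frac{1}{\pi}\,dx\,dy$; $P : L^2(\mathbb{D}, dA) \to L_A^2(\mathbb{D})$ is the orthogonal (Bergman) projection, $Pf(z)= \int_{\mathbb{D}} \frac{f(\omega)}{(1-\bar{\omega}z)^{2}} \, dA(\omega)$. For $\phi \in L^\infty(\mathbb{D})$, the Toeplitz operator on $L_A^2(\mathbb{D})$ is $T_{\phi}f = P(\phi f)$. A bounded operator $T$ is hypercyclic if there is a vector $x$ whose orbit $\{T^n x : n \geq 0\}$ is dense. Under (a'), for every $\lambda\in\Psi(\mathbb{D})$ the denominator $\gamma + \omega(\psi(\omega) - \lambda)$ has no zeros in $\overline{\mathbb{D}}$, so $f_\lambda$ is well defined, and it is a bounded analytic function on $\mathbb{D}$ satisfying $T_\Psi f_\lambda=\lambda f_\lambda$. *)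

(* Defs.v *)
From HB Require Import structures.
From mathcomp Require Import all_boot all_order all_algebra.
From mathcomp Require Import all_classical all_reals all_analysis.
From mathcomp.real_closed Require Export complex.
Import Order.TTheory GRing.Theory Num.Theory.
Import numFieldNormedType.Exports.

Set Implicit Arguments.
Unset Strict Implicit.
Unset Printing Implicit Defensive.

Local Open Scope classical_set_scope.
Local Open Scope ring_scope.
Local Open Scope complex_scope.

(* R[i] is a field with a norm but has no topology of its own; this transports
   the one every numFieldType carries through R[i]^o, so that [open],
   [closure], [derivable] and [derive1] below are the complex ones. *)
HB.instance Definition _ (R : realType) := NormedModule.copy R[i] R[i]^o.

Section complex_analysis.
Variable R : realType.
Implicit Types (z : R[i]) (f : R[i] -> R[i]) (A : set R[i]).

Definition cexp z : R[i] :=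
  (expR (complex.Re z))%:C * (cos (complex.Im z) +i* sin (complex.Im z)).

Definition Cintegral d (T : measurableType d) (mu : {measure set T -> \bar R})
    (D : set T) (f : T -> R[i]) : R[i] :=
  (\int[mu]_(x in D) complex.Re (f x)) +i* (\int[mu]_(x in D) complex.Im (f x)).

(* The integral of f along the segment [0, z], parametrized by t |-> t * z.
   For f holomorphic on a disc centred at 0 it is the path integral from 0
   to z, which is independent of the path. *)
Definition segment_integral f z : R[i] :=
  z * Cintegral (@lebesgue_measure R) `[0, 1] (fun t => f (t%:C * z)).

Definition holomorphic_on A f := forall z, A z -> derivable f z 1.

Definition unit_disk : set R[i] := [set z | `|z| < 1].

End complex_analysis.

Arguments unit_disk R : clear implicits.

Section bergman.
Variable R : realType.
Implicit Types (z : R[i]) (f g phi : R[i] -> R[i]).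

Lemma invpi_ge0 : 0 <= (pi : R)^-1.
Proof. by rewrite invr_ge0 pi_ge0. Qed.

(* Borel sigma-algebra and Lebesgue measure of the plane live on R * R. *)
Definition plane := (measurableTypeR R * measurableTypeR R)%type.

Definition cplx (p : plane) : R[i] := p.1 +i* p.2.

Definition dA : {measure set plane -> \bar R} :=
  mscale (NngNum invpi_ge0) (@lebesgue_measure R \x @lebesgue_measure R)%E.

Definition diskR2 : set plane := cplx @^-1` unit_disk R.

Definition L2norm f : \bar R :=
  poweR (\int[dA]_(p in diskR2) (ComplexField.Normc.normc (f (cplx p)) ^+ 2)%:E)%E (2^-1).

(* Functions are total on R[i]; here and below only their values on the unit
   disk matter. *)
Definition L2disk f : Prop :=
  [/\ measurable_fun diskR2 (fun p => complex.Re (f (cplx p))),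
      measurable_fun diskR2 (fun p => complex.Im (f (cplx p))) &
      (L2norm f < +oo)%E].

Definition bergman f : Prop := L2disk f /\ holomorphic_on (unit_disk R) f.

(* The orthogonal projection of L2disk onto bergman, as the integral operator
   with the reproducing (Bergman) kernel. *)
Definition bergman_proj f z : R[i] :=
  Cintegral dA diskR2
    (fun p => let w := cplx p in f w / (1 - conjc w * z) ^+ 2).

Definition toeplitz phi f : R[i] -> R[i] :=
  bergman_proj (fun w => phi w * f w).

(* Membership of S in the Bergman space is not part of this definition; for
   orbits of a bounded operator it follows from [bounded_operator]. *)
Definition bergman_dense (S : set (R[i] -> R[i])) : Prop :=
  forall g, bergman g -> forall eps : R, 0 < eps ->
    exists2 h, S h & (L2norm (fun z => (g z - h z)%R) < eps%:E)%E.

Definition lin_span (I : Type) (A : set I) (F : I -> R[i] -> R[i]) :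
    set (R[i] -> R[i]) :=
  [set h | exists (n : nat) (c : 'I_n -> R[i]) (l : 'I_n -> I),
     (forall k, A (l k)) /\ h = (fun z => \sum_(k < n) c k * F (l k) z)].

(* Equality in the Bergman space is equality on the unit disk, hence the
   restriction of the linearity clause to z in the disk. *)
Definition bounded_operator (T : (R[i] -> R[i]) -> (R[i] -> R[i])) : Prop :=
  [/\ forall f, bergman f -> bergman (T f),
      forall (a : R[i]) f g, bergman f -> bergman g ->
        forall z, unit_disk R z ->
          T (fun w => a * f w + g w) z = a * T f z + T g z &
      exists M : R, forall f, bergman f -> (L2norm (T f) <= M%:E * L2norm f)%E].

Definition hypercyclic (T : (R[i] -> R[i]) -> (R[i] -> R[i])) : Prop :=
  bounded_operator T /\
  exists2 x, bergman x & bergman_dense (range (fun n => iter n T x)).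

Definition symbol (gamma : R[i]) (psi : R[i] -> R[i]) z : R[i] :=
  gamma * conjc z + psi z.

Definition eigenfun (gamma : R[i]) (psi : R[i] -> R[i]) (l z : R[i]) : R[i] :=
  cexp (- segment_integral
            (fun w => (w * derive1 psi w + 2 * (psi w - l)) /
                      (gamma + w * (psi w - l))) z).

End bergman.

(* Main.v *)
From HB Require Import structures.
Require Import Defs.
From mathcomp Require Import all_boot all_order all_algebra.
From mathcomp Require Import all_classical all_reals all_analysis.
From mathcomp Require Import measurable_realfun ring lra.
From mathcomp Require cyclic separable cyclotomic.
Import Order.TTheory GRing.Theory Num.Theory.
Import numFieldNormedType.Exports.
Set Implicit Arguments. Unset Strict Implicit. Unset Printing Implicit Defensive.
Local Open Scope classical_set_scope.
Local Open Scope ring_scope.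
Local Open Scope complex_scope.

(** The eigenfunctions f_l depend holomorphically on l. A bounded holomorphic
    function on a disk is approximated at any given interior point, uniformly
    over all functions with a given bound, by fixed linear combinations of its
    values at roots of unity scaled close to the centre. Moving along a segment
    in the unit disk, every f_l with l in Psi(D) is therefore a uniform limit of
    combinations of eigenfunctions with eigenvalues near any prescribed point
    of Psi(D), so that near each such point they already span a dense subspace.
    Taking one point inside and one outside the closed unit disk, the iterates
    of T tend to zero on one dense subspace, and on the other one T has right
    inverses whose iterates tend to zero; Kitai's construction then gives a
    hypercyclic vector as the sum of a series.

    Cauchy's theorem is not used. Green's formula for the field (1 - |w|^2) G
    shows that the Bergman kernel reproduces holomorphic functions that are
    bounded together with their derivative. It applies to psi because
    |psi'| < |gamma|, and to f_l, and it also gives T f_l = l f_l, since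
    (Psi - l) f_l is the d/dw-derivative of
    - (1 - |w|^2) (gamma + w (psi - l)) f_l. *)

(** Hypothesis (b') does not say where the eigenvalues lie, whereas Kitai's argument needs them all
    inside, or all outside, the unit circle; hence the transport of spans along segments. It takes
    place in [reg], the eigenvalues whose denominator is bounded away from zero on the disk. Small
    perturbations preserve this property, so a full neighbourhood of each point of Psi(D) is
    available. The delicate point is the lower bound itself, which has to be uniform up to the
    circle.

    The reproducing formula is established for bounded functions with bounded derivative. Other
    elements of the space are reached through the density hypothesis, and the vector finally
    constructed is a limit of reproduced functions.

    Backward vectors are attached to a chosen linear combination of eigenfunctions and not to its
    sum, so linear independence is never at issue. Their eigenvalues lie outside the circle, while
    the partial sums of the series must shrink under iteration; each backward vector is therefore
    replaced by a combination with eigenvalues inside, so close to it that the power of T in use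
    does not separate them. *)

Local Notation nc := ComplexField.Normc.normc.
Local Notation cj := conjc.
Local Notation Re := complex.Re.
Local Notation Im := complex.Im.

(** * Complex derivatives *)

Section ComplexBasics.
Variable R : realType.
Notation C := R[i].
Implicit Types (f g : C -> C) (z w : C).

Lemma normcE (z : C) : `|z| = (nc z)%:C.
Proof. by case: z. Qed.

Lemma nc_ge0 z : 0 <= nc z.
Proof. by case: z => a b; exact: sqrtr_ge0. Qed.

Lemma nc0 : nc (0 : C) = 0. Proof. exact: ComplexField.Normc.normc0. Qed.
Lemma nc1 : nc (1 : C) = 1. Proof. exact: ComplexField.Normc.normc1. Qed.
Lemma ncN z : nc (- z) = nc z. Proof. exact: normcN. Qed.
Lemma ncM z w : nc (z * w) = nc z * nc w. Proof. exact: ComplexField.Normc.normcM. Qed.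
Lemma ncV z : nc z^-1 = (nc z)^-1. Proof. exact: ComplexField.Normc.normcV. Qed.
Lemma ncD z w : nc (z + w) <= nc z + nc w. Proof. exact: le_normcD. Qed.
Lemma ncB z w : nc (z - w) <= nc z + nc w. Proof. by rewrite -(ncN w); exact: ncD. Qed.
Lemma ncBC z w : nc (z - w) = nc (w - z). Proof. by rewrite -ncN opprB. Qed.
Lemma nc_dist z w u : nc (z - w) <= nc (z - u) + nc (u - w).
Proof. by rewrite (_ : z - w = (z - u) + (u - w)) ?ncD//; ring. Qed.
Lemma ncBl z w : nc z - nc w <= nc (z - w).
Proof. by rewrite lerBlDr (le_trans _ (ncD _ _)) // subrK. Qed.
Lemma nc_real (x : R) : nc x%:C = `|x|.
Proof. by rewrite /= expr0n /= addr0 sqrtr_sqr. Qed.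
Lemma ncX z n : nc (z ^+ n) = nc z ^+ n.
Proof. by elim: n => [|n IH]; rewrite ?expr0 ?nc1 // !exprS ncM IH. Qed.
Lemma nc_sqr z : nc z ^+ 2 = complex.Re z ^+ 2 + complex.Im z ^+ 2.
Proof. by case: z => a b /=; rewrite sqr_sqrtr // addr_ge0 ?sqr_ge0. Qed.
Lemma ncJ z : nc (cj z) = nc z.
Proof. by case: z => a b /=; rewrite sqrrN. Qed.
Lemma normRe_nc z : `|complex.Re z| <= nc z.
Proof. by case: z => a b /=; rewrite -sqrtr_sqr ler_wsqrtr // lerDl sqr_ge0. Qed.
Lemma normIm_nc z : `|complex.Im z| <= nc z.
Proof. by case: z => a b /=; rewrite -sqrtr_sqr ler_wsqrtr // lerDr sqr_ge0. Qed.
Lemma nc_ReIm z : nc z <= `|complex.Re z| + `|complex.Im z|.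
Proof.
case: z => a b /=; rewrite -[leRHS]ger0_norm ?addr_ge0 // -sqrtr_sqr ler_wsqrtr //.
by rewrite sqrrD !real_normK ?num_real // lerD2r lerDl mulrn_wge0 // mulr_ge0.
Qed.
Lemma nc_nat n : nc (n%:R : C) = n%:R.
Proof. by rewrite -(rmorph_nat (real_complex R)) nc_real normr_nat. Qed.
Lemma mulJ z : z * (cj z) = ((nc z) ^+ 2)%:C.
Proof. by rewrite nc_sqr; case: z => a b; apply/eqP; rewrite eq_complex /=; apply/andP; split; apply/eqP; ring. Qed.
Lemma nc_sum n (F : 'I_n -> C) : nc (\sum_(i < n) F i) <= \sum_(i < n) nc (F i).
Proof.
elim/big_ind2: _ => [|x x' y y' h h'|//]; first by rewrite nc0.
by apply: le_trans (ncD _ _) _; apply: lerD.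
Qed.
Lemma mulrCRe (a : R) z : a%:C * z = (a * complex.Re z) +i* (a * complex.Im z).
Proof. by case: z => x y; apply/eqP; rewrite eq_complex /= !mul0r subr0 addr0 !eqxx. Qed.

Lemma ltc_posE (e : C) : 0 < e -> e = (complex.Re e)%:C /\ 0 < complex.Re e.
Proof. by case: e => a b; rewrite ltcE /= => /andP[/eqP -> ->]. Qed.

Lemma nbhs_ncP z (A : set C) : nbhs z A <-> exists2 d : R, 0 < d & forall w, nc (w - z) < d -> A w.
Proof.
split.
- move=> /nbhs_ballP[e /= e0 H]; have [ee e0'] := ltc_posE e0.
  exists (complex.Re e) => // w hw; apply: H.
  by rewrite -ball_normE /ball_ /= distrC normcE ee ltcR.
- move=> [d d0 H]; apply/nbhs_ballP; exists d%:C => /=; first by rewrite ltcR.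
  by move=> w; rewrite -ball_normE /ball_ /= distrC normcE ltcR => /H.
Qed.

(** The form without quotient admits h = 0 and is shared with the Wirtinger derivative [wderiv] and
    the real derivative [rderiv]. *)
Definition cderiv f z l := forall e : R, 0 < e -> exists2 d : R, 0 < d &
  forall h, nc h < d -> nc (f (z + h) - f z - l * h) <= e * nc h.

Lemma nc_eq0 z : (nc z == 0) = (z == 0).
Proof.
apply/eqP/eqP => [/ComplexField.Normc.eq0_normc//|->]; exact: nc0.
Qed.

Lemma nc_gt0 z : (0 < nc z) = (z != 0).
Proof. by rewrite lt_def nc_ge0 andbT nc_eq0. Qed.

Lemma cderiv_dnbhs f z l : cderiv f z l <->
  ((fun h : C => h^-1 * (f (h + z) - f z)) @ 0^' --> l).
Proof.
split.
- move=> H; apply/cvgrPdist_le => e e0; have [ee e0'] := ltc_posE e0.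
  have [d d0 {}H] := H _ e0'.
  apply/nbhs_ncP; exists d => // h; rewrite subr0 => hd h0.
  rewrite ee normcE lecR.
  have -> : l - h^-1 * (f (h + z) - f z) = - (h^-1 * (f (z + h) - f z - l * h)).
    by rewrite [h + z]addrC; field.
  rewrite ncN ncM ncV.
  by rewrite mulrC ler_pdivrMr ?nc_gt0 //; apply: H.
- move=> /cvgrPdist_le H e e0.
  have /= := H e%:C; rewrite ltcR => /(_ e0) /nbhs_ncP[d d0 {}H].
  exists d => // h hd; have [->|h0] := eqVneq h 0.
    by rewrite addr0 subrr mulr0 subr0 !nc0 mulr0.
  have := H h; rewrite subr0 => /(_ hd h0); rewrite normcE lecR.
  have -> : l - h^-1 * (f (h + z) - f z) = - (h^-1 * (f (z + h) - f z - l * h)).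
    by rewrite [h + z]addrC; field.
  rewrite ncN ncM ncV.
  by rewrite mulrC ler_pdivrMr ?nc_gt0.
Qed.

Lemma diffquotE f z : (fun h : C => h^-1 * (f (h + z) - f z)) =
  (fun h : C => h^-1 *: ((f \o shift z) (h *: 1) - f z)).
Proof. by apply/funext => h /=; rewrite [h *: 1](mulr1 h). Qed.

Lemma derivable_cderiv f z : derivable f z 1 -> cderiv f z (derive1 f z).
Proof.
move=> df; apply/cderiv_dnbhs; rewrite derive1E diffquotE; exact: df.
Qed.

Lemma cderiv_derivable f z l : cderiv f z l -> derivable f z 1.
Proof.
move=> /cderiv_dnbhs; rewrite diffquotE => H.
by rewrite /derivable; apply/cvg_ex; exists l; exact: H.
Qed.

Lemma cderiv_unique f z l l' : cderiv f z l -> cderiv f z l' -> l = l'.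
Proof.
move=> /cderiv_dnbhs H /cderiv_dnbhs H'; exact: cvg_unique H H'.
Qed.

End ComplexBasics.

Section Cderiv.
Variable R : realType.
Notation C := R[i].
Implicit Types (f g : C -> C) (z w : C).

Lemma ncS_gt0 z : 0 < nc z + 1.
Proof. by rewrite ltr_wpDl // nc_ge0. Qed.

Lemma cderiv_quad f z l (c d : R) : 0 < d ->
  (forall h, nc h < d -> nc (f (z + h) - f z - l * h) <= c * nc h ^+ 2) -> cderiv f z l.
Proof.
move=> d0 H e e0.
(* The sign of c is not prescribed and c may be 0, hence |c| + 1. *)
have c0 : 0 < `|c| + 1 by rewrite ltr_wpDl.
exists (Num.min d (e / (`|c| + 1))); first by rewrite lt_min d0 divr_gt0.
move=> h; rewrite lt_min => /andP[hd he].
apply: le_trans (H _ hd) _; rewrite expr2 mulrA ler_wpM2r ?nc_ge0 //.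
apply: (@le_trans _ _ ((`|c| + 1) * nc h)).
  by rewrite ler_wpM2r ?nc_ge0 // (le_trans (ler_norm c)) // lerDl.
by rewrite mulrC -ler_pdivlMr // ltW.
Qed.

Lemma cderiv_eq f z l l' : cderiv f z l -> l = l' -> cderiv f z l'.
Proof. by move=> ? <-. Qed.

Lemma cderiv_near f g z l (r : R) : 0 < r -> (forall w, nc (w - z) < r -> f w = g w) ->
  cderiv f z l -> cderiv g z l.
Proof.
move=> r0 fg H e e0; have [d d0 {}H] := H _ e0.
exists (Num.min d r); first by rewrite lt_min d0 r0.
move=> h; rewrite lt_min => /andP[hd hr].
rewrite -!fg ?subrr ?nc0 //; first exact: H.
by rewrite addrC addKr.
Qed.

Lemma cderiv_cst (k : C) z : cderiv (fun _ => k) z 0.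
Proof.
by move=> e e0; exists 1 => // h _; rewrite subrr mul0r subr0 nc0 mulr_ge0 ?nc_ge0 // ltW.
Qed.

Lemma cderiv_id z : cderiv (fun w => w) z 1.
Proof.
move=> e e0; exists 1 => // h _.
have -> : z + h - z - 1 * h = 0 by ring.
by rewrite nc0 mulr_ge0 ?nc_ge0 // ltW.
Qed.

(* Wirtinger derivatives: [a] is df/dz and [b] is df/d(conj z). *)
Definition wderiv f z a b := forall e : R, 0 < e -> exists2 d : R, 0 < d &
  forall h, nc h < d -> nc (f (z + h) - f z - (a * h + b * (cj h))) <= e * nc h.

Lemma cderivW f z l : cderiv f z l <-> wderiv f z l 0.
Proof. by split=> H e /H[d d0 {}H]; exists d => // h /H; rewrite mul0r addr0. Qed.

Lemma nc_lin (a b h : C) : nc (a * h + b * (cj h)) <= (nc a + nc b) * nc h.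
Proof. by apply: le_trans (ncD _ _) _; rewrite !ncM ncJ mulrDl. Qed.

Lemma wderiv_eq f z a b a' b' : wderiv f z a b -> a = a' -> b = b' -> wderiv f z a' b'.
Proof. by move=> ? <- <-. Qed.

Lemma wderiv_near f g z a b (r : R) : 0 < r -> (forall w, nc (w - z) < r -> f w = g w) ->
  wderiv f z a b -> wderiv g z a b.
Proof.
move=> r0 fg H e e0; have [d d0 {}H] := H _ e0.
exists (Num.min d r); first by rewrite lt_min d0 r0.
move=> h; rewrite lt_min => /andP[hd hr].
rewrite -!fg ?subrr ?nc0 //; first exact: H.
by rewrite addrC addKr.
Qed.

Lemma wderivJ f z a b : wderiv f z a b -> wderiv (fun w => (cj (f w))) z (cj b) (cj a).
Proof.
move=> H e /H[d d0 {}H]; exists d => // h /H; rewrite -ncJ.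
by rewrite !raddfB /= raddfD /= !rmorphM /= conjcK [(cj a) * _ + _]addrC.
Qed.

Lemma wderivD f g z a b a' b' : wderiv f z a b -> wderiv g z a' b' ->
  wderiv (fun w => f w + g w) z (a + a') (b + b').
Proof.
move=> Hf Hg e e0.
have e20 : 0 < e / 2 by rewrite divr_gt0.
have [d d0 {}Hf] := Hf _ e20; have [d' d'0 {}Hg] := Hg _ e20.
exists (Num.min d d'); first by rewrite lt_min d0.
move=> h; rewrite lt_min => /andP[/Hf hf /Hg hg].
have -> : f (z + h) + g (z + h) - (f z + g z) - ((a + a') * h + (b + b') * (cj h)) =
  (f (z + h) - f z - (a * h + b * (cj h))) + (g (z + h) - g z - (a' * h + b' * (cj h))) by ring.
apply: le_trans (ncD _ _) _; lra.
Qed.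

Lemma wderiv_lip f z a b : wderiv f z a b -> exists2 d : R, 0 < d &
  forall h, nc h < d -> nc (f (z + h) - f z) <= (nc a + nc b + 1) * nc h.
Proof.
move=> /(_ 1 ltr01)[d d0 H]; exists d => // h /H hh.
have -> : f (z + h) - f z = (f (z + h) - f z - (a * h + b * (cj h))) + (a * h + b * (cj h)) by ring.
apply: le_trans (ncD _ _) _; have := nc_lin a b h; lra.
Qed.

Lemma wderivM f g z a b a' b' : wderiv f z a b -> wderiv g z a' b' ->
  wderiv (fun w => f w * g w) z (a * g z + f z * a') (b * g z + f z * b').
Proof.
move=> Hf Hg e e0.
have [d3 d30 H3] := wderiv_lip Hg.
pose l := nc a + nc b; pose m := nc a' + nc b'.
have l0 : 0 <= l by rewrite addr_ge0 ?nc_ge0.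
have m0 : 0 <= m by rewrite addr_ge0 ?nc_ge0.
pose K := nc (g z) + m + 1 + nc (f z).
have K0 : 0 < K by rewrite /K; move: (nc_ge0 (g z)) (nc_ge0 (f z)); lra.
have e20 : 0 < e / (3 * K) by rewrite divr_gt0 // mulr_gt0.
have [d d0 {}Hf] := Hf _ e20; have [d' d'0 {}Hg] := Hg _ e20.
pose d4 := e / (3 * (l * (m + 1) + 1)).
have l1 : 0 < l * (m + 1) + 1 by rewrite ltr_wpDl // mulr_ge0 // addr_ge0.
have d40 : 0 < d4 by rewrite divr_gt0 // mulr_gt0.
exists (Num.min 1 (Num.min (Num.min d d') (Num.min d3 d4))); first by rewrite !lt_min d0 d'0 d30 d40 ltr01.
move=> h; rewrite !lt_min => /andP[h1 /andP[/andP[/Hf hf /Hg hg] /andP[/H3 hg3 h4]]].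
rewrite -/m in hg3.
(* Three errors, each given e/3: the remainder of f times g, the product of the two increments, and
   f times the remainder of g. The middle one is quadratic in h and is what [d4] controls. *)
have -> : f (z + h) * g (z + h) - f z * g z - ((a * g z + f z * a') * h + (b * g z + f z * b') * (cj h)) =
  (f (z + h) - f z - (a * h + b * (cj h))) * g (z + h) + (a * h + b * (cj h)) * (g (z + h) - g z) +
  f z * (g (z + h) - g z - (a' * h + b' * (cj h))) by ring.
have h0 := nc_ge0 h.
have gb : nc (g (z + h)) <= K.
  have -> : g (z + h) = (g (z + h) - g z) + g z by ring.
  apply: le_trans (ncD _ _) _; apply: le_trans (lerD hg3 (lexx _)) _.
  have : (m + 1) * nc h <= (m + 1) * 1 by rewrite ler_wpM2l ?ltW // ltr_wpDl.
  by rewrite /K; move: (nc_ge0 (f z)); lra.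
have fb : nc (f z) <= K by rewrite /K; move: (nc_ge0 (g z)); lra.
have ee : e / (3 * K) * nc h * K = e / 3 * nc h by field; rewrite gt_eqF.
have s1 : nc (f (z + h) - f z - (a * h + b * (cj h))) * nc (g (z + h)) <= e / 3 * nc h.
  by rewrite -ee; apply: ler_pM => //; exact: nc_ge0.
have s3 : nc (f z) * nc (g (z + h) - g z - (a' * h + b' * (cj h))) <= e / 3 * nc h.
  by rewrite -ee mulrC; apply: ler_pM => //; exact: nc_ge0.
have s2 : nc (a * h + b * (cj h)) * nc (g (z + h) - g z) <= e / 3 * nc h.
  apply: (@le_trans _ _ (l * nc h * ((m + 1) * nc h))).
    by apply: ler_pM; rewrite ?nc_ge0 // nc_lin.
  rewrite (_ : _ * _ * _ = l * (m + 1) * nc h * nc h); last by ring.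
  rewrite ler_wpM2r //.
  apply: (@le_trans _ _ ((l * (m + 1) + 1) * d4)).
    apply: ler_pM => //; last exact: ltW.
      by rewrite mulr_ge0 // addr_ge0.
    by rewrite lerDl.
  by rewrite /d4 le_eqVlt; apply/orP; left; apply/eqP; field; rewrite gt_eqF.
apply: le_trans (ncD _ _) _; apply: le_trans (lerD (ncD _ _) (lexx _)) _.
by rewrite !ncM; lra.
Qed.

Lemma wderiv_comp f g z l a b : wderiv g z a b -> cderiv f (g z) l ->
  wderiv (fun w => f (g w)) z (l * a) (l * b).
Proof.
move=> Hg Hf e e0.
have [d3 d30 H3] := wderiv_lip Hg.
pose m := nc a + nc b.
have m1 : 0 < m + 1 by rewrite ltr_wpDl // addr_ge0 ?nc_ge0.
have l1 := ncS_gt0 l.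
have [d d0 {}Hf] := Hf (e / (2 * (m + 1))) ltac:(by rewrite divr_gt0 // mulr_gt0).
have [d' d'0 {}Hg] := Hg (e / (2 * (nc l + 1))) ltac:(by rewrite divr_gt0 // mulr_gt0).
exists (Num.min (d / (m + 1)) (Num.min d' d3)).
  by rewrite !lt_min d'0 d30 divr_gt0.
move=> h; rewrite !lt_min ltr_pdivlMr // => /andP[h1 /andP[/Hg hg /H3 h3]].
have kd : nc (g (z + h) - g z) < d by apply: le_lt_trans h3 _; rewrite mulrC.
have := Hf _ kd; rewrite [g z + _]addrC subrK => hf.
have -> : f (g (z + h)) - f (g z) - (l * a * h + l * b * (cj h)) =
  (f (g (z + h)) - f (g z) - l * (g (z + h) - g z)) + l * (g (z + h) - g z - (a * h + b * (cj h))) by ring.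
apply: le_trans (ncD _ _) _; rewrite ncM.
have s1 : e / (2 * (m + 1)) * nc (g (z + h) - g z) <= e / 2 * nc h.
  rewrite (_ : e / 2 * nc h = e / (2 * (m + 1)) * ((m + 1) * nc h)).
    by rewrite ler_wpM2l // divr_ge0 ?ltW // mulr_gt0.
  by field; rewrite gt_eqF.
have s2 : nc l * nc (g (z + h) - g z - (a * h + b * (cj h))) <= e / 2 * nc h.
  apply: (@le_trans _ _ ((nc l + 1) * (e / (2 * (nc l + 1)) * nc h))).
    by apply: ler_pM => //; rewrite ?nc_ge0 // lerDl.
  by rewrite le_eqVlt; apply/orP; left; apply/eqP; field; rewrite gt_eqF.
lra.
Qed.

Lemma cderivD f g z l m : cderiv f z l -> cderiv g z m ->
  cderiv (fun w => f w + g w) z (l + m).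
Proof.
move=> /cderivW Hf /cderivW Hg; apply/cderivW.
by apply: wderiv_eq (wderivD Hf Hg) _ _ => //; rewrite addr0.
Qed.

Lemma cderivM f g z l m : cderiv f z l -> cderiv g z m ->
  cderiv (fun w => f w * g w) z (l * g z + f z * m).
Proof.
move=> /cderivW Hf /cderivW Hg; apply/cderivW.
by apply: wderiv_eq (wderivM Hf Hg) _ _ => //; rewrite mul0r mulr0 addr0.
Qed.

Lemma cderiv_comp f g z l m : cderiv g z m -> cderiv f (g z) l ->
  cderiv (fun w => f (g w)) z (l * m).
Proof.
move=> /cderivW Hg Hf; apply/cderivW.
by apply: wderiv_eq (wderiv_comp Hg Hf) _ _ => //; rewrite mulr0.
Qed.

Lemma wderiv_cont f z a b : wderiv f z a b -> forall e : R, 0 < e -> exists2 d : R, 0 < d &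
  forall w, nc (w - z) < d -> nc (f w - f z) < e.
Proof.
move=> /wderiv_lip[d d0 H] e e0.
have l0 : 0 < nc a + nc b + 1 by rewrite ltr_wpDl // addr_ge0 ?nc_ge0.
exists (Num.min d (e / (nc a + nc b + 1))); first by rewrite lt_min d0 divr_gt0.
move=> w; rewrite lt_min ltr_pdivlMr // => /andP[h1 h2].
have := H _ h1; rewrite [z + _]addrC subrK => h3; apply: le_lt_trans h3 _.
by rewrite mulrC.
Qed.

Lemma cderiv_cont f z l : cderiv f z l -> forall e : R, 0 < e -> exists2 d : R, 0 < d &
  forall w, nc (w - z) < d -> nc (f w - f z) < e.
Proof. by move=> /cderivW; exact: wderiv_cont. Qed.

Lemma cderiv_inv z : z != 0 -> cderiv (fun w => w^-1) z (- z ^- 2).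
Proof.
move=> z0; have nz0 : 0 < nc z by rewrite nc_gt0.
(* For |h| < |z|/2 one has |z + h| >= |z|/2, and the remainder is exactly h^2 / (z^2 (z + h)). *)
apply: (@cderiv_quad _ _ _ (2 / nc z ^+ 3) (nc z / 2)); first by rewrite divr_gt0.
move=> h hh.
have zh : nc z / 2 <= nc (z + h).
  by have := ncBl z (- h); rewrite opprK ncN; lra.
have zh0 : 0 < nc (z + h) by apply: lt_le_trans zh; rewrite divr_gt0.
have zhn : z + h != 0 by rewrite -nc_gt0.
have -> : (z + h)^-1 - z^-1 - - z ^- 2 * h = h ^+ 2 * z^-1 ^+ 2 * (z + h)^-1.
  by field; rewrite zhn z0.
rewrite 2!ncM 2!ncX 2!ncV mulrC [leRHS]mulrC [_^-1 * _]mulrC -mulrA ler_wpM2l ?sqr_ge0 //.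
rewrite (_ : 2 / nc z ^+ 3 = (nc z)^-1 ^+ 2 * (nc z / 2)^-1); last by field; rewrite gt_eqF.
by rewrite ler_wpM2l ?sqr_ge0 // lef_pV2 // posrE divr_gt0.
Qed.

Lemma cderivV f z l : f z != 0 -> cderiv f z l -> cderiv (fun w => (f w)^-1) z (- (l / f z ^+ 2)).
Proof.
move=> f0 H; have := cderiv_comp H (cderiv_inv f0).
by move=> hh; apply: cderiv_eq hh _; rewrite mulNr mulrC.
Qed.

Lemma cderivN f z l : cderiv f z l -> cderiv (fun w => - f w) z (- l).
Proof.
move=> H; have := cderivM (cderiv_cst (-1) z) H.
rewrite mul0r add0r mulN1r; apply: (@cderiv_near _ _ _ _ 1) => // w _.
by rewrite mulN1r.
Qed.

Lemma cderivB f g z l m : cderiv f z l -> cderiv g z m ->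
  cderiv (fun w => f w - g w) z (l - m).
Proof. by move=> hf /cderivN; exact: cderivD. Qed.

Lemma cderivZ k f z l : cderiv f z l -> cderiv (fun w => k * f w) z (k * l).
Proof.
by move=> H; apply: cderiv_eq (cderivM (cderiv_cst k z) H) _; rewrite mul0r add0r.
Qed.

Lemma cderivX z n : cderiv (fun w => w ^+ n) z (n%:R * z ^+ n.-1).
Proof.
elim: n => [|n IH]; first by rewrite mul0r; exact: cderiv_cst.
apply: (@cderiv_near (fun w => w * w ^+ n) _ _ _ 1) => //.
  by move=> w _; rewrite exprS.
apply: cderiv_eq (cderivM (cderiv_id z) IH) _; rewrite mul1r /=.
case: n {IH} => [|n]; first by rewrite !mul0r mulr0 addr0 mul1r.
by rewrite /= -[in n.+2%:R]natr1 exprS; ring.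
Qed.

Definition rderiv (f : R -> R) (x l : R) := forall e : R, 0 < e -> exists2 d : R, 0 < d &
  forall h, `|h| < d -> `|f (x + h) - f x - l * h| <= e * `|h|.

Lemma rderivP (f : R -> R) x l : rderiv f x l <-> is_derive x (1 : R) f l.
Proof.
have E : (fun h : R => h^-1 *: ((f \o shift x) (h *: (1 : R)) - f x)) =
         (fun h => h^-1 * (f (h + x) - f x)).
  by apply/funext => h /=; rewrite [h *: 1]mulr1.
split.
- move=> H.
  have HH : (fun h => h^-1 * (f (h + x) - f x)) @ 0^' --> l.
    apply/cvgrPdist_le => e e0; have [d d0 {}H] := H _ e0.
    apply/nbhs_ballP; exists d => //= h; rewrite /ball /= sub0r normrN => /H hd h0.
    have -> : l - h^-1 * (f (h + x) - f x) = - (h^-1 * (f (x + h) - f x - l * h)).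
      by rewrite [h + x]addrC; field.
    by rewrite normrN normrM normfV mulrC ler_pdivrMr ?normr_gt0.
  apply: DeriveDef; rewrite /derivable /derive E; first by apply/cvg_ex; exists l.
  exact/cvg_lim.
- move=> D; have := @ex_derive _ _ _ _ _ _ _ D; have := @derive_val _ _ _ _ _ _ _ D.
  rewrite /derivable /derive E => H /cvg_ex[l' hl'].
  have ll : l' = l by rewrite -H; apply/esym/cvg_lim.
  rewrite ll in hl'; move=> e e0.
  have /cvgrPdist_le /(_ _ e0) := hl'.
  move=> /nbhs_ballP[d /= d0 {}H]; exists d => // h hd; have [->|h0] := eqVneq h 0.
    by rewrite addr0 subrr mulr0 subr0 !normr0 mulr0.
  have := H h; rewrite /ball /= sub0r normrN => /(_ hd h0).
  have -> : l - h^-1 * (f (h + x) - f x) = - (h^-1 * (f (x + h) - f x - l * h)).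
    by rewrite [h + x]addrC; field.
  by rewrite normrN normrM normfV mulrC ler_pdivrMr ?normr_gt0.
Qed.

(** The factor k serves several uses: k = 1 and k = -i give real and imaginary parts, and the
    conjugate of an increment gives the mean value inequality. *)
Lemma wderiv_line f (c q : C) (x : R) a b (k : C) : wderiv f (c + x%:C * q) a b ->
  rderiv (fun t : R => complex.Re (k * f (c + t%:C * q))) x (complex.Re (k * (a * q + b * (cj q)))).
Proof.
move=> H e e0.
have K0 : 0 < nc k * nc q + 1 by rewrite ltr_wpDl // mulr_ge0 ?nc_ge0.
have q1 := ncS_gt0 q.
have [d d0 {}H] := H (e / (nc k * nc q + 1)) ltac:(by rewrite divr_gt0).
exists (d / (nc q + 1)); first by rewrite divr_gt0.
move=> h; rewrite ltr_pdivlMr // => hh.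
have hd : nc (h%:C * q) < d.
  rewrite ncM nc_real; apply: le_lt_trans hh.
  by rewrite ler_wpM2l // lerDl.
have := H _ hd => {}H.
rewrite -(raddfB (@complex.Re R)) (_ : complex.Re (k * (a * q + b * (cj q))) * h = complex.Re (k * (a * q + b * (cj q)) * h%:C)); last first.
  by rewrite [_ * h%:C]mulrC mulrCRe /= mulrC.
rewrite -(raddfB (@complex.Re R)).
have Eq : (cj (h%:C * q)) = h%:C * (cj q) by rewrite rmorphM /= oppr0.
rewrite Eq in H.
have -> : k * f (c + (x + h)%:C * q) - k * f (c + x%:C * q) - k * (a * q + b * (cj q)) * h%:C =
  k * (f (c + x%:C * q + h%:C * q) - f (c + x%:C * q) - (a * (h%:C * q) + b * (h%:C * (cj q)))).
  by rewrite rmorphD /= mulrDl addrA; ring.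
apply: le_trans (normRe_nc _) _; rewrite ncM.
apply: le_trans (ler_wpM2l (nc_ge0 k) H) _; rewrite ncM nc_real.
rewrite (_ : nc k * (e / (nc k * nc q + 1) * (`|h| * nc q)) = e * `|h| * (nc k * nc q / (nc k * nc q + 1))); last by field; rewrite gt_eqF.
rewrite -[leRHS]mulr1 ler_wpM2l //; first by rewrite mulr_ge0 // ltW.
by rewrite ler_pdivrMr // mul1r lerDl.
Qed.

(** The values are projected onto the direction of the total increment: Re (conj (f b - f a) f)
    increases by |f b - f a|^2 along the segment, and the real mean value theorem bounds that
    increase. *)
Lemma nc_mvtW f fa fb (a b : C) (M : R) :
  (forall t : R, 0 <= t <= 1 -> wderiv f (a + t%:C * (b - a)) (fa (a + t%:C * (b - a))) (fb (a + t%:C * (b - a)))) ->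
  (forall t : R, 0 <= t <= 1 -> nc (fa (a + t%:C * (b - a))) + nc (fb (a + t%:C * (b - a))) <= M) ->
  nc (f b - f a) <= M * nc (b - a).
Proof.
move=> df Mf.
pose k : C := (cj (f b - f a)).
pose F t := complex.Re (k * f (a + t%:C * (b - a))).
pose F' t := complex.Re (k * (fa (a + t%:C * (b - a)) * (b - a) + fb (a + t%:C * (b - a)) * (cj (b - a)))).
have FF (t : R) : t \in `[0, 1] -> is_derive t (1 : R) F (F' t).
  by rewrite in_itv /= => t01; apply/rderivP; apply: wderiv_line; exact: df.
have H1 (x : R) : x \in `]0, 1[%R -> is_derive x (1 : R) F (F' x).
  by move=> x01; apply: FF; move: x01; rewrite !in_itv /= => /andP[/ltW -> /ltW ->].
have H2 : {within `[(0 : R), 1], continuous F}.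
  by apply: derivable_within_continuous => x x01; have := FF x x01; case.
have [c] := MVT_segment ler01 H1 H2.
rewrite in_itv /= => c01.
rewrite /F /= mul0r addr0 mul1r [a + (b - a)]addrC subrK subr0 mulr1.
rewrite -(raddfB (@complex.Re R)) -mulrBr /k [(cj _) * _]mulrC mulJ /= => E.
have M0 : 0 <= M by apply: le_trans (Mf 0 _); rewrite ?addr_ge0 ?nc_ge0 // lexx ler01.
have [->|n0] := eqVneq (nc (f b - f a)) 0; first by rewrite mulr_ge0 ?nc_ge0.
have {}n0 : 0 < nc (f b - f a) by rewrite lt_def n0 nc_ge0.
rewrite -(ler_pM2l n0) -expr2 E /F'.
apply: le_trans (ler_norm _) _; apply: le_trans (normRe_nc _) _.
rewrite ncM ncJ ler_pM2l //; apply: le_trans (nc_lin _ _ _) _.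
by rewrite ler_wpM2r ?nc_ge0 //; exact: Mf.
Qed.

Lemma nc_mvt f f' (a b : C) (M : R) :
  (forall t : R, 0 <= t <= 1 -> cderiv f (a + t%:C * (b - a)) (f' (a + t%:C * (b - a)))) ->
  (forall t : R, 0 <= t <= 1 -> nc (f' (a + t%:C * (b - a))) <= M) ->
  nc (f b - f a) <= M * nc (b - a).
Proof.
move=> df Mf; apply: (@nc_mvtW f f' (fun=> 0)) => t t01.
  by apply/cderivW; exact: df.
by rewrite nc0 addr0; exact: Mf.
Qed.

(** The mean value inequality is applied to f w - f'(a) w, whose derivative f' w - f'(a) is bounded
    by a second application. This costs the factor 1/2 of Taylor's formula. *)
Lemma taylor1 f f' f'' (a b : C) (M : R) :
  (forall t : R, 0 <= t <= 1 -> cderiv f (a + t%:C * (b - a)) (f' (a + t%:C * (b - a)))) ->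
  (forall t : R, 0 <= t <= 1 -> cderiv f' (a + t%:C * (b - a)) (f'' (a + t%:C * (b - a)))) ->
  (forall t : R, 0 <= t <= 1 -> nc (f'' (a + t%:C * (b - a))) <= M) ->
  nc (f b - f a - f' a * (b - a)) <= M * nc (b - a) ^+ 2.
Proof.
move=> df ddf Mf.
have M0 : 0 <= M by apply: le_trans (nc_ge0 _) (Mf 0 _); rewrite lexx ler01.
have := @nc_mvt (fun w => f w - f' a * w) (fun w => f' w - f' a) a b (M * nc (b - a)).
rewrite (_ : f b - f' a * b - (f a - f' a * a) = f b - f a - f' a * (b - a)); last by ring.
rewrite expr2 mulrA; apply.
- move=> t t01; apply: cderivB; first exact: df.
  by apply: cderiv_eq (cderivZ (f' a) (cderiv_id _)) _; rewrite mulr1.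
- move=> t /andP[t0 t1].
  have : nc (f' (a + t%:C * (b - a)) - f' a) <= M * nc (t%:C * (b - a)).
    rewrite [t%:C * (b - a)](_ : _ = (a + t%:C * (b - a)) - a); last by ring.
    have E (s : R) : a + s%:C * (a + t%:C * (b - a) - a) = a + (s * t)%:C * (b - a).
      by rewrite rmorphM /=; ring.
    rewrite (_ : a + (a + t%:C * (b - a) - a) = a + t%:C * (b - a)); last by ring.
    apply: (@nc_mvt _ f'') => s /andP[s0 s1]; rewrite E;
      have st : 0 <= s * t <= 1 by rewrite mulr_ge0 // mulr_ile1.
    + exact: ddf.
    + exact: Mf.
  move/le_trans; apply; rewrite ler_wpM2l // ncM nc_real ger0_norm //.
  by rewrite ler_piMl ?nc_ge0.
Qed.

End Cderiv.

(** * Complex-valued integrals *)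

Section Cint.
Variable R : realType.
Notation C := R[i].

Definition ncvg (u : nat -> C) (l : C) := forall e : R, 0 < e ->
  exists N, forall n, (N <= n)%N -> nc (u n - l) < e.

Lemma ncvg_Re u l : ncvg u l -> (fun n => Re (u n)) @ \oo --> Re l.
Proof.
move=> H; apply/cvgrPdist_lt => e e0; have [N hN] := H e e0.
exists N => // n /= Nn; rewrite distrC -(raddfB (@complex.Re R)).
exact: le_lt_trans (normRe_nc _) (hN _ Nn).
Qed.

Lemma ncvg_Im u l : ncvg u l -> (fun n => Im (u n)) @ \oo --> Im l.
Proof.
move=> H; apply/cvgrPdist_lt => e e0; have [N hN] := H e e0.
exists N => // n /= Nn; rewrite distrC -(raddfB (@complex.Im R)).
exact: le_lt_trans (normIm_nc _) (hN _ Nn).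
Qed.

Section gen.
Context d (T : measurableType d) (mu : {measure set T -> \bar R}) (D : set T).
Hypothesis mD : measurable D.
Implicit Types (f g : T -> C) (G : T -> R).

Definition cmeas f := measurable_fun D (fun x => Re (f x)) /\ measurable_fun D (fun x => Im (f x)).
Definition rint G := mu.-integrable D (fun x => (G x)%:E).
Definition cint f := rint (fun x => Re (f x)) /\ rint (fun x => Im (f x)).
Local Notation CI f := (Cintegral mu D f).

Lemma cmeas_cst k : cmeas (fun _ => k).
Proof. by split; exact: measurable_cst. Qed.
Lemma cmeasD f g : cmeas f -> cmeas g -> cmeas (fun x => f x + g x).
Proof.
move=> [f1 f2] [g1 g2]; split.
  by under eq_fun do rewrite raddfD; exact: measurable_funD.
by under eq_fun do rewrite raddfD; exact: measurable_funD.
Qed.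
Lemma cmeasM f g : cmeas f -> cmeas g -> cmeas (fun x => f x * g x).
Proof.
move=> [f1 f2] [g1 g2].
have E x : f x * g x = (Re (f x) * Re (g x) - Im (f x) * Im (g x)) +i*
   (Re (f x) * Im (g x) + Im (f x) * Re (g x)) by case: (f x); case: (g x).
split; under eq_fun do rewrite E /=.
  by apply: measurable_funB; apply: measurable_funM.
by apply: measurable_funD; apply: measurable_funM.
Qed.
Lemma cmeasZ k f : cmeas f -> cmeas (fun x => k * f x).
Proof. by apply: cmeasM; exact: cmeas_cst. Qed.
Lemma cmeasN f : cmeas f -> cmeas (fun x => - f x).
Proof. by move=> /(cmeasZ (-1)); under eq_fun do rewrite mulN1r. Qed.
Lemma cmeasB f g : cmeas f -> cmeas g -> cmeas (fun x => f x - g x).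
Proof. by move=> hf /cmeasN; exact: cmeasD. Qed.
Lemma cmeasJ f : cmeas f -> cmeas (fun x => (cj (f x))).
Proof.
move=> [f1 f2]; have E x : (cj (f x)) = Re (f x) -i* Im (f x) by case: (f x).
by split; under eq_fun do rewrite E /=; [|exact: measurable_funN].
Qed.
Lemma cmeasX f n : cmeas f -> cmeas (fun x => f x ^+ n).
Proof.
move=> mf; elim: n => [|n IH]; first by under eq_fun do rewrite expr0; exact: cmeas_cst.
by under eq_fun do rewrite exprS; exact: cmeasM.
Qed.
Lemma cmeas_eq f g : (forall x, D x -> f x = g x) -> cmeas f -> cmeas g.
Proof.
move=> fg [f1 f2]; split.
  by apply: eq_measurable_fun f1 => x /[!inE] /fg ->.
by apply: eq_measurable_fun f2 => x /[!inE] /fg ->.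
Qed.
Lemma cmeas_nc2 f : cmeas f -> measurable_fun D (fun x => nc (f x) ^+ 2).
Proof.
move=> [f1 f2]; under eq_fun do rewrite nc_sqr.
by apply: measurable_funD; apply: measurable_funX.
Qed.
Lemma cmeas_nc f : cmeas f -> measurable_fun D (fun x => nc (f x)).
Proof.
move=> /cmeas_nc2 H; under eq_fun do rewrite -[nc _]ger0_norm ?nc_ge0 // -sqrtr_sqr.
apply: measurableT_comp => //; exact: continuous_measurable_fun (@sqrt_continuous R).
Qed.
Lemma cmeas_cvg (F : nat -> T -> C) f : (forall n, cmeas (F n)) ->
  (forall x, D x -> ncvg (fun n => F n x) (f x)) -> cmeas f.
Proof.
move=> mF Ff; split.
  apply: (@measurable_fun_cvg _ _ _ _ (fun n x => Re (F n x))) => //.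
    by move=> n; case: (mF n).
  by move=> x /Ff /ncvg_Re.
apply: (@measurable_fun_cvg _ _ _ _ (fun n x => Im (F n x))) => //.
  by move=> n; case: (mF n).
by move=> x /Ff /ncvg_Im.
Qed.

Lemma rint_meas G : rint G -> measurable_fun D G.
Proof. by move=> /measurable_int /measurable_EFinP. Qed.
Lemma cint_meas f : cint f -> cmeas f.
Proof. by move=> [/rint_meas ? /rint_meas ?]. Qed.
Lemma rint_dom G H : measurable_fun D G -> rint H -> (forall x, D x -> `|G x| <= H x) -> rint G.
Proof.
move=> mG iH GH; apply: le_integrable iH => //; first exact/measurable_EFinP.
by move=> x Dx /=; rewrite lee_fin (le_trans (GH _ Dx)) // ler_norm.
Qed.
Lemma rintD G H : rint G -> rint H -> rint (fun x => G x + H x).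
Proof. by move=> hG hH; exact: (integrableD mD hG hH). Qed.
Lemma rintZ k G : rint G -> rint (fun x => k * G x).
Proof. by move=> hG; exact: (integrableZl mD k hG). Qed.
Lemma rint_abs G : rint G -> rint (fun x => `|G x|).
Proof. by move=> hG; exact: (integrable_norm hG). Qed.
Lemma cint_dom f G : cmeas f -> rint G -> (forall x, D x -> nc (f x) <= G x) -> cint f.
Proof.
move=> [f1 f2] iG H; split; apply: rint_dom iG _ => // x Dx.
  exact: le_trans (normRe_nc _) (H _ Dx).
exact: le_trans (normIm_nc _) (H _ Dx).
Qed.
Lemma cint_nc f : cint f -> rint (fun x => nc (f x)).
Proof.
move=> If; have [f1 f2] := If; have := rintD (rint_abs f1) (rint_abs f2).
move/rint_dom; apply; first exact/cmeas_nc/cint_meas.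
by move=> x _; rewrite ger0_norm ?nc_ge0 //; exact: nc_ReIm.
Qed.
Lemma cintD f g : cint f -> cint g -> cint (fun x => f x + g x).
Proof.
move=> If Ig; apply: (cint_dom (cmeasD (cint_meas If) (cint_meas Ig)) (rintD (cint_nc If) (cint_nc Ig))).
by move=> x _; exact: ncD.
Qed.
Lemma cintZ k f : cint f -> cint (fun x => k * f x).
Proof.
move=> If; apply: (cint_dom (cmeasZ k (cint_meas If)) (rintZ (nc k) (cint_nc If))).
by move=> x _; rewrite ncM.
Qed.
Lemma cintN f : cint f -> cint (fun x => - f x).
Proof. by move=> /(cintZ (-1)); under eq_fun do rewrite mulN1r. Qed.
Lemma cintB f g : cint f -> cint g -> cint (fun x => f x - g x).
Proof. by move=> hf /cintN; exact: cintD. Qed.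
Lemma rint_eq G H : (forall x, D x -> G x = H x) -> rint G -> rint H.
Proof. by move=> GH; apply: eq_integrable => // x /[!inE] /GH ->. Qed.
Lemma cint_eq f g : (forall x, D x -> f x = g x) -> cint f -> cint g.
Proof. by move=> fg [f1 f2]; split; [apply: rint_eq f1|apply: rint_eq f2] => x /fg ->. Qed.
Lemma cint_sum n (F : 'I_n -> T -> C) : (forall i, cint (F i)) -> cint (fun x => \sum_(i < n) F i x).
Proof.
elim: n F => [|n IH] F IF.
  under eq_fun do rewrite big_ord0.
  by split; exact: integrable0.
by under eq_fun do rewrite big_ord_recr /=; apply: cintD => //; exact: IH.
Qed.

Lemma CI_eq f g : (forall x, D x -> f x = g x) -> CI f = CI g.
Proof.
move=> fg; rewrite /Cintegral; congr (_ +i* _); apply: eq_Rintegral => x /[!inE] /fg -> //.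
Qed.
Lemma CID f g : cint f -> cint g -> CI (fun x => f x + g x) = CI f + CI g.
Proof.
move=> [f1 f2] [g1 g2]; rewrite /Cintegral; apply/eqP; rewrite eq_complex /=; apply/andP; split; apply/eqP.
  by rewrite -RintegralD //; apply: eq_Rintegral => x _; rewrite raddfD.
by rewrite -RintegralD //; apply: eq_Rintegral => x _; rewrite raddfD.
Qed.
Lemma CIZ k f : cint f -> CI (fun x => k * f x) = k * CI f.
Proof.
move=> [f1 f2]; case: k => a b; rewrite /Cintegral; apply/eqP; rewrite eq_complex /=; apply/andP; split; apply/eqP.
  rewrite -!RintegralZl // -RintegralB //; [|exact: rintZ|exact: rintZ].
  by apply: eq_Rintegral => x _; case: (f x).
rewrite -!RintegralZl // -RintegralD //; [|exact: rintZ|exact: rintZ].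
by apply: eq_Rintegral => x _; case: (f x).
Qed.
Lemma CIN f : cint f -> CI (fun x => - f x) = - CI f.
Proof. by move=> hf; rewrite -mulN1r -CIZ //; apply: CI_eq => x _; rewrite mulN1r. Qed.
Lemma CIB f g : cint f -> cint g -> CI (fun x => f x - g x) = CI f - CI g.
Proof. by move=> hf hg; rewrite -CIN // -CID //; exact: cintN. Qed.
Lemma CI_sum n (F : 'I_n -> T -> C) : (forall i, cint (F i)) ->
  CI (fun x => \sum_(i < n) F i x) = \sum_(i < n) CI (F i).
Proof.
elim: n F => [|n IH] F IF.
  rewrite big_ord0; apply/eqP; rewrite eq_complex /Cintegral /=.
  by under eq_Rintegral do rewrite big_ord0; rewrite Rintegral_cst // mul0r eqxx /=;
     under eq_Rintegral do rewrite big_ord0; rewrite Rintegral_cst // mul0r eqxx.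
rewrite big_ord_recr /= -IH // -CID //; last exact: cint_sum.
by apply: CI_eq => x _; rewrite big_ord_recr.
Qed.
Lemma CIJ f : cint f -> CI (fun x => (cj (f x))) = (cj (CI f)).
Proof.
move=> [f1 f2]; rewrite /Cintegral /=; congr (_ +i* _).
  by apply: eq_Rintegral => x _; case: (f x).
rewrite -mulN1r -RintegralZl //.
by apply: eq_Rintegral => x _; case: (f x) => ? ?; rewrite mulN1r.
Qed.
(** Multiplication by the conjugate of the integral turns its squared modulus into the real part of
    an integral, where the real inequality applies. *)
Lemma CI_le f G : cint f -> rint G -> (forall x, D x -> nc (f x) <= G x) ->
  nc (CI f) <= \int[mu]_(x in D) G x.
Proof.
move=> If IG H.
have [->|n0] := eqVneq (nc (CI f)) 0.
  by apply: Rintegral_ge0 => x /H; exact: le_trans (nc_ge0 _).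
have {}n0 : 0 < nc (CI f) by rewrite lt_def n0 nc_ge0.
rewrite -(ler_pM2l n0) -expr2.
have -> : nc (CI f) ^+ 2 = Re (CI (fun x => (cj (CI f)) * f x)).
  by rewrite CIZ // mulrC mulJ.
rewrite -RintegralZl //; set I := CI f.
rewrite [leLHS](_ : _ = \int[mu]_(x in D) Re ((cj I) * f x)) //.
have [h1 h2] := cintZ (cj (CI f)) If.
apply: le_Rintegral => //; first exact: rintZ.
move=> x Dx; apply: le_trans (ler_norm _) _; apply: le_trans (normRe_nc _) _.
by rewrite ncM ncJ ler_wpM2l ?nc_ge0 // H.
Qed.

(** An integrable bound on the second derivative makes the integrated remainder quadratic, so
    differentiation under the integral follows from [taylor1] with no limit theorem. *)
Lemma CI_cderiv (k k' k'' : T -> C -> C) (z0 : C) (r : R) G : 0 < r ->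
  (forall x z, D x -> nc (z - z0) < r -> cderiv (k x) z (k' x z)) ->
  (forall x z, D x -> nc (z - z0) < r -> cderiv (k' x) z (k'' x z)) ->
  (forall x z, D x -> nc (z - z0) < r -> nc (k'' x z) <= G x) ->
  (forall z, nc (z - z0) < r -> cint (fun x => k x z)) ->
  cint (fun x => k' x z0) -> rint G ->
  cderiv (fun z => CI (fun x => k x z)) z0 (CI (fun x => k' x z0)).
Proof.
move=> r0 dk dk' kG Ik Ik' IG.
apply: (@cderiv_quad _ _ _ _ (\int[mu]_(x in D) G x) r r0) => h hr.
have zr : nc (z0 - z0) < r by rewrite subrr nc0.
have hr' : nc (z0 + h - z0) < r by rewrite [z0 + h]addrC addrK.
rewrite -CIB; [|exact: Ik|exact: Ik].
rewrite [_ * h]mulrC -CIZ // -CIB; [|by apply: cintB; exact: Ik|exact: cintZ].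
rewrite [leRHS]mulrC -RintegralZl //.
apply: CI_le; first by apply: cintB; [apply: cintB; exact: Ik|exact: cintZ].
  exact: rintZ.
move=> x Dx.
have E (t : R) : 0 <= t <= 1 -> nc (z0 + t%:C * (z0 + h - z0) - z0) < r.
  move=> /andP[t0 t1]; rewrite (_ : _ - z0 = t%:C * h); last by ring.
  by rewrite ncM nc_real ger0_norm //; apply: le_lt_trans hr; rewrite ler_piMl ?nc_ge0.
have := @taylor1 _ (k x) (k' x) (k'' x) z0 (z0 + h) (G x).
rewrite (_ : z0 + h - z0 = h); last by ring.
rewrite [h * _]mulrC [_ ^+ 2 * _]mulrC (_ : h = z0 + h - z0); last by ring.
rewrite [z0 + (z0 + h - z0)](_ : _ = z0 + h); last by ring.
by apply=> t /E; [exact: dk|exact: dk'|exact: kG].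
Qed.
End gen.
End Cint.

(** * Green's formula on the disk *)

Section Plane.
Variable R : realType.
Notation C := R[i].
Local Notation mu := (@lebesgue_measure R).
Local Notation pl := (plane R).

Lemma measurable_shift (t : R) : measurable_fun [set: measurableTypeR R] ((fun x => x + t) : measurableTypeR R -> measurableTypeR R).
Proof. by apply: measurable_funD => //; exact: measurable_cst. Qed.

Lemma lebesgue_shift (t : R) (A : set R) : measurable A ->
  pushforward mu ((fun x => x + t) : measurableTypeR R -> measurableTypeR R) A = mu A.
Proof.
move=> mA; apply/esym.
apply: (@lebesgue_measure_unique R (measure_function_pushforward__canonical__measure_function_Measure mu (measurable_shift t))) => //.
move=> _ [[a b] _ <-] /=; rewrite /pushforward.
rewrite (_ : _ @^-1` _ = `]a - t, b - t]%classic); last first.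
  by apply/seteqP; split => x /=; rewrite !in_itv /= ltrBlDr lerBrDr.
rewrite !lebesgue_measure_itv /= !lte_fin ltrD2r.
by case: ifP => // _; rewrite -!EFinB; congr (_%:E); ring.
Qed.

Lemma integral_shift (t : R) (g : R -> R) : rint mu setT g ->
  rint mu setT (fun x : R => g (x + t)) /\
  (\int[mu]_x (g (x + t))%:E = \int[mu]_x (g x)%:E)%E.
Proof.
move=> ig.
have mg : measurable_fun setT g by exact: rint_meas ig.
have mgt : measurable_fun setT (fun x : R => g (x + t)).
  exact: measurableT_comp mg (measurable_shift t).
have pf (h : R -> \bar R) : measurable_fun setT h ->
    (forall x, 0 <= h x)%E -> (\int[mu]_x ((h \o (fun x : R => x + t)%R) x) = \int[mu]_x h x)%E.
  move=> mh h0.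
  have := @ge0_integral_pushforward _ _ _ _ R _ (measurable_shift t) mu setT h measurableT mh (fun x _ => h0 x).
  rewrite preimage_setT => /esym E; rewrite [LHS]E.
  by apply: (@eq_measure_integral _ _ _ _ mu (measure_function_pushforward__canonical__measure_function_Measure mu (measurable_shift t))) => A mA _; exact: lebesgue_shift.
have igt : rint mu setT (fun x : R => g (x + t)).
  apply/integrableP; split; first exact/measurable_EFinP.
  rewrite [X in (X < _)%E](pf (fun x => `|(g x)%:E|%E)) //; first by case/integrableP: ig.
  by apply: measurableT_comp => //; exact/measurable_EFinP.
split => //.
have := @integral_pushforward _ _ _ _ R _ (measurable_shift t) mu setT (EFin \o g).
have mE : measurable_fun setT (EFin \o g) by exact/measurable_EFinP.
move=> /(_ mE); rewrite preimage_setT => /(_ igt measurableT) /esym E.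
rewrite [LHS]E.
by apply: (@eq_measure_integral _ _ _ _ mu (measure_function_pushforward__canonical__measure_function_Measure mu (measurable_shift t))) => A mA _; exact: lebesgue_shift.
Qed.

(* The difference quotients of g have integral zero and are dominated by L. *)
Lemma integral_deriv_lip0 (s L : R) (g g' : R -> R) : 0 <= s -> measurable_fun `]- s, s[ g' ->
  (forall x y : R, `|g x - g y| <= L * `|x - y|) ->
  (forall x : R, s <= `|x| -> g x = 0) ->
  (forall x : R, `|x| < s -> rderiv g x (g' x)) ->
  (\int[mu]_(x in `]- s, s[%classic%R) (g' x)%:E = 0)%E.
Proof.
move=> s0 mg' gL g0 dg.
have L0 : 0 <= L.
  by have := gL 1 0; rewrite subr0 normr1 mulr1; exact: le_trans.
have cg : continuous g.
  move=> x; apply/cvgrPdist_le => e e0; near=> y.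
  apply: le_trans (gL _ _) _.
  apply: (@le_trans _ _ ((L + 1) * `|x - y|)); first by rewrite ler_wpM2r // lerDl.
  rewrite mulrC -ler_pdivlMr; last by rewrite ltr_wpDl.
  near: y; apply: cvgr_dist_le; first exact: cvg_id.
  by rewrite divr_gt0 // ltr_wpDl.
have mg : measurable_fun setT g by exact: continuous_measurable_fun.
(* The translations are by 1/(n+1) <= 1, so all difference quotients vanish outside
   [-(s+1), s+1]. *)
pose I : set R := `[- (s + 1), s + 1]%classic.
have mI : measurable I by exact: measurable_itv.
have iI (k : R) : rint mu setT (fun x : R => k * \1_I x).
  apply: rintZ => //; exact: (integrable_indic_itv (- (s + 1)) (s + 1) true false).
have gb (x : R) : `|g x| <= (L * (s + 1)) * \1_I x.
  have [h|h] := leP s `|x|.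
    by rewrite g0 // normr0 mulr_ge0 ?mulr_ge0 ?addr_ge0.
  have -> : \1_I x = 1 :> R.
    rewrite indicE mem_set //= /I /= in_itv /= -ler_norml.
    by rewrite (le_trans (ltW h)) // lerDl.
  have := gL x (if 0 <= x then s else - s).
  rewrite (g0 (if _ then _ else _)); last by case: ifP; rewrite ?normrN ler_norm.
  rewrite subr0 mulr1 => /le_trans; apply; rewrite ler_wpM2l //.
  apply: (@le_trans _ _ s); last by rewrite lerDl.
  move: h; rewrite ltr_norml => /andP[h1 h2].
  by case: ifPn => [x0|]; [rewrite ltr0_norm|rewrite -ltNge => x0; rewrite gtr0_norm]; lra.
have ig : rint mu setT g by apply: rint_dom (iI _) _.
pose V n (x : R) := n.+1%:R * (g (x + n.+1%:R^-1) - g x).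
have mV n : measurable_fun setT (V n).
  apply: measurable_funM; first exact: measurable_cst.
  apply: measurable_funB => //; exact: measurableT_comp mg (measurable_shift _).
have V0 n : (\int[mu]_x (V n x)%:E = 0)%E.
  have [i1 E] := integral_shift n.+1%:R^-1 ig.
  under eq_integral do rewrite /V EFinM EFinB.
  rewrite integralZl //; last exact: integrableB.
  by rewrite integralB // E subee ?mule0 //; exact: integrable_fin_num.
pose f (x : R) := if `|x| < s then g' x else 0.
have E : f = g' \_ `]- s, s[.
  by apply/funext => x; rewrite /f patchE mem_setE in_itv /= -ltr_norml.
have mf : measurable_fun setT f.
  by rewrite E; apply/(measurable_restrictT _ _).1 => //; exact: measurable_itv.
(* At x = -s the right difference quotients may have a nonzero limit while f is 0 there; this single
   point is null. *)
have conv (x : R) : x != - s -> (fun n => (V n x)%:E) @ \oo --> (f x)%:E.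
  move=> xs; apply: cvg_EFin; first exact: nearW.
  rewrite /f; case: ifPn => [xlt|].
    apply/cvgrPdist_le => e e0; have [d d0 H] := dg _ xlt e e0.
    near=> n; have n0 : n.+1%:R^-1 > 0 :> R by rewrite invr_gt0.
    have := H n.+1%:R^-1; rewrite gtr0_norm // => /(_ ltac:(near: n; exact: near_infty_natSinv_lt (PosNum d0))).
    rewrite -ler_pdivrMr // => h; rewrite distrC; apply: le_trans h.
    rewrite (_ : V n x - g' x = (g (x + n.+1%:R^-1) - g x - g' x * n.+1%:R^-1) * n.+1%:R); last first.
      rewrite /V; move: (g (_ + _)) => A; have : n.+1%:R != 0 :> R by rewrite pnatr_eq0.
      by move: (_%:R) => N N0; field.
    by rewrite normrM [`|_%:R|]ger0_norm // invrK.
  rewrite -leNgt => h.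
  have [h'|h'] := leP s x.
    apply: cvg_near_cst; near=> n.
    rewrite [LHS]/= /V (g0 x) // g0 ?subrr ?mulr0 //.
    by rewrite (le_trans h') // (le_trans _ (ler_norm _)) // lerDl invr_ge0.
  have xs' : x < - s.
    by rewrite lt_def eq_sym xs /= lerNr; move: h; rewrite ler_normr leNgt h'.
  have h0 : 0 < - s - x by rewrite subr_gt0.
  apply: cvg_near_cst; near=> n.
  rewrite [LHS]/= /V (g0 x) // g0 ?subrr ?mulr0 //.
  rewrite -normrN (le_trans _ (ler_norm _)) // opprD lerBrDr.
  have /ltW : n.+1%:R^-1 < - s - x by near: n; exact: near_infty_natSinv_lt (PosNum h0).
  by move: (_^-1) => q hh; lra.
have dom n (x : R) : (`|(V n x)%:E| <= (L * \1_I x)%:E)%E.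
  rewrite lee_fin /V normrM [`|_%:R|]ger0_norm //.
  have [xI|xI] := boolP (x \in I).
    rewrite indicE xI mulr1; apply: le_trans (ler_wpM2l _ (gL _ _)) _ => //.
    rewrite addrAC subrr add0r ger0_norm ?invr_ge0 // mulrCA mulfV ?mulr1 //.
  rewrite indicE (negbTE xI) mulr0 !g0 ?subrr ?normr0 ?mulr0 //.
    move: xI; rewrite notin_setE /I /= in_itv /= -ler_norml => /negP; rewrite -ltNge => h.
    by apply: ltW; apply: le_lt_trans h; rewrite lerDl.
  move: xI; rewrite notin_setE /I /= in_itv /= -ler_norml => /negP; rewrite -ltNge => h.
  have n1 : `|n.+1%:R^-1| <= 1 :> R by rewrite ger0_norm ?invr_ge0 // invf_le1 // ler1n.
  have := ler_normD (x + n.+1%:R^-1) (- n.+1%:R^-1); rewrite addrK normrN; lra.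
have m1 n : measurable_fun setT (fun x : R => (V n x)%:E) by exact/measurable_EFinP.
have m2 : measurable_fun setT (fun x : R => (f x)%:E) by exact/measurable_EFinP.
have c1 : {ae mu, forall x : R, setT x -> (fun n => (V n x)%:E) @ \oo --> (f x)%:E}.
  exists [set - s]; split => //; first exact: lebesgue_measure_set1.
  move=> x /= nx; apply: contrapT => /eqP xs; apply: nx => _; exact: conv.
have c2 : {ae mu, forall (x : R) n, setT x -> (`|(V n x)%:E| <= (L * \1_I x)%:E)%E}.
  by apply: aeW => x n _; exact: dom.
have [_ _ HH] := @dominated_convergence _ _ R mu setT measurableT _ _ _ m1 m2 c1 (iI L) c2.
have Z : (\int[mu]_x (f x)%:E = 0)%E.
  apply: (cvg_unique _ HH) => //=.
  rewrite (_ : (fun x => _) = cst 0%E); last by apply/funext => n /=; exact: V0.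
  exact: cvg_cst.
rewrite -[RHS]Z integral_mkcond E; apply: eq_integral => x _.
by rewrite !patchE; case: ifP.
Unshelve. all: end_near. Qed.

End Plane.

(** * Measurability in the plane and Green's formula in one direction *)

Section Plane2.
Variable R : realType.
Notation C := R[i].
Local Notation mu := (@lebesgue_measure R).
Local Notation pl := (plane R).
Local Notation cx := (@cplx R).
Local Notation DD := (@diskR2 R).

Definition ncopen (A : set C) := forall z, A z -> exists2 r : R, 0 < r & forall w, nc (w - z) < r -> A w.

(** The set is the union of the countably many squares with rational centre and half-side 1/(n+1)
    that it contains, and each of these is a measurable rectangle. *)
Lemma ncopen_measurable (A : set C) : ncopen A -> measurable (cx @^-1` A).
Proof.
move=> oA.
pose rect (i : rat * rat * nat) : set pl :=
  (ball (ratr i.1.1 : R) i.2.+1%:R^-1) `*` (ball (ratr i.1.2 : R) i.2.+1%:R^-1).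
have mrect i : measurable (rect i).
  by apply: measurableX; exact: measurable_ball.
pose F i := if pselect (rect i `<=` cx @^-1` A) then rect i else set0.
have -> : cx @^-1` A = \bigcup_i F i.
  apply/seteqP; split => [[x y] /= Axy|p [i _]]; last first.
    by rewrite /F; case: pselect => // h; exact: h.
  have [r r0 H] := oA _ Axy.
  (* Two points of a square of half-side 1/(n+1) differ by less than 2/(n+1) in each coordinate,
     hence by less than 4/(n+1) in modulus. *)
  pose n := Num.bound (4 / r).
  have n0 : 0 < n.+1%:R^-1 :> R by rewrite invr_gt0.
  have nr : 4 * n.+1%:R^-1 < r.
    rewrite ltr_pdivrMr // mulrC -ltr_pdivrMr //.
    apply: lt_trans (archi_boundP _) _; first by rewrite divr_ge0 // ltW.
    by rewrite ltr_nat.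
  have appr (u : R) : exists p : rat, `|ratr p - u| < n.+1%:R^-1.
    have [|q] := @rat_in_itvoo R (u - n.+1%:R^-1) (u + n.+1%:R^-1).
      by move: n0; move: (_^-1) => q; lra.
    rewrite in_itv /= => /andP[h1 h2]; exists q; rewrite ltr_norml.
    by move: h1 h2; move: (_^-1) => e; lra.
  have [p hp] := appr x; have [q hq] := appr y.
  exists (p, q, n) => //; rewrite /F; case: (pselect (rect (p, q, n) `<=` cx @^-1` A)) => [hs|].
    by split; rewrite /ball /=.
  move=> hn; exfalso; apply: hn; case=> x' y'; rewrite /rect /= => h12; case: h12 => /= h1 h2; apply: H.
  apply: le_lt_trans (nc_ReIm _) _; rewrite /cplx /=.
  apply: le_lt_trans nr.
  move: h1 h2; rewrite /ball /= => h1 h2.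
  have -> : x' - x = (ratr p - x) - (ratr p - x') by ring.
  have -> : y' - y = (ratr q - y) - (ratr q - y') by ring.
  have := ler_normB (ratr p - x) (ratr p - x').
  have := ler_normB (ratr q - y) (ratr q - y').
  move: h1 h2 hp hq; move: (_^-1) => e; lra.
apply: (@countable_bigcupT_measurable _ pl); first exact: countableP.
by move=> i; rewrite /F; case: (pselect (rect i `<=` cx @^-1` A)) => h; [exact: mrect|exact: measurable0].
Qed.

Lemma ncopen_disk : ncopen [set z : C | nc z < 1].
Proof.
move=> z /= z1; exists (1 - nc z); first by rewrite subr_gt0.
move=> w /= h; rewrite (_ : w = (w - z) + z); last by ring.
by apply: le_lt_trans (ncD _ _) _; rewrite -ltrBrDr.
Qed.

Lemma unit_diskE (z : C) : unit_disk R z = (nc z < 1).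
Proof. by rewrite /unit_disk /= normcE -(rmorph1 (real_complex R)) ltcR. Qed.

Lemma diskR2E (p : pl) : DD p = (nc (cx p) < 1).
Proof. exact: unit_diskE. Qed.

Lemma measurable_disk : measurable DD.
Proof.
rewrite (_ : DD = cx @^-1` [set z | nc z < 1]); last by apply/funext => p; rewrite diskR2E.
exact: ncopen_measurable ncopen_disk.
Qed.

Definition nccont (f : C -> C) z := forall e : R, 0 < e -> exists2 d : R, 0 < d &
  forall w, nc (w - z) < d -> nc (f w - f z) < e.

Lemma nccont_meas (A : set C) (f : C -> C) : ncopen A -> (forall z, A z -> nccont f z) ->
  cmeas (cx @^-1` A) (fun p => f (cx p)).
Proof.
move=> oA cf.
(* [h] will be the real and the imaginary part; that it is 1-Lipschitz makes preimages of half-lines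
   open. *)
have main (h : C -> R) : (forall z w, `|h z - h w| <= nc (z - w)) ->
    measurable_fun (cx @^-1` A) (fun p => h (f (cx p))).
  move=> hh mA; apply: (measurability _ (RGenOInfty.measurableE R)) => //.
  move=> _ [_ [a ->] <-].
  rewrite (_ : _ `&` _ = cx @^-1` [set z | A z /\ a < h (f z)]); last first.
    by apply/seteqP; split => p /=; rewrite in_itv /= andbT.
  apply: ncopen_measurable => z [/= Az az].
  have [r r0 H] := oA _ Az.
  have [d d0 H'] := cf _ Az (h (f z) - a) ltac:(by rewrite subr_gt0).
  exists (Num.min r d); first by rewrite lt_min r0.
  move=> w; rewrite lt_min => /andP[/H Aw /H' fw]; split => //=.
  have := hh (f w) (f z); rewrite ler_norml; lra.
split.
  by apply: main => z w; rewrite -(raddfB (@complex.Re R)); exact: normRe_nc.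
by apply: main => z w; rewrite -(raddfB (@complex.Im R)); exact: normIm_nc.
Qed.

Lemma rint_mscale (F : pl -> R) : rint (mu \x mu)%E setT F ->
  rint (dA R) setT F /\ (\int[dA R]_p (F p)%:E = (pi^-1)%:E * \int[(mu \x mu)]_p (F p)%:E)%E.
Proof.
move=> iF; have mF := measurable_int _ iF.
have E (G : pl -> \bar R) : measurable_fun setT G -> (forall x, 0 <= G x)%E ->
   (\int[dA R]_p G p = (pi^-1)%:E * \int[(mu \x mu)]_p G p)%E.
  by move=> mG G0; rewrite ge0_integral_mscale.
split.
  apply/integrableP; split=> //; rewrite E //; last exact: measurableT_comp.
  apply: lte_mul_pinfty; rewrite ?lee_fin ?invr_ge0 ?pi_ge0 //.
  by case/integrableP: iF.
have ip := integrable_funepos measurableT iF.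
have inn := integrable_funeneg measurableT iF.
rewrite [LHS]integralE [X in (_ * X)%E]integralE.
rewrite !E //; [|exact: measurable_funeneg|exact: measurable_funepos].
rewrite [RHS]muleBr //. by apply: integrable_add_def.
Qed.

Lemma box_measure (a b : R) (r : R) : 0 <= r ->
  (mu \x mu)%E (`[a - r, a + r]%classic `*` `[b - r, b + r]%classic : set pl) = ((2 * r) ^+ 2)%:E.
Proof.
move=> r0; rewrite [LHS]product_measure1E //; try exact: measurable_itv.
have itv c : mu `[c - r, c + r]%classic = (2 * r)%:E.
  rewrite lebesgue_measure_itv /= lte_fin; case: ltP => h.
    by rewrite -EFinB; congr (_%:E); ring.
  by congr (_%:E); have : r = 0 by [lra]; move=> ->; rewrite mulr0.
transitivity ((2 * r)%:E * (2 * r)%:E)%E; last by rewrite -EFinM expr2.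
by congr (_ * _)%E; exact: itv.
Qed.

(* Specialised to the disk, so that its measurability is not a side condition. *)
Definition dcintD := @cintD R _ _ (dA R) _ measurable_disk.
Definition dcintZ := @cintZ R _ _ (dA R) _ measurable_disk.
Definition dcintB := @cintB R _ _ (dA R) _ measurable_disk.
Definition dcint_sum := @cint_sum R _ _ (dA R) _ measurable_disk.
Definition dcint_eq := @cint_eq R _ _ (dA R) _ measurable_disk.
Definition dCID := @CID R _ _ (dA R) _ measurable_disk.
Definition dCIZ := @CIZ R _ _ (dA R) _ measurable_disk.
Definition dCIN := @CIN R _ _ (dA R) _ measurable_disk.
Definition dCIB := @CIB R _ _ (dA R) _ measurable_disk.
Definition dCI_sum := @CI_sum R _ _ (dA R) _ measurable_disk.
Definition dCIJ := @CIJ R _ _ (dA R) _ measurable_disk.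
Definition dCI_le := @CI_le R _ _ (dA R) _ measurable_disk.
Definition dcint_dom := @cint_dom R _ _ (dA R) _ measurable_disk.
Definition dcint_nc := @cint_nc R _ _ (dA R) _ measurable_disk.
Definition drint_dom := @rint_dom R _ _ (dA R) _ measurable_disk.
Definition drintD := @rintD R _ _ (dA R) _ measurable_disk.
Definition drintZ := @rintZ R _ _ (dA R) _ measurable_disk.
Definition drint_eq := @rint_eq R _ _ (dA R) _ measurable_disk.
Definition dCI_cderiv := @CI_cderiv R _ _ (dA R) _ measurable_disk.

Lemma disk_lty : (dA R DD < +oo)%E.
Proof.
rewrite /dA /mscale /=; apply: lte_mul_pinfty; rewrite ?lee_fin ?invr_ge0 ?pi_ge0 //.
have sub : DD `<=` `[(0 - 1)%R, (0 + 1)%R]%classic `*` `[(0 - 1)%R, (0 + 1)%R]%classic.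
  move=> [x y]; rewrite diskR2E /cplx => h; split; rewrite /= in_itv /= !add0r -ler_norml ltW //.
    by apply: le_lt_trans h; exact: normRe_nc (x +i* y).
  by apply: le_lt_trans h; exact: normIm_nc (x +i* y).
have h : ((mu \x mu)%E DD <= (mu \x mu)%E (`[(0 - 1)%R, (0 + 1)%R]%classic `*` `[(0 - 1)%R, (0 + 1)%R]%classic : set pl))%E.
  apply: le_measure => //; rewrite ?inE; first exact: measurable_disk.
  by apply: measurableX; exact: measurable_itv.
by rewrite box_measure ?ler01 // in h; apply: le_lt_trans h _; exact: ltry.
Qed.

Lemma rint_bnd (F : pl -> R) (M : R) : measurable_fun DD F -> (forall p, DD p -> `|F p| <= M) ->
  rint (dA R) DD F.
Proof.
move=> mF bF; apply: measurable_bounded_integrable => //; [exact: measurable_disk|exact: disk_lty|].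
exists M; split; first exact: num_real.
by move=> x Mx p /bF h; exact: le_trans h (ltW Mx).
Qed.

Lemma cint_bnd (f : pl -> C) (M : R) : cmeas DD f -> (forall p, DD p -> nc (f p) <= M) ->
  cint (dA R) DD f.
Proof.
by move=> mf bf; split; (apply: (@rint_bnd _ M); first by case: mf) => p /bf;
  apply: le_trans; [exact: normRe_nc|exact: normIm_nc].
Qed.

Lemma rderiv_seq (h : R -> R) l : rderiv h 0 l ->
  (fun n : nat => n.+1%:R * (h n.+1%:R^-1 - h 0)) @ \oo --> l.
Proof.
move=> H; apply/cvgrPdist_le => e e0; have [d d0 {}H] := H e e0.
near=> n; have n0 : n.+1%:R^-1 > 0 :> R by rewrite invr_gt0.
have := H n.+1%:R^-1; rewrite gtr0_norm // => /(_ ltac:(near: n; exact: near_infty_natSinv_lt (PosNum d0))).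
rewrite -ler_pdivrMr // => hh; rewrite distrC; apply: le_trans hh.
rewrite add0r invrK.
have -> : n.+1%:R * (h n.+1%:R^-1 - h 0) - l = (h n.+1%:R^-1 - h 0 - l * n.+1%:R^-1) * n.+1%:R.
  have : n.+1%:R != 0 :> R by rewrite pnatr_eq0.
  by move: (h (_^-1)) => A; move: (_%:R) => N N0; field.
by rewrite normrM [`|_%:R|]ger0_norm.
Unshelve. all: end_near. Qed.

Lemma nc_imag (x : R) : nc (0 +i* x) = `|x|.
Proof. by rewrite /= expr0n /= add0r sqrtr_sqr. Qed.

Section green.
Variables (L : R) (U U' : C -> R) (q : C).
Hypothesis q1 : nc q = 1.
Hypothesis UL : forall z w, `|U z - U w| <= L * nc (z - w).
Hypothesis U0 : forall z, 1 <= nc z -> U z = 0.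
Hypothesis dU : forall z, nc z < 1 -> rderiv (fun x => U (z + x%:C * q)) 0 (U' z).

(** Extension by zero to the whole plane, so that Fubini applies to the product measure, of which
    [dA] is a multiple. *)
Let F (p : pl) := if nc (cx p) < 1 then U' (cx p) else 0.

Let mU (a : C) : measurable_fun setT (fun p : pl => U (cx p + a)).
Proof.
have := @nccont_meas setT (fun z => (U (z + a))%:C) _ _.
case.
- by move=> z _; exists 1.
- move=> z _ e e0; exists (e / (`|L| + 1)).
    by rewrite divr_gt0 // ltr_wpDl.
  move=> w; rewrite ltr_pdivlMr ?ltr_wpDl // => h.
  rewrite -(rmorphB (real_complex R)) nc_real; apply: le_lt_trans (UL _ _) _.
  rewrite (_ : w + a - (z + a) = w - z); last by ring.
  apply: le_lt_trans h; rewrite mulrC ler_wpM2l ?nc_ge0 // (le_trans (ler_norm _)) // lerDl //.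
by rewrite preimage_setT.
Qed.

(** U' is known only as a pointwise limit of difference quotients of the continuous function U; this
    is what makes it measurable. *)
Lemma green_meas : measurable_fun DD (fun p => U' (cx p)).
Proof.
apply: (@measurable_fun_cvg _ _ _ _ (fun n p => n.+1%:R * (U (cx p + (n.+1%:R^-1)%:C * q) - U (cx p)))).
- move=> n; apply: measurable_funM; first exact: measurable_cst.
  apply: measurable_funTS; apply: measurable_funB; first exact: mU.
  by under eq_fun do rewrite -[cx _]addr0; exact: mU.
- move=> p; rewrite diskR2E => /dU /rderiv_seq.
  by rewrite [0%:C * q]mul0r addr0.
Qed.

Lemma green_bound z : nc z < 1 -> `|U' z| <= L.
Proof.
move=> z1; have H := dU z1.
apply/ler_addgt0Pl => e e0; have [d d0 {}H] := H e e0.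
have := H (d / 2); rewrite gtr0_norm ?divr_gt0 // => /(_ ltac:(lra)).
rewrite add0r mul0r addr0 => {}H.
have := UL (z + (d / 2)%:C * q) z; rewrite (_ : z + _ - z = (d / 2)%:C * q); last by ring.
have d20 : 0 < d / 2 by rewrite divr_gt0.
rewrite ncM q1 mulr1 nc_real (gtr0_norm d20) => H'.
have E : `|U' z| * (d / 2) = `|U' z * (d / 2)| by rewrite normrM (gtr0_norm d20).
rewrite -(ler_pM2r d20) E.
rewrite (_ : U' z * (d / 2) = (U (z + (d / 2)%:C * q) - U z) - (U (z + (d / 2)%:C * q) - U z - U' z * (d / 2))); last by ring.
by apply: le_trans (ler_normB _ _) _; rewrite mulrDl addrC lerD.
Qed.

Lemma green_rint : rint (dA R) DD (fun p => U' (cx p)).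
Proof. by apply: (rint_bnd (M := L) green_meas) => p; rewrite diskR2E => /green_bound. Qed.

Let mF : measurable_fun setT F.
Proof.
have E : F = (fun p => U' (cx p)) \_ DD.
  apply/funext => p; rewrite /F patchE; case: ifPn => h; first by rewrite mem_set // diskR2E.
  by rewrite memNset // diskR2E; exact/negP.
rewrite E; apply/(measurable_restrictT _ _).1; [exact: measurable_disk|exact: green_meas].
Qed.

Lemma F_rint : rint (mu \x mu)%E setT F.
Proof.
have mB : measurable (`[(0 - 1)%R, (0 + 1)%R]%classic `*` `[(0 - 1)%R, (0 + 1)%R]%classic : set pl).
  by apply: measurableX; exact: measurable_itv.
have : rint (mu \x mu)%E (`[(0 - 1)%R, (0 + 1)%R]%classic `*` `[(0 - 1)%R, (0 + 1)%R]%classic : set pl) F.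
  apply: measurable_bounded_integrable => //.
  - apply: (@le_lt_trans _ _ ((2 * 1) ^+ 2)%:E); last exact: ltry.
    by rewrite -(box_measure 0 0 ler01).
  - exact: measurable_funTS.
  exists L; split; first exact: num_real.
  move=> x Lx p _ /=; apply: le_trans (ltW Lx); rewrite /F; case: ifP => [/green_bound //|_].
  by rewrite normr0; have := UL (1) 0; rewrite subr0 nc1 mulr1; exact: le_trans.
move=> /(integrable_mkcond _ mB).1; apply: eq_integrable => // p _.
rewrite patchE; case: ifPn => // /negP h; rewrite /F; case: ifPn => // h1.
exfalso; apply: h; rewrite inE; case: p h1 => x y h; split; rewrite /= in_itv /= !add0r -ler_norml ltW //.
  by apply: le_lt_trans h; exact: normRe_nc (x +i* y).
by apply: le_lt_trans h; exact: normIm_nc (x +i* y).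
Qed.

(** [e] parametrizes the horizontal or vertical line with fixed coordinate y. It meets the disk
    where |x| < sqrt (1 - y^2); for |y| >= 1 the root is 0 and the interval is empty. *)
Lemma green_section (y : R) (e : R -> C) :
  (forall x, nc (e x) ^+ 2 = x ^+ 2 + y ^+ 2) -> (forall x h, e (x + h) = e x + h%:C * q) ->
  measurable_fun setT (fun x => if nc (e x) < 1 then U' (e x) else 0) ->
  (\int[mu]_x (if nc (e x) < 1 then U' (e x) else 0)%:E = 0)%E.
Proof.
move=> ne eD mg.
pose s := Num.sqrt (1 - y ^+ 2).
have s0 : 0 <= s by exact: sqrtr_ge0.
have lt1 x : (nc (e x) < 1) = (`|x| < s).
  rewrite -(ltr_pXn2r (n := 2)) ?nnegrE ?nc_ge0 // expr1n ne.
  have [y1|y1] := leP 0 (1 - y ^+ 2).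
    rewrite -[RHS](ltr_pXn2r (n := 2)) ?nnegrE // sqr_sqrtr // real_normK ?num_real //.
    by rewrite ltrBrDr.
  rewrite /s ler0_sqrtr ?ltW // [RHS]ltNge normr_ge0 /=; apply/negP => h.
  have := sqr_ge0 x; move: h y1; lra.
have mg' : measurable_fun `]- s, s[ (fun x => U' (e x)).
  apply: eq_measurable_fun (measurable_funTS mg) => x.
  by rewrite inE /= in_itv /= -ltr_norml -lt1 => ->.
have eB x z : e x - e z = (x - z)%:C * q.
  by have := eD z (x - z); rewrite [z + _]addrC subrK => ->; ring.
have := @integral_deriv_lip0 R s L (fun x => U (e x)) (fun x => U' (e x)) s0 mg' _ _ _.
move=> H; rewrite -[RHS]H.
- rewrite [RHS]integral_mkcond; apply: eq_integral => x _; rewrite patchE mem_setE in_itv /= -ltr_norml -lt1.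
  by case: ifP.
- by move=> x z; apply: le_trans (UL _ _) _; rewrite eB ncM q1 mulr1 nc_real.
- by move=> x; rewrite leNgt -lt1 -leNgt; exact: U0.
- move=> x; rewrite -lt1 => /dU Hd d /Hd[r r0 {}Hd]; exists r => // h /Hd.
  by rewrite eD !add0r mul0r addr0.
Qed.

Lemma green_int0 : (\int[(mu \x mu)]_p (F p)%:E = 0)%E ->
  \int[dA R]_(p in DD) U' (cx p) = 0.
Proof.
move=> H; have [_] := rint_mscale F_rint; rewrite H mule0 => H'.
rewrite /Rintegral integral_mkcond -[RHS]/(fine 0%E) -H'; congr fine.
apply: eq_integral => p _; rewrite patchE /F; case: ifPn => h; case: ifPn => h' //.
  by move: h h'; rewrite inE diskR2E => ->.
by move: h; rewrite notin_setE diskR2E h'.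
Qed.
End green.

Lemma green_x L U U' : (forall z w, `|U z - U w| <= L * nc (z - w)) ->
  (forall z, 1 <= nc z -> U z = 0) ->
  (forall z, nc z < 1 -> rderiv (fun x => U (z + x%:C)) 0 (U' z)) ->
  rint (dA R) DD (fun p => U' (cx p)) /\ \int[dA R]_(p in DD) U' (cx p) = 0.
Proof.
move=> UL U0 dU'.
have dU z : nc z < 1 -> rderiv (fun x => U (z + x%:C * 1)) 0 (U' z).
  by under eq_fun do rewrite mulr1; exact: dU'.
split; first exact: green_rint (nc1 R) UL dU.
apply: (green_int0 (nc1 R) UL dU).
have iF := F_rint (nc1 R) UL dU.
rewrite -integral21_prod_meas1 // /fubini_G.
rewrite -[RHS](@integral0 _ _ _ mu setT); apply: eq_integral => y _.
apply: (@green_section L U U' 1 (nc1 R) UL U0 dU y (fun x => x +i* y)).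
- by move=> x; rewrite nc_sqr.
- by move=> x h; rewrite mulr1; apply/eqP; rewrite eq_complex /= addr0 !eqxx.
- have := rint_meas iF => mF.
  exact: (measurableT_comp mF (pair2_measurable y)).
Qed.

Lemma green_y L U U' : (forall z w, `|U z - U w| <= L * nc (z - w)) ->
  (forall z, 1 <= nc z -> U z = 0) ->
  (forall z, nc z < 1 -> rderiv (fun x => U (z + x%:C * 'i)) 0 (U' z)) ->
  rint (dA R) DD (fun p => U' (cx p)) /\ \int[dA R]_(p in DD) U' (cx p) = 0.
Proof.
move=> UL U0 dU.
have nci : nc ('i : C) = 1 by rewrite nc_imag normr1.
split; first exact: green_rint nci UL dU.
apply: (green_int0 nci UL dU).
have iF := F_rint nci UL dU.
rewrite -integral12_prod_meas1 // /fubini_F.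
rewrite -[RHS](@integral0 _ _ _ mu setT); apply: eq_integral => y _.
apply: (@green_section L U U' 'i nci UL U0 dU y (fun x => y +i* x)).
- by move=> x; rewrite nc_sqr /= addrC.
- by move=> x h; apply/eqP; rewrite eq_complex /= !mulr0 !mul0r subr0 !addr0 mulr1 !eqxx.
- have := rint_meas iF => mF.
  exact: (measurableT_comp mF (pair1_measurable y)).
Qed.

End Plane2.

(** * Stokes formulas for Wirtinger derivatives *)

Section Green.
Variable R : realType.
Notation C := R[i].
Local Notation cx := (@cplx R).
Local Notation DD := (@diskR2 R).
Local Notation CI f := (Cintegral (dA R) DD (fun p => f (cx p))).
Local Notation dint f := (cint (dA R) DD (fun p => f (cx p))).

Lemma ReMi (z : C) : Re (- 'i * z) = Im z.
Proof. by case: z => x y /=; rewrite oppr0 mul0r sub0r mulN1r opprK. Qed.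

(** The derivative of U along 1 is a + b and along i it is i (a - b). Both integrate to zero, and a
    and b are recovered as half-sums. *)
Lemma green_lip (L : R) (U a b : C -> C) :
  (forall z w, nc (U z - U w) <= L * nc (z - w)) ->
  (forall z, 1 <= nc z -> U z = 0) ->
  (forall z, nc z < 1 -> wderiv U z (a z) (b z)) ->
  [/\ dint a, dint b, CI a = 0 & CI b = 0].
Proof.
move=> UL U0 dU.
have L0 : 0 <= L.
  by have := UL 1 0; rewrite subr0 nc1 mulr1; apply: le_trans; exact: nc_ge0.
have lipk k : nc k = 1 -> forall z w, `|Re (k * U z) - Re (k * U w)| <= L * nc (z - w).
  move=> k1 z w; rewrite -(raddfB (@complex.Re R)) -mulrBr.
  by apply: le_trans (normRe_nc _) _; rewrite ncM k1 mul1r.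
have zk (k : C) z : 1 <= nc z -> Re (k * U z) = 0 by move=> /U0 ->; rewrite mulr0.
have i1 : nc (- 'i : C) = 1 by rewrite ncN nc_imag normr1.
have ci : cj 'i = - 'i :> C by apply/eqP; rewrite eq_complex /= oppr0 !eqxx.
have GX k : nc k = 1 -> rint (dA R) DD (fun p => Re (k * (a (cx p) + b (cx p)))) /\
    \int[dA R]_(p in DD) Re (k * (a (cx p) + b (cx p))) = 0.
  move=> k1; apply: (green_x (U := fun z => Re (k * U z)) (U' := fun z => Re (k * (a z + b z))) (lipk _ k1) (zk k)) => z /dU H.
  have := @wderiv_line R U z 1 0 (a z) (b z) k.
  rewrite mul0r addr0 => /(_ H); rewrite conjc1 !mulr1.
  by under eq_fun do rewrite mulr1.
have GY k : nc k = 1 -> rint (dA R) DD (fun p => Re (k * ('i * (a (cx p) - b (cx p))))) /\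
    \int[dA R]_(p in DD) Re (k * ('i * (a (cx p) - b (cx p)))) = 0.
  move=> k1; apply: (green_y (U := fun z => Re (k * U z)) (U' := fun z => Re (k * ('i * (a z - b z)))) (lipk _ k1) (zk k)) => z /dU H.
  have := @wderiv_line R U z 'i 0 (a z) (b z) k.
  rewrite [0%:C * _]mul0r addr0 => /(_ H); rewrite ci.
  by rewrite (_ : a z * 'i + b z * - 'i = 'i * (a z - b z)) //; ring.
have mk (f : C -> C) : (forall k, nc k = 1 -> rint (dA R) DD (fun p => Re (k * f (cx p))) /\
     \int[dA R]_(p in DD) Re (k * f (cx p)) = 0) -> dint f /\ CI f = 0.
  move=> H; have [h1 h2] := H 1 (nc1 R); have [h3 h4] := H _ i1.
  split.
    split; first by move: h1; under eq_fun do rewrite mul1r.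
    by move: h3; under eq_fun do rewrite ReMi.
  rewrite /Cintegral; apply/eqP; rewrite eq_complex /= -[X in (_ == X) && _]h2 -[X in _ && (_ == X)]h4.
  apply/andP; split; apply/eqP; apply: eq_Rintegral => p _; first by rewrite mul1r.
  by rewrite ReMi.
have [s1 s2] := mk (fun z => a z + b z) GX.
have [d1 d2] := mk (fun z => 'i * (a z - b z)) GY.
have ii : 'i * 'i = -1 :> C by apply/eqP; rewrite eq_complex /= !mul0r !mulr0 mulr1 sub0r addr0 oppr0 !eqxx.
have E1 z : 2^-1 * ((a z + b z) + - 'i * ('i * (a z - b z))) = a z.
  rewrite (_ : - 'i * ('i * (a z - b z)) = - ('i * 'i) * (a z - b z)); last by ring.
  by rewrite ii; field.
have E2 z : 2^-1 * ((a z + b z) + 'i * ('i * (a z - b z))) = b z.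
  rewrite (_ : 'i * ('i * (a z - b z)) = ('i * 'i) * (a z - b z)); last by ring.
  by rewrite ii; field.
split.
- have h : cint (dA R) DD (fun p => 2^-1 * ((a (cx p) + b (cx p)) + - 'i * ('i * (a (cx p) - b (cx p))))) by apply: dcintZ; apply: dcintD => //; exact: dcintZ.
  by apply: dcint_eq h => p _; rewrite ?E1 ?E2.
- have h : cint (dA R) DD (fun p => 2^-1 * ((a (cx p) + b (cx p)) + 'i * ('i * (a (cx p) - b (cx p))))) by apply: dcintZ; apply: dcintD => //; exact: dcintZ.
  by apply: dcint_eq h => p _; rewrite ?E1 ?E2.
- transitivity (Cintegral (dA R) DD (fun p => 2^-1 * ((a (cx p) + b (cx p)) + - 'i * ('i * (a (cx p) - b (cx p)))))); first by apply: CI_eq => p _; rewrite ?E1 ?E2.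
  rewrite dCIZ; last by apply: dcintD => //; exact: dcintZ.
  by rewrite dCID //; [rewrite dCIZ // s2 d2 mulr0 addr0 mulr0|exact: dcintZ].
- transitivity (Cintegral (dA R) DD (fun p => 2^-1 * ((a (cx p) + b (cx p)) + 'i * ('i * (a (cx p) - b (cx p)))))); first by apply: CI_eq => p _; rewrite ?E1 ?E2.
  rewrite dCIZ; last by apply: dcintD => //; exact: dcintZ.
  by rewrite dCID //; [rewrite dCIZ // s2 d2 mulr0 addr0 mulr0|exact: dcintZ].
Qed.

Definition rho (z : C) : C := 1 - z * cj z.

Lemma rhoE z : rho z = (1 - nc z ^+ 2)%:C.
Proof. by rewrite /rho mulJ [RHS]rmorphB /= rmorph1. Qed.

Lemma nc_rho z : nc z <= 1 -> nc (rho z) <= 1 - nc z ^+ 2.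
Proof.
move=> z1; rewrite rhoE nc_real ger0_norm // subr_ge0 expr_le1 //; exact: nc_ge0.
Qed.

Lemma wderiv_rho z : wderiv rho z (- cj z) (- z).
Proof.
have idz := (cderivW _ _ _).1 (cderiv_id z).
have := wderivM idz (wderivJ idz).
rewrite conjc0 conjc1 mulr0 addr0 mul0r add0r mul1r mulr1 => H.
have := wderivD ((cderivW _ _ _).1 (cderiv_cst 1 z)) (wderiv_comp H (cderivN (cderiv_id (z * cj z)))).
by rewrite !mulN1r !add0r.
Qed.

Lemma disk_segment (z w : C) (t : R) : nc z < 1 -> nc w < 1 -> 0 <= t <= 1 -> nc (z + t%:C * (w - z)) < 1.
Proof.
move=> z1 w1 /andP[t0 t1].
have -> : z + t%:C * (w - z) = (1 - t)%:C * z + t%:C * w by rewrite rmorphB rmorph1 /=; ring.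
apply: le_lt_trans (ncD _ _) _; rewrite !ncM !nc_real !ger0_norm ?subr_ge0 //.
have [t2|t2] := ltP t 1.
  have : (1 - t) * nc z < (1 - t) * 1 by rewrite ltr_pM2l // subr_gt0.
  have : t * nc w <= t * 1 by rewrite ler_wpM2l // ltW.
  lra.
have -> : t = 1 by apply/eqP; rewrite eq_le t1 t2.
by rewrite subrr mul0r add0r mul1r.
Qed.

(* Stokes' theorem on the disk for the field rho * G, which vanishes on the circle *)
Lemma green_rho (B M : R) (G a b : C -> C) :
  (forall z, nc z < 1 -> wderiv G z (a z) (b z)) ->
  (forall z, nc z < 1 -> nc (G z) <= B) ->
  (forall z, nc z < 1 -> nc (a z) + nc (b z) <= M) ->
  [/\ dint (fun z => rho z * a z - cj z * G z), dint (fun z => rho z * b z - z * G z),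
      CI (fun z => rho z * a z - cj z * G z) = 0 & CI (fun z => rho z * b z - z * G z) = 0].
Proof.
move=> dG GB abM.
have B0 : 0 <= B by apply: le_trans (nc_ge0 _) (GB 0 _); rewrite nc0.
have M0 : 0 <= M by apply: le_trans (abM 0 _); rewrite ?nc0 // addr_ge0 // nc_ge0.
(* G need not have boundary values, but rho G extended by zero is Lipschitz on the plane: 2 B comes
   from the variation of rho, M from that of G. *)
pose U z := if nc z < 1 then rho z * G z else 0.
apply: (@green_lip (2 * B + M) U (fun z => rho z * a z - cj z * G z) (fun z => rho z * b z - z * G z)).
- have Gl z w : nc z < 1 -> nc w < 1 -> nc (G z - G w) <= M * nc (z - w).
    move=> z1 w1; apply: (@nc_mvtW _ _ a b) => t t01.
      by apply: dG; exact: disk_segment.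
    by apply: abM; exact: disk_segment.
  (* A point inside and a point outside: 1 - |z|^2 <= 2 (1 - |z|) <= 2 |z - w|. *)
  have key z w : nc z < 1 -> 1 <= nc w -> nc (rho z * G z) <= (2 * B + M) * nc (z - w).
    move=> z1 w1; rewrite ncM.
    apply: (@le_trans _ _ ((1 - nc z ^+ 2) * B)).
      by apply: ler_pM; rewrite ?nc_ge0 ?GB // nc_rho // ltW.
    have zw : 1 - nc z <= nc (z - w) by have := ncBl w z; rewrite ncBC; lra.
    have := nc_ge0 z; set r := nc z in z1 zw *; set e := nc (z - w) in zw * => r0.
    apply: (@le_trans _ _ (2 * e * B)).
      by rewrite ler_wpM2r // expr2; nra.
    have : 0 <= M * e by rewrite mulr_ge0 // nc_ge0.
    by move=> ?; lra.
  move=> z w; rewrite /U; case: ltP => z1; case: ltP => w1.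
  + have -> : rho z * G z - rho w * G w = (rho z - rho w) * G z + rho w * (G z - G w) by ring.
    apply: le_trans (ncD _ _) _; rewrite !ncM mulrDl; apply: lerD.
      rewrite mulrAC; apply: ler_pM; rewrite ?nc_ge0 ?GB //.
      rewrite !rhoE -(rmorphB (real_complex R)) nc_real.
      rewrite (_ : 1 - nc z ^+ 2 - (1 - nc w ^+ 2) = - ((nc z - nc w) * (nc z + nc w))); last by ring.
      rewrite normrN normrM mulrC; apply: ler_pM => //.
        by rewrite ger0_norm ?addr_ge0 ?nc_ge0 //; lra.
      by rewrite ler_norml ncBl andbT; have := ncBl w z; rewrite [nc (w - z)]ncBC; lra.
    rewrite -[leRHS]mul1r; apply: ler_pM; rewrite ?nc_ge0 ?Gl //.
    apply: le_trans (nc_rho (ltW w1)) _; rewrite gerBl; exact: sqr_ge0.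
  + by rewrite subr0; exact: key.
  + by rewrite sub0r ncN ncBC; exact: key.
  + by rewrite subrr nc0 mulr_ge0 ?nc_ge0 // addr_ge0 // mulr_ge0.
- by move=> z z1; rewrite /U ltNge z1.
- move=> z z1.
  have [r r0 H] := ncopen_disk z1.
  apply: (@wderiv_near _ (fun w => rho w * G w) _ _ _ _ r r0).
    by move=> w /H; rewrite /U /= => ->.
  by apply: wderiv_eq (wderivM (wderiv_rho z) (dG _ z1)) _ _; ring.
Qed.
End Green.

(** * Area of the unit disk *)

Section Area.
Variable R : realType.
Notation C := R[i].
Local Notation cx := (@cplx R).
Local Notation DD := (@diskR2 R).
Local Notation mu := (@lebesgue_measure R).

(** The substitution x = sin t turns the integrand into 2 cos^2 t, with primitive t + sin t cos
    t. *)
Lemma integral_semicircle :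
  (\int[mu]_(x in `[(- 1)%R, 1%R]) (2 * Num.sqrt (1 - x ^+ 2))%:E = (pi : R)%:E)%E.
Proof.
have p2 : - (pi / 2) < pi / 2 :> R by have := @pi_gt0 R; lra.
have dsin : (@sin R)^`()%classic = cos.
  by apply/funext => x; rewrite derive1E; apply: derive_val.
have sc : continuous (fun x : R => 2 * Num.sqrt (1 - x ^+ 2)).
  move=> x; apply: cvgM; first exact: cvg_cst.
  apply: (@continuous_comp _ _ _ (fun x : R => 1 - x ^+ 2) Num.sqrt); last exact: sqrt_continuous.
  by apply: cvgB; [exact: cvg_cst|exact: exprn_continuous].
have := @integration_by_substitution_increasing R sin (fun x : R => 2 * Num.sqrt (1 - x ^+ 2)) (- (pi / 2)) (pi / 2) (ltW p2).
rewrite sin_pihalf sinN sin_pihalf => -> //; last first.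
- exact: continuous_subspaceT.
- split; first by move=> x _; exact: ex_derive.
  + by apply: cvg_at_right_filter; exact: continuous_sin.
  + by apply: cvg_at_left_filter; exact: continuous_sin.
- by rewrite dsin; apply/cvg_ex; eexists; apply: cvg_at_left_filter; exact: continuous_cos.
- by rewrite dsin; apply/cvg_ex; eexists; apply: cvg_at_right_filter; exact: continuous_cos.
- by move=> x _; rewrite dsin; exact: continuous_cos.
- by move=> x y xi yi xy; rewrite ltr_sin.
pose G (t : R) := t + sin t * cos t.
have dG (t : R) : is_derive t (1 : R) G (2 * cos t ^+ 2).
  have := is_deriveD (is_derive_id t (1 : R)) (is_deriveM (is_derive_sin t) (is_derive_cos t)).
  move=> h; apply: is_derive_eq h _; rewrite /GRing.scale /=.
  have := cos2Dsin2 t; move: (cos t) (sin t) => a b ab; rewrite -[X in X + _]ab; ring.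
have := @continuous_FTC2 R (fun t => 2 * cos t ^+ 2) G _ _ p2.
rewrite /G sinN cosN cos_pihalf !mulr0 !addr0 -EFinB => H.
rewrite [RHS](_ : _ = (pi / 2 - - (pi / 2))%:E); last by congr (_%:E); field.
rewrite -H.
- apply: eq_integral => t /=; rewrite inE /= in_itv /= => ti; rewrite dsin.
  have ct := cos_ge0_pihalf ti.
  have E1 : 1 - sin t ^+ 2 = cos t ^+ 2 by rewrite -(cos2Dsin2 t) addrK.
  have -> : (((fun x : R => 2 * Num.sqrt (1 - x ^+ 2)) \o sin) * cos) t = 2 * Num.sqrt (1 - sin t ^+ 2) * cos t by [].
  by rewrite E1 sqrtr_sqr ger0_norm // -mulrA -expr2.
- apply: continuous_subspaceT => t; apply: cvgM; first exact: cvg_cst.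
  by apply: (@continuous_comp _ _ _ cos (fun x => x ^+ 2)); [exact: continuous_cos|exact: exprn_continuous].
- have cG : continuous G by move=> t; apply: differentiable_continuous; apply/derivable1_diffP; exact: ex_derive.
  split; first by move=> x _; exact: ex_derive.
  + by apply: cvg_at_right_filter; exact: cG.
  + by apply: cvg_at_left_filter; exact: cG.
- by move=> t _; rewrite derive1E; apply: derive_val.
Qed.

Lemma disk_area : dA R DD = 1%:E.
Proof.
rewrite /dA /mscale /=.
transitivity ((pi^-1)%:E * (pi : R)%:E)%E; last by rewrite -EFinM mulVf // gt_eqF // pi_gt0.
congr (_ * _)%E; rewrite [LHS](_ : _ = product_measure1 mu mu DD) //.
rewrite -integral_semicircle integral_mkcond /product_measure1.
apply: eq_integral => x _ /=.
(* For |x| > 1 both sides are empty, since the square root of a negative number is 0. *)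
have -> : xsection DD x = `](- Num.sqrt (1 - x ^+ 2))%R, (Num.sqrt (1 - x ^+ 2))%R[%classic.
  apply/seteqP; split => y; rewrite /xsection /= inE diskR2E /cplx in_itv /= -ltr_norml.
    have [h|h] := ltP (1 - x ^+ 2) 0.
    - rewrite -(ltr_pXn2r (n := 2)) ?nnegrE ?sqrtr_ge0 // expr1n sqr_sqrtr ?addr_ge0 ?sqr_ge0 //.
      by have := sqr_ge0 y; move: h; lra.
    - rewrite -(ltr_pXn2r (n := 2)) ?nnegrE ?sqrtr_ge0 // expr1n sqr_sqrtr ?addr_ge0 ?sqr_ge0 // => hh.
      by rewrite -(ltr_pXn2r (n := 2)) ?nnegrE ?sqrtr_ge0 // real_normK ?num_real // sqr_sqrtr //; lra.
  have [h|h] := ltP (1 - x ^+ 2) 0.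
    by rewrite ler0_sqrtr ?ltW // ltNge normr_ge0.
  rewrite -[in X in X -> _](ltr_pXn2r (n := 2)) ?nnegrE ?sqrtr_ge0 // real_normK ?num_real // sqr_sqrtr // => hh.
  by rewrite -(ltr_pXn2r (n := 2)) ?nnegrE ?sqrtr_ge0 // expr1n sqr_sqrtr ?addr_ge0 ?sqr_ge0 //; lra.
rewrite lebesgue_measure_itv /= lte_fin patchE mem_setE in_itv /=.
have s0 := sqrtr_ge0 (1 - x ^+ 2).
have -> : (- 1 <= x <= 1) = (0 <= 1 - x ^+ 2).
  by rewrite -ler_norml -[LHS](ler_pXn2r (n := 2)) ?nnegrE // real_normK ?num_real // expr1n subr_ge0.
case: ltP => h; case: leP => h'.
- by rewrite -EFinB; congr (_%:E); ring.
- by move: h; rewrite ler0_sqrtr ?ltW // oppr0 ltxx.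
- by congr (_%:E); have -> : Num.sqrt (1 - x ^+ 2) = 0 by [lra]; rewrite mulr0.
- by [].
Qed.
End Area.

(** * The Bergman kernel *)

Section Kernel.
Variable R : realType.
Notation C := R[i].
Local Notation cx := (@cplx R).
Local Notation DD := (@diskR2 R).
Local Notation CI f := (Cintegral (dA R) DD (fun p => f (cx p))).
Local Notation dint f := (cint (dA R) DD (fun p => f (cx p))).

Lemma nc_leM (a b : C) x y : nc a <= x -> nc b <= y -> nc (a * b) <= x * y.
Proof. by move=> h1 h2; rewrite ncM; apply: ler_pM; rewrite ?nc_ge0. Qed.
Lemma nc_leD (a b : C) x y : nc a <= x -> nc b <= y -> nc (a + b) <= x + y.
Proof. by move=> h1 h2; apply: le_trans (ncD _ _) _; exact: lerD. Qed.
Lemma nc_leB (a b : C) x y : nc a <= x -> nc b <= y -> nc (a - b) <= x + y.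
Proof. by move=> h1 h2; apply: le_trans (ncB _ _) _; exact: lerD. Qed.
Lemma nc_leX (a : C) x n : nc a <= x -> nc (a ^+ n) <= x ^+ n.
Proof. by move=> h; rewrite ncX lerXn2r ?nnegrE ?nc_ge0 // (le_trans (nc_ge0 _) h). Qed.

Lemma CI_eqD (f g : plane R -> C) : (forall p, nc (cx p) < 1 -> f p = g p) ->
  Cintegral (dA R) DD f = Cintegral (dA R) DD g.
Proof. by move=> fg; apply: CI_eq => p; rewrite diskR2E => /fg. Qed.

Lemma dint_eqD (f g : plane R -> C) : (forall p, nc (cx p) < 1 -> f p = g p) ->
  cint (dA R) DD f -> cint (dA R) DD g.
Proof. by move=> fg; apply: dcint_eq => p; rewrite diskR2E => /fg. Qed.

Lemma CI_cst (k : C) : CI (fun=> k) = k.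
Proof.
rewrite /Cintegral !Rintegral_cst ?measurable_disk //; try exact: measurable_disk.
by rewrite disk_area /= !mulr1; case: k.
Qed.

Lemma cderiv_nccont (f : C -> C) z l : cderiv f z l -> nccont f z.
Proof. by move=> H e e0; have [d d0 h] := cderiv_cont H e0; exists d. Qed.

Lemma holo_cmeas (f f' : C -> C) : (forall z, nc z < 1 -> cderiv f z (f' z)) -> cmeas DD (fun p => f (cx p)).
Proof.
move=> df; rewrite (_ : DD = cx @^-1` [set z | nc z < 1]); last by apply/funext => p; rewrite diskR2E.
by apply: nccont_meas; [exact: ncopen_disk|move=> z /df /cderiv_nccont].
Qed.

Lemma cmeas_cx : cmeas DD (fun p => cx p).
Proof. exact: (holo_cmeas (f := id) (fun z _ => cderiv_id z)). Qed.

Lemma dint_bnd (f : plane R -> C) M : cmeas DD f -> (forall p, nc (cx p) < 1 -> nc (f p) <= M) ->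
  cint (dA R) DD f.
Proof. by move=> mf bf; apply: (cint_bnd (M := M) mf) => p; rewrite diskR2E => /bf. Qed.

(** For holomorphic G the second formula of [green_rho] has b = 0 and reduces to the integral of - z
    G. *)
Lemma CI_mul_z (B M : R) (G G' : C -> C) :
  (forall z, nc z < 1 -> cderiv G z (G' z)) ->
  (forall z, nc z < 1 -> nc (G z) <= B) ->
  (forall z, nc z < 1 -> nc (G' z) <= M) -> CI (fun z => z * G z) = 0.
Proof.
move=> dG GB G'M.
have [//|//||_ _ _ H] := @green_rho R B M G G' (fun=> 0).
- by move=> z /dG /cderivW.
- by move=> z /G'M; rewrite nc0 addr0.
have iz : dint (fun z => z * G z).
  apply: (@dint_bnd _ (1 * B)); first by apply: cmeasM; [exact: cmeas_cx|exact: holo_cmeas dG].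
  by move=> z z1; apply: nc_leM; [exact: ltW|exact: GB].
apply/eqP; rewrite -oppr_eq0 -dCIN // -[X in _ == X]H; apply/eqP; apply: CI_eqD => z _.
by rewrite mulr0 sub0r.
Qed.

Lemma kden_ge (w z : C) : nc w <= 1 -> nc z < 1 -> 1 - nc z <= nc (1 - w * z).
Proof.
move=> w1 z1; have := ncBl 1 (w * z); rewrite nc1 ncM; apply: le_trans.
by rewrite lerD2l lerN2 ler_piMl ?nc_ge0.
Qed.

Lemma kden_neq0 (w z : C) : nc w <= 1 -> nc z < 1 -> 1 - w * z != 0.
Proof. by move=> w1 z1; rewrite -nc_gt0; apply: lt_le_trans (kden_ge w1 z1); rewrite subr_gt0. Qed.

Lemma kinv_le (w z : C) : nc w <= 1 -> nc z < 1 -> nc (1 - w * z)^-1 <= (1 - nc z)^-1.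
Proof.
by move=> w1 z1; rewrite ncV lef_pV2 ?kden_ge // posrE ?subr_gt0 // nc_gt0 kden_neq0.
Qed.

Lemma cderiv_kinv (a w : C) : 1 - w * a != 0 -> cderiv (fun w => (1 - w * a)^-1) w (a * (1 - w * a)^-1 ^+ 2).
Proof.
move=> n0; have H : cderiv (fun w => 1 - w * a) w (- a).
  apply: cderiv_eq (cderivB (cderiv_cst 1 w) (cderivM (cderiv_id w) (cderiv_cst a w))) _.
  by rewrite mul1r mulr0 addr0 sub0r.
apply: cderiv_eq (cderivV (f := fun w => 1 - w * a) n0 H) _; by rewrite mulNr opprK exprVn.
Qed.

Lemma cderiv_sqr (f : C -> C) z l : cderiv f z l -> cderiv (fun w => f w ^+ 2) z (2 * f z * l).
Proof.
by move=> H; apply: cderiv_eq (cderivM H H) _; ring.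
Qed.

(** The conjugate of the integrand is holomorphic in w and has the form 1 + w B(w); the second term
    integrates to zero by [CI_mul_z]. *)
Lemma CI_kernel (z : C) : nc z < 1 -> CI (fun w => (1 - cj w * z)^-1 ^+ 2) = 1.
Proof.
move=> z1; pose a := cj z; have a1 : nc a < 1 by rewrite ncJ.
pose q w := (1 - w * a)^-1; pose Q := (1 - nc a)^-1.
have qQ w : nc w < 1 -> nc (q w) <= Q by move=> w1; apply: kinv_le => //; exact: ltW.
have n0 w : nc w < 1 -> 1 - w * a != 0 by move=> w1; apply: kden_neq0 => //; exact: ltW.
have dq w : nc w < 1 -> cderiv q w (a * q w ^+ 2) by move=> /n0; exact: cderiv_kinv.
pose B w := (2 * a - w * a ^+ 2) * q w ^+ 2.
have dB w : nc w < 1 -> cderiv B w (- a ^+ 2 * q w ^+ 2 + (2 * a - w * a ^+ 2) * (2 * q w * (a * q w ^+ 2))).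
  move=> w1; apply: cderivM; last by apply: cderiv_sqr; exact: dq.
  apply: cderiv_eq (cderivB (cderiv_cst (2 * a) w) (cderivM (cderiv_id w) (cderiv_cst (a ^+ 2) w))) _; ring.
have n2 : nc (2 : C) <= 2 by rewrite nc_nat.
have a1' := ltW a1.
have zero : CI (fun w => w * B w) = 0.
  apply: (CI_mul_z (B := (2 * 1 + 1 * 1 ^+ 2) * Q ^+ 2) (M := 1 ^+ 2 * Q ^+ 2 + (2 * 1 + 1 * 1 ^+ 2) * (2 * Q * (1 * Q ^+ 2))) dB) => w w1;
    have w1' := ltW w1; have qw := qQ _ w1.
    by apply: nc_leM; [apply: nc_leB; apply: nc_leM => //; exact: nc_leX|exact: nc_leX].
  apply: nc_leD; first by apply: nc_leM; rewrite ?ncN; exact: nc_leX.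
  apply: nc_leM; first by apply: nc_leB; apply: nc_leM => //; exact: nc_leX.
  by apply: nc_leM; apply: nc_leM => //; exact: nc_leX.
have iB : dint (fun w => w * B w).
  apply: (@dint_bnd _ (1 * ((2 * 1 + 1 * 1 ^+ 2) * Q ^+ 2))).
    by apply: cmeasM; [exact: cmeas_cx|exact: holo_cmeas dB].
  move=> w w1; have w1' := ltW w1; have qw := qQ _ w1.
  by apply: nc_leM => //; apply: nc_leM; [apply: nc_leB; apply: nc_leM => //; exact: nc_leX|exact: nc_leX].
have ic : dint (fun=> 1) by apply: (@dint_bnd _ 1); [exact: cmeas_cst|move=> w _; rewrite nc1].
have E : CI (fun w => q w ^+ 2) = 1.
  rewrite -[RHS](CI_cst 1) -[RHS]addr0 -zero -dCID //; apply: CI_eqD => w w1.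
  by rewrite /B /q; field; exact: n0.
have iq : dint (fun w => q w ^+ 2).
  have := dcintD ic iB; apply: dint_eqD => w w1.
  by rewrite /B /q; field; exact: n0.
transitivity (cj (CI (fun w => q w ^+ 2))); last by rewrite E conjc1.
rewrite -dCIJ //; apply: CI_eqD => w w1.
by rewrite /q rmorphXn /= fmorphV /= rmorphB rmorphM rmorph1 /= /a conjcK.
Qed.

Lemma conjc_mono (w : C) n m : cj (w ^+ n * cj w ^+ m) = w ^+ m * cj w ^+ n.
Proof. by rewrite rmorphM /= !rmorphXn /= conjcK mulrC. Qed.

Lemma mono_int n m : dint (fun w => w ^+ n * cj w ^+ m).
Proof.
apply: (@dint_bnd _ (1 ^+ n * 1 ^+ m)).
  by apply: cmeasM; apply: cmeasX; [exact: cmeas_cx|apply: cmeasJ; exact: cmeas_cx].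
by move=> w /ltW w1; apply: nc_leM; apply: nc_leX; rewrite ?ncJ.
Qed.

Lemma wderiv_cj (w : C) : wderiv cj w 0 1.
Proof.
have := wderivJ ((cderivW _ _ _).1 (cderiv_id w)).
by rewrite conjc0 conjc1.
Qed.

(** The second formula of [green_rho] for G = w^n conj(w)^m. At m = 0 the truncated predecessor does
    no harm, as the factor m vanishes. *)
Lemma moment_rec n m : m%:R * CI (fun w => w ^+ n * cj w ^+ m.-1) = m.+1%:R * CI (fun w => w ^+ n.+1 * cj w ^+ m).
Proof.
pose G w : C := w ^+ n * cj w ^+ m.
have dG w : nc w < 1 -> wderiv G w (n%:R * w ^+ n.-1 * cj w ^+ m) (w ^+ n * (m%:R * cj w ^+ m.-1)).
  move=> _.
  have := wderivM ((cderivW _ _ _).1 (cderivX w n)) (wderiv_comp (wderiv_cj w) (cderivX (cj w) m)).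
  by rewrite !mulr0 addr0 mul0r add0r mulr1.
have [||_ _ _] := @green_rho R (1 ^+ n * 1 ^+ m) (n%:R * 1 ^+ n.-1 * 1 ^+ m + 1 ^+ n * (m%:R * 1 ^+ m.-1)) G _ _ dG.
- by move=> w /ltW w1; apply: nc_leM; apply: nc_leX; rewrite ?ncJ.
- move=> w /ltW w1; apply: lerD.
    by apply: nc_leM; [apply: nc_leM; [rewrite nc_nat|exact: nc_leX]|apply: nc_leX; rewrite ncJ].
  by apply: nc_leM; [exact: nc_leX|apply: nc_leM; [rewrite nc_nat|apply: nc_leX; rewrite ncJ]].
move=> H; apply/eqP; rewrite -subr_eq0 -!dCIZ ?mono_int //; try exact: mono_int.
rewrite -dCIB; [|apply: dcintZ; exact: mono_int|apply: dcintZ; exact: mono_int].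
rewrite -[X in _ == X]H; apply/eqP; apply: CI_eqD => w _.
rewrite /G /rho; case: m {G dG H} => [|m]; first by rewrite /= expr0 exprS; ring.
by rewrite /= -[m.+2%:R]natr1 !exprS; ring.
Qed.

Lemma momentJ n m : CI (fun w => w ^+ n * cj w ^+ m) = cj (CI (fun w => w ^+ m * cj w ^+ n)).
Proof. by rewrite -dCIJ; [apply: CI_eqD => w _; rewrite conjc_mono|exact: mono_int]. Qed.

Lemma moment0 n : CI (fun w => w ^+ n.+1 * cj w ^+ 0) = 0.
Proof. by have := moment_rec n 0; rewrite mul0r mul1r. Qed.

(** The recursion lowers both exponents together. If they differ, one of them reaches 0 first and
    [moment0], or its conjugate, gives 0. *)
Lemma moment n m : CI (fun w => w ^+ n * cj w ^+ m) = if n == m then n.+1%:R^-1 else 0.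
Proof.
elim: n m => [|n IH] [|m].
- rewrite eqxx invr1 -[RHS]CI_cst; apply: CI_eqD => w _; by rewrite !expr0 mulr1.
- by rewrite momentJ moment0 conjc0.
- by rewrite moment0.
rewrite eqSS; have := moment_rec n m.+1; rewrite /= IH => H.
have m0 : m.+2%:R != 0 :> C by rewrite pnatr_eq0.
apply: (mulfI m0); rewrite -H; case: eqP => [->|_]; last by rewrite !mulr0.
by rewrite !mulfV // pnatr_eq0.
Qed.

End Kernel.

(** * Reproducing property of the Bergman kernel *)

Section Repro.
Variable R : realType.
Notation C := R[i].
Local Notation cx := (@cplx R).
Local Notation DD := (@diskR2 R).
Local Notation CI f := (Cintegral (dA R) DD (fun p => f (cx p))).
Local Notation dint f := (cint (dA R) DD (fun p => f (cx p))).

Definition box (z : C) (r : R) : set (plane R) :=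
  `[Re z - r, Re z + r]%classic `*` `[Im z - r, Im z + r]%classic.

Lemma measurable_box z r : measurable (box z r).
Proof. by apply: measurableX; exact: measurable_itv. Qed.

(** The normalized area of a square of side 2 r is 4 r^2 / pi, and pi >= 2. *)
Lemma box_indic z r : 0 <= r -> rint (dA R) DD (\1_(box z r)) /\
  \int[dA R]_(p in DD) \1_(box z r) p <= 2 * r ^+ 2.
Proof.
move=> r0; have mb := measurable_box z r.
split.
  apply: (@rint_bnd _ _ 1); first exact: measurable_indic.
  by move=> p _; rewrite indicE; case: (_ \in _); rewrite ?normr1 ?normr0.
rewrite /Rintegral integral_indic //; last exact: measurable_disk.
have h1 : ((dA R) (box z r `&` DD) <= (dA R) (box z r))%E.
  by apply: le_measure; rewrite ?inE //; apply: measurableI => //; exact: measurable_disk.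
have h2 : (dA R) (box z r) = (pi^-1 * (2 * r) ^+ 2)%:E.
  by rewrite EFinM -(box_measure (Re z) (Im z) r0).
rewrite h2 in h1.
have h3 : (dA R) (box z r `&` DD) \is a fin_num.
  by rewrite ge0_fin_numE //; apply: le_lt_trans h1 _; exact: ltry.
rewrite -lee_fin fineK //; apply: le_trans h1 _; rewrite lee_fin.
have := pi_ge2 R => p2.
rewrite exprMn mulrA ler_wpM2r ?sqr_ge0 // mulrC ler_pdivrMr ?pi_gt0 //; lra.
Qed.

Lemma far_box z (r : R) (p : plane R) : 0 <= r -> ~ box z r p -> r <= nc (cx p - z).
Proof.
move=> r0 h; rewrite leNgt; apply/negP => hp; apply: h.
case: p hp => x y hp; split; rewrite /= in_itv /= -ler_distl ltW //.
  by apply: le_lt_trans hp; have := normRe_nc (cx (x, y) - z); rewrite raddfB.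
by apply: le_lt_trans hp; have := normIm_nc (cx (x, y) - z); rewrite raddfB.
Qed.

Section repr.
Variables (h h' : C -> C) (B M : R) (z : C).
Hypothesis dh : forall w, nc w < 1 -> cderiv h w (h' w).
Hypothesis hB : forall w, nc w < 1 -> nc (h w) <= B.
Hypothesis hM : forall w, nc w < 1 -> nc (h' w) <= M.
Hypothesis z1 : nc z < 1.

Let Q := (1 - nc z)^-1.
Let p (w : C) := (1 - cj w * z)^-1.

Let pQ w : nc w < 1 -> nc (p w) <= Q.
Proof. by move=> w1; apply: kinv_le => //; rewrite ncJ ltW. Qed.

Let n0 w : nc w < 1 -> 1 - cj w * z != 0.
Proof. by move=> w1; apply: kden_neq0 => //; rewrite ncJ ltW. Qed.

Let wp w : nc w < 1 -> wderiv p w 0 (z * p w ^+ 2).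
Proof.
move=> w1; have := wderiv_comp (wderiv_cj w) (cderiv_kinv (n0 w1)).
by rewrite mulr0 mulr1.
Qed.

Let Q0 : 0 <= Q. Proof. by rewrite invr_ge0 subr_ge0 ltW. Qed.
Let M0 : 0 <= M. Proof. by apply: le_trans (nc_ge0 _) (hM z1). Qed.

Let f1M w : nc w < 1 -> nc (h w - h z) <= M * nc (w - z).
Proof.
move=> w1; apply: (@nc_mvt _ h h') => t t01.
  by apply: dh; exact: disk_segment.
by apply: hM; exact: disk_segment.
Qed.

Section eps.
Variable e : R.
Hypothesis e0 : 0 < e.
Let u w := w - z.
(** conj(u) / s is a smooth substitute for the Cauchy kernel 1/(w - z). Its derivative in conj(w) is
    e^2 / s^2, an approximate identity at z, where h w - h z vanishes. *)
Let s w : C := u w * cj (u w) + (e ^+ 2)%:C.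

Let sE w : s w = (nc (u w) ^+ 2 + e ^+ 2)%:C.
Proof. by rewrite /s mulJ rmorphD. Qed.

Let nc_s w : nc (s w) = nc (u w) ^+ 2 + e ^+ 2.
Proof. by rewrite sE nc_real ger0_norm // addr_ge0 // sqr_ge0. Qed.

Let s0 w : s w != 0.
Proof. by rewrite -nc_gt0 nc_s ltr_wpDl ?sqr_ge0 // exprn_gt0. Qed.

Let ws w : wderiv (fun w => (s w)^-1) w (- ((s w)^-1 ^+ 2 * cj (u w))) (- ((s w)^-1 ^+ 2 * u w)).
Proof.
have wu : wderiv u w 1 0.
  apply/cderivW; apply: cderiv_eq (cderivB (cderiv_id w) (cderiv_cst z w)) _; exact: subr0.
have := wderivD (wderivM wu (wderivJ wu)) ((cderivW _ _ _).1 (cderiv_cst (e ^+ 2)%:C w)).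
rewrite conjc0 conjc1 !mulr0 mul1r mul0r mulr1 !addr0 add0r => H.
by apply: wderiv_eq (wderiv_comp H (cderiv_inv (s0 w))) _ _; rewrite mulNr exprVn.
Qed.

Let E := (e ^+ 2)^-1.
Let sI w : nc (s w)^-1 <= E.
Proof.
by rewrite ncV nc_s lef_pV2 ?posrE ?exprn_gt0 ?ltr_wpDl ?sqr_ge0 ?exprn_gt0 // lerDr sqr_ge0.
Qed.
Let fB w : nc w < 1 -> nc (h w - h z) <= B + B.
Proof. by move=> w1; apply: nc_leB; exact: hB. Qed.

Let mp : cmeas DD (fun q => p (cx q)).
Proof.
have mA : ncopen [set w : C | nc w < 1] := @ncopen_disk R.
have -> : DD = cx @^-1` [set w | nc w < 1] by apply/funext => q; rewrite diskR2E.
by apply: (nccont_meas (f := p) mA) => w w1 d d0; have [r r0 hh] := wderiv_cont (wp w1) d0; exists r.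
Qed.

Let msi : cmeas DD (fun q => (s (cx q))^-1).
Proof.
have mA : ncopen [set w : C | nc w < 1] := @ncopen_disk R.
have -> : DD = cx @^-1` [set w | nc w < 1] by apply/funext => q; rewrite diskR2E.
by apply: (nccont_meas (f := fun w => (s w)^-1) mA) => w w1 d d0; have [r r0 hh] := wderiv_cont (ws w) d0; exists r.
Qed.

Let mh : cmeas DD (fun q => h (cx q) - h z).
Proof.
by apply: cmeasB; [exact: holo_cmeas dh|exact: cmeas_cst].
Qed.

Let mrho : cmeas DD (fun q => rho (cx q)).
Proof.
by apply: cmeasB; [exact: cmeas_cst|apply: cmeasM; [exact: cmeas_cx|apply: cmeasJ; exact: cmeas_cx]].
Qed.

Let repr_int1 : dint (fun w => (h w - h z) * p w * (rho w * (e ^+ 2)%:C * (s w)^-1 ^+ 2)).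
Proof.
apply: (@dint_bnd _ _ ((B + B) * Q * (1 * e ^+ 2 * E ^+ 2))).
  apply: cmeasM; first exact: cmeasM.
  by apply: cmeasM; [apply: cmeasM => //; exact: cmeas_cst|exact: cmeasX].
move=> q q1; apply: nc_leM; first by apply: nc_leM; [exact: fB|exact: pQ].
apply: nc_leM; last exact: nc_leX.
apply: nc_leM; last by rewrite nc_real ger0_norm // sqr_ge0.
by apply: le_trans (nc_rho (ltW q1)) _; rewrite gerBl sqr_ge0.
Qed.

Let repr_int2 : dint (fun w => (h w - h z) * p w ^+ 2 * ((e ^+ 2)%:C * (s w)^-1)).
Proof.
apply: (@dint_bnd _ _ ((B + B) * Q ^+ 2 * (e ^+ 2 * E))).
  apply: cmeasM; first by apply: cmeasM => //; exact: cmeasX.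
  by apply: cmeasM => //; exact: cmeas_cst.
move=> q q1; apply: nc_leM; first by apply: nc_leM; [exact: fB|apply: nc_leX; exact: pQ].
by apply: nc_leM => //; rewrite nc_real ger0_norm // sqr_ge0.
Qed.

Let repr_int3 : dint (fun w => (h w - h z) * p w ^+ 2).
Proof.
apply: (@dint_bnd _ _ ((B + B) * Q ^+ 2)); first by apply: cmeasM => //; exact: cmeasX.
by move=> q q1; apply: nc_leM; [exact: fB|apply: nc_leX; exact: pQ].
Qed.

(* dbar of the regularised quotient (h w - h z) / (w - z) times the kernel factor *)
Lemma repr_green :
  CI (fun w => (h w - h z) * p w * (rho w * (e ^+ 2)%:C * (s w)^-1 ^+ 2)) +
  CI (fun w => (h w - h z) * p w ^+ 2 * ((e ^+ 2)%:C * (s w)^-1)) =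
  CI (fun w => (h w - h z) * p w ^+ 2).
Proof.
pose G w := (h w - h z) * cj (u w) * (s w)^-1 * p w.
pose a w := (h' w * cj (u w) * (s w)^-1 + (h w - h z) * cj (u w) * (- ((s w)^-1 ^+ 2 * cj (u w)))) * p w.
pose b w := ((h w - h z) * (s w)^-1 + (h w - h z) * cj (u w) * (- ((s w)^-1 ^+ 2 * u w))) * p w +
  (h w - h z) * cj (u w) * (s w)^-1 * (z * p w ^+ 2).
have dG w : nc w < 1 -> wderiv G w (a w) (b w).
  move=> w1.
  have wf : wderiv (fun w => h w - h z) w (h' w) 0.
    apply/cderivW; apply: cderiv_eq (cderivB (dh w1) (cderiv_cst _ _)) _; exact: subr0.
  have wu : wderiv (fun w => cj (u w)) w 0 1.
    have : wderiv u w 1 0.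
      apply/cderivW; apply: cderiv_eq (cderivB (cderiv_id w) (cderiv_cst z w)) _; exact: subr0.
    by move/wderivJ; rewrite conjc0 conjc1.
  apply: wderiv_eq (wderivM (wderivM (wderivM wf wu) (ws w)) (wp w1)) _ _.
    by rewrite /a; ring.
  by rewrite /b; ring.
have u2 w : nc w < 1 -> nc (u w) <= 2.
  by move=> w1; apply: le_trans (ncB _ _) _; move: (ltW w1) (ltW z1); lra.
have cu2 w : nc w < 1 -> nc (cj (u w)) <= 2 by rewrite ncJ; exact: u2.
have z1' := ltW z1.
have [||ia ib _ H] := @green_rho R ((B + B) * 2 * E * Q)
  (((M * 2 * E + (B + B) * 2 * (E ^+ 2 * 2)) * Q) +
   (((B + B) * E + (B + B) * 2 * (E ^+ 2 * 2)) * Q + (B + B) * 2 * E * (1 * Q ^+ 2))) G a b dG.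
- move=> w w1; have := fB w1; have := cu2 _ w1; have := sI w; have := pQ w1 => *.
  by do 3 (apply: nc_leM => //).
- move=> w w1; have := fB w1; have := cu2 _ w1; have := u2 _ w1; have := sI w; have := pQ w1; have := hM w1 => *.
  apply: lerD.
    apply: nc_leM => //; apply: nc_leD; first by do 2 (apply: nc_leM => //).
    by apply: nc_leM; [apply: nc_leM|rewrite ncN; apply: nc_leM => //; exact: nc_leX].
  apply: nc_leD; last by do 3 (apply: nc_leM => //); exact: nc_leX.
  apply: nc_leM => //; apply: nc_leD; first by apply: nc_leM.
  by apply: nc_leM; [apply: nc_leM|rewrite ncN; apply: nc_leM => //; exact: nc_leX].
rewrite -dCID //; apply/eqP; rewrite -subr_eq0 -dCIB //; last exact: dcintD.
rewrite -[X in _ == X]H; apply/eqP; apply: CI_eqD => q q1.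
rewrite /b /G.
have n := n0 q1; have ns := s0 (cx q).
(* Replacing e^2 by s - u conj(u) makes the claim a rational identity in independent letters. Its
   core is rho z - w (1 - conj(w) z) = z - w, which cancels the singular factor. *)
have Ee : (e ^+ 2)%:C = s (cx q) - u (cx q) * cj (u (cx q)) by rewrite /s; ring.
rewrite Ee /rho /p; move: ns; set S := s _ => ns; move: (h (cx q)) => hq.
rewrite /u rmorphB /=; move: n; set w := cx q; set cw := cj w; set cz := cj z => n.
by field; rewrite ns n.
Qed.

(** Put v = |w - z|; the Lipschitz bound on h supplies a factor v. In the first integral v e^2 /
    (v^2 + e^2)^2 is at most e^2 / r^3 off the square of half-side r and at most 1/(2 e) on it, an
    area of at most 2 r^2. In the second, v e^2 / (v^2 + e^2) <= e/2. *)
Lemma repr_eps (r : R) : 0 < r ->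
  nc (CI (fun w => (h w - h z) * p w ^+ 2)) <=
  M * Q * (e ^+ 2 / r ^+ 3 + (2 * e)^-1 * (2 * r ^+ 2)) + M * Q ^+ 2 * (e / 2).
Proof.
move=> r0; rewrite -repr_green.
have [i1 i2] := box_indic z (ltW r0).
have sig w : 0 < nc (u w) ^+ 2 + e ^+ 2 by rewrite ltr_wpDl ?sqr_ge0 // exprn_gt0.
have half w : nc (u w) * (nc (u w) ^+ 2 + e ^+ 2)^-1 <= (2 * e)^-1.
  rewrite ler_pdivrMr // mulrC ler_pdivlMr ?mulr_gt0 //.
  by have := sqr_ge0 (nc (u w) - e); rewrite !expr2; move: e (nc _) => x y; lra.
have one w : e ^+ 2 * (nc (u w) ^+ 2 + e ^+ 2)^-1 <= 1.
  by rewrite ler_pdivrMr // mul1r lerDr sqr_ge0.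
have far w : r <= nc (u w) -> nc (u w) * e ^+ 2 * (nc (u w) ^+ 2 + e ^+ 2)^-1 ^+ 2 <= e ^+ 2 / r ^+ 3.
  move=> ru; have u0 : 0 < nc (u w) by exact: lt_le_trans ru.
  apply: (@le_trans _ _ (e ^+ 2 / nc (u w) ^+ 3)).
    rewrite (_ : e ^+ 2 / nc (u w) ^+ 3 = nc (u w) * e ^+ 2 * (nc (u w) ^+ 2)^-1 ^+ 2); last by field; rewrite gt_eqF.
    apply: ler_wpM2l; first by rewrite mulr_ge0 ?sqr_ge0 // ltW.
    apply: lerXn2r; rewrite ?nnegrE ?invr_ge0 ?sqr_ge0 ?(ltW (sig _)) //.
    by rewrite lef_pV2 ?posrE ?exprn_gt0 // lerDl sqr_ge0.
  apply: ler_wpM2l; first exact: sqr_ge0.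
  by rewrite lef_pV2 ?posrE ?exprn_gt0 // lerXn2r ?nnegrE // ltW.
have near w : nc (u w) * e ^+ 2 * (nc (u w) ^+ 2 + e ^+ 2)^-1 ^+ 2 <= (2 * e)^-1.
  rewrite (_ : _ * _ * _ = nc (u w) * (nc (u w) ^+ 2 + e ^+ 2)^-1 * (e ^+ 2 * (nc (u w) ^+ 2 + e ^+ 2)^-1)); last by ring.
  rewrite -[leRHS]mulr1; apply: ler_pM => //; rewrite mulr_ge0 ?nc_ge0 ?sqr_ge0 // invr_ge0 ltW //.
have b1 w : nc w < 1 -> nc ((h w - h z) * p w * (rho w * (e ^+ 2)%:C * (s w)^-1 ^+ 2)) <=
    M * Q * (nc (u w) * e ^+ 2 * (nc (u w) ^+ 2 + e ^+ 2)^-1 ^+ 2).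
  move=> w1; rewrite (_ : M * Q * _ = M * nc (u w) * Q * (1 * e ^+ 2 * (nc (u w) ^+ 2 + e ^+ 2)^-1 ^+ 2)); last by ring.
  apply: nc_leM; first by apply: nc_leM; [exact: f1M|exact: pQ].
  apply: nc_leM; last by apply: nc_leX; rewrite ncV nc_s.
  apply: nc_leM; last by rewrite nc_real ger0_norm // sqr_ge0.
  by apply: le_trans (nc_rho (ltW w1)) _; rewrite gerBl sqr_ge0.
have b2 w : nc w < 1 -> nc ((h w - h z) * p w ^+ 2 * ((e ^+ 2)%:C * (s w)^-1)) <= M * Q ^+ 2 * (e / 2).
  move=> w1; apply: (@le_trans _ _ (M * nc (u w) * Q ^+ 2 * (e ^+ 2 * (nc (u w) ^+ 2 + e ^+ 2)^-1))).
    apply: nc_leM; first by apply: nc_leM; [exact: f1M|apply: nc_leX; exact: pQ].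
    by apply: nc_leM; [rewrite nc_real ger0_norm // sqr_ge0|rewrite ncV nc_s].
  rewrite (_ : _ * _ * _ * _ = M * Q ^+ 2 * (e ^+ 2 * (nc (u w) * (nc (u w) ^+ 2 + e ^+ 2)^-1))); last by ring.
  apply: ler_wpM2l; first by rewrite mulr_ge0 ?sqr_ge0.
  rewrite (_ : e / 2 = e ^+ 2 * (2 * e)^-1); last by field; rewrite gt_eqF.
  by apply: ler_wpM2l; rewrite ?sqr_ge0.
have MQ : 0 <= M * Q by rewrite mulr_ge0.
have cst k : rint (dA R) DD (fun=> k).
  by apply: (@rint_bnd _ _ `|k|); first exact: measurable_cst.
apply: nc_leD.
  apply: (@le_trans _ _ (\int[dA R]_(q in DD) (M * Q * (e ^+ 2 / r ^+ 3 + (2 * e)^-1 * \1_(box z r) q)))).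
    apply: dCI_le.
    - exact: repr_int1.
    - by apply: drintZ; apply: drintD; [exact: cst|exact: drintZ].
    - move=> q; rewrite diskR2E => q1; apply: le_trans (b1 _ q1) _; apply: ler_wpM2l => //.
      have [qb|qb] := boolP (q \in box z r).
        rewrite indicE qb mulr1; apply: le_trans (near _) _.
        by rewrite lerDr divr_ge0 ?sqr_ge0 // exprn_ge0 // ltW.
      rewrite indicE (negbTE qb) mulr0 addr0; apply: far; apply: far_box (ltW r0) _.
      by move: qb; rewrite notin_setE.
  rewrite RintegralZl ?measurable_disk //; [|exact: measurable_disk|by apply: drintD; [exact: cst|exact: drintZ]].
  apply: ler_wpM2l => //.
  rewrite RintegralD; [|exact: measurable_disk|exact: cst|exact: drintZ].
  rewrite Rintegral_cst; last exact: measurable_disk.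
  rewrite disk_area mulr1 lerD2l RintegralZl //; last exact: measurable_disk.
  by apply: ler_wpM2l => //; rewrite invr_ge0 mulr_ge0 // ltW.
apply: (@le_trans _ _ (\int[dA R]_(q in DD) (M * Q ^+ 2 * (e / 2)))).
  apply: dCI_le; [exact: repr_int2|exact: cst|].
  by move=> q; rewrite diskR2E => /b2.
by rewrite Rintegral_cst ?disk_area ?mulr1 //; exact: measurable_disk.
Qed.

End eps.

Lemma repr_bound (d : R) : 0 < d <= 1 ->
  nc (CI (fun w => (h w - h z) * p w ^+ 2)) <= (3 * M * Q + M * Q ^+ 2) * d.
Proof.
move=> /andP[d0 d1].
(* With e = d^5 and r = d^3 both e^2 / r^3 and r^2 / e equal d. In general r must lie between
   e^(2/3) and e^(1/2), and 3/5 is between these exponents. *)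
have e0 : 0 < d ^+ 5 by rewrite exprn_gt0.
have r0 : 0 < d ^+ 3 by rewrite exprn_gt0.
apply: le_trans (repr_eps e0 r0) _.
have -> : (d ^+ 5) ^+ 2 / (d ^+ 3) ^+ 3 + (2 * d ^+ 5)^-1 * (2 * (d ^+ 3) ^+ 2) = 2 * d.
  by field; rewrite gt_eqF.
have d5 : d ^+ 5 <= d by rewrite -[leRHS]expr1 ler_wiXn2l // ltW.
have MQ : 0 <= M * Q by rewrite mulr_ge0.
have MQ2 : 0 <= M * Q ^+ 2 by rewrite mulr_ge0 // sqr_ge0.
rewrite [leRHS]mulrDl; apply: lerD.
  have := mulr_ge0 MQ (ltW d0); lra.
by apply: ler_wpM2l => //; lra.
Qed.

(** Since the kernel integrates to 1, the difference of the two sides is the integral of (h w - h z)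
    against the kernel, which [repr_bound] makes arbitrarily small. *)
Lemma repr_proj : bergman_proj h z = h z.
Proof.
apply/eqP; rewrite -subr_eq0 -nc_eq0 eq_le nc_ge0 andbT.
have E : bergman_proj h z - h z = CI (fun w => (h w - h z) * p w ^+ 2).
  rewrite /bergman_proj.
  have iK : dint (fun w => p w ^+ 2).
    apply: (@dint_bnd _ _ (Q ^+ 2)); last by move=> w w1; apply: nc_leX; exact: pQ.
    apply: cmeasX.
    have mA : ncopen [set w : C | nc w < 1] := @ncopen_disk R.
    have -> : DD = cx @^-1` [set w | nc w < 1] by apply/funext => q; rewrite diskR2E.
    by apply: (nccont_meas (f := p) mA) => w w1 d d0; have [r r0 hh] := wderiv_cont (wp w1) d0; exists r.
  have ih : dint (fun w => h w * p w ^+ 2).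
    apply: (@dint_bnd _ _ (B * Q ^+ 2)); last first.
      by move=> w w1; apply: nc_leM; [exact: hB|apply: nc_leX; exact: pQ].
    by apply: cmeasM; [exact: holo_cmeas dh|exact: cint_meas iK].
  have E1 : h z = CI (fun w => h z * p w ^+ 2) by rewrite dCIZ // CI_kernel // mulr1.
  have ih' : cint (dA R) DD (fun q => let w := cx q in h w / (1 - cj w * z) ^+ 2).
    by apply: dint_eqD ih => q q1; rewrite /p exprVn.
  rewrite [X in _ - X]E1 -dCIB //; last exact: dcintZ.
  by apply: CI_eqD => q q1; rewrite /p mulrBl !exprVn.
rewrite E; apply/ler_addgt0Pl => t t0; rewrite addr0.
pose K := 3 * M * Q + M * Q ^+ 2 + 1.
have K0 : 0 < K by rewrite ltr_wpDl // addr_ge0 // ?mulr_ge0 // ?sqr_ge0 // mulr_ge0.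
have d0 : 0 < Num.min 1 (t / K) by rewrite lt_min ltr01 divr_gt0.
apply: le_trans (repr_bound (d := Num.min 1 (t / K)) _) _.
  by rewrite d0 ge_min lexx.
apply: (@le_trans _ _ (K * (t / K))); last by rewrite mulrC divfK // gt_eqF.
apply: ler_pM; rewrite ?(ltW d0) ?ge_min ?lexx ?orbT // /K ?lerDl //.
by rewrite addr_ge0 // ?mulr_ge0 // ?sqr_ge0 // mulr_ge0.
Qed.
End repr.
End Repro.

(** * The Bergman projection *)

Section L2.
Variable R : realType.
Notation C := R[i].
Local Notation cx := (@cplx R).
Local Notation DD := (@diskR2 R).
Local Notation CI f := (Cintegral (dA R) DD (fun p => f (cx p))).
Local Notation dint f := (cint (dA R) DD (fun p => f (cx p))).
Local Notation dmeas f := (cmeas DD (fun p => f (cx p))).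
Implicit Types (f g h : C -> C).

(** A form of [L2disk] with real integrals, so that the estimates take place in [R] and not in the
    extended reals. *)
Definition L2f f := dmeas f /\ rint (dA R) DD (fun p => nc (f (cx p)) ^+ 2).
Definition sq f := \int[dA R]_(p in DD) (nc (f (cx p)) ^+ 2).
Definition nrm f := Num.sqrt (sq f).

Lemma sq_ge0 f : 0 <= sq f.
Proof. by apply: Rintegral_ge0 => p _; exact: sqr_ge0. Qed.
Lemma nrm_ge0 f : 0 <= nrm f. Proof. exact: sqrtr_ge0. Qed.
Lemma nrm_sqr f : nrm f ^+ 2 = sq f. Proof. by rewrite sqr_sqrtr // sq_ge0. Qed.

Lemma rint_fin (G : plane R -> R) : rint (dA R) DD G ->
  (\int[dA R]_(p in DD) (G p)%:E = (\int[dA R]_(p in DD) G p)%:E)%E.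
Proof. by move=> iG; rewrite /Rintegral fineK //; apply: integrable_fin_num => //; exact: measurable_disk. Qed.

Lemma L2norm_nrm f : L2f f -> L2norm f = (nrm f)%:E.
Proof.
move=> [mf If]; rewrite /L2norm rint_fin // poweR_EFin powR12_sqrt //; exact: sq_ge0.
Qed.

Lemma L2diskP f : L2disk f <-> L2f f.
Proof.
split=> [[m1 m2 fin]|Lf].
  split; first by [].
  apply/integrableP; split; first by apply/measurable_EFinP; exact: cmeas_nc2.
  have E : (\int[dA R]_(p in DD) `|(nc (f (cx p)) ^+ 2)%:E| = \int[dA R]_(p in DD) (nc (f (cx p)) ^+ 2)%:E)%E.
    by apply: eq_integral => p _; rewrite /= ger0_norm ?sqr_ge0.
  rewrite E ltey; apply/eqP => h; move: fin.
  by rewrite /L2norm h /= invr_eq0 pnatr_eq0.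
have [[m1 m2] _] := Lf; split => //; rewrite L2norm_nrm //; exact: ltry.
Qed.

Lemma rint_cst (k : R) : rint (dA R) DD (fun=> k).
Proof. by apply: (@rint_bnd _ _ `|k|); first exact: measurable_cst. Qed.

Lemma RI_cst (k : R) : \int[dA R]_(p in DD) k = k.
Proof. by rewrite Rintegral_cst ?disk_area ?mulr1 //; exact: measurable_disk. Qed.

Lemma L2f_dom f (G : plane R -> R) : dmeas f -> rint (dA R) DD G ->
  (forall p, nc (cx p) < 1 -> nc (f (cx p)) ^+ 2 <= G p) -> L2f f.
Proof.
move=> mf iG H; split=> //; apply: drint_dom iG _; first exact: cmeas_nc2.
by move=> p; rewrite diskR2E ger0_norm ?sqr_ge0 //; exact: H.
Qed.

Lemma L2f_int f : L2f f -> dint f.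
Proof.
move=> [mf If]; apply: (dcint_dom mf (drintD (rint_cst 1) If)) => p _.
rewrite /=; move: (nc _) => x; have := sqr_ge0 (2 * x - 1); rewrite !expr2; nra.
Qed.

Lemma L2f_bnd f M : dmeas f -> (forall z, nc z < 1 -> nc (f z) <= M) -> L2f f.
Proof.
move=> mf fM; apply: (L2f_dom mf (rint_cst (M ^+ 2))) => p p1.
by rewrite lerXn2r ?nnegrE ?nc_ge0 ?fM // (le_trans (nc_ge0 _) (fM _ p1)).
Qed.

Lemma L2f_eq f g : (forall z, nc z < 1 -> f z = g z) -> L2f f -> L2f g.
Proof.
move=> fg [mf If]; split.
  by apply: cmeas_eq mf => p; rewrite diskR2E => /fg.
by apply: drint_eq If => p; rewrite diskR2E => /fg ->.
Qed.

Lemma sq_eq f g : (forall z, nc z < 1 -> f z = g z) -> sq f = sq g.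
Proof. by move=> fg; apply: eq_Rintegral => p; rewrite inE diskR2E => /fg ->. Qed.

Lemma nrm_eq f g : (forall z, nc z < 1 -> f z = g z) -> nrm f = nrm g.
Proof. by move=> fg; rewrite /nrm (sq_eq fg). Qed.

(** With t the ratio of the two norms this becomes the triangle inequality [nrmD], without
    Cauchy-Schwarz. *)
Lemma nc_sqrD (a b : C) (t : R) : 0 < t -> nc (a + b) ^+ 2 <= (1 + t) * nc a ^+ 2 + (1 + t^-1) * nc b ^+ 2.
Proof.
move=> t0; apply: (@le_trans _ _ ((nc a + nc b) ^+ 2)).
  by rewrite lerXn2r ?nnegrE ?addr_ge0 ?nc_ge0 // ncD.
have : 0 <= t^-1 * (t * nc a - nc b) ^+ 2 by rewrite mulr_ge0 ?sqr_ge0 // invr_ge0 ltW.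
rewrite (_ : t^-1 * _ = t * nc a ^+ 2 - 2 * (nc a * nc b) + t^-1 * nc b ^+ 2); last by field; rewrite gt_eqF.
by rewrite sqrrD -mulr_natl; move: (t^-1) (nc a) (nc b) => q y v; rewrite !expr2 => hh; lra.
Qed.

Lemma L2fD f g : L2f f -> L2f g -> L2f (fun z => f z + g z).
Proof.
move=> [mf If] [mg Ig].
apply: (L2f_dom (cmeasD mf mg) (drintD (drintZ (1 + 1) If) (drintZ (1 + 1^-1) Ig))) => p _.
exact: nc_sqrD.
Qed.

Lemma L2fM f g M : dmeas g -> (forall z, nc z < 1 -> nc (g z) <= M) -> L2f f -> L2f (fun z => g z * f z).
Proof.
move=> mg gM [mf If]; apply: (L2f_dom (cmeasM mg mf) (drintZ (M ^+ 2) If)) => p p1.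
rewrite ncM exprMn ler_wpM2r ?sqr_ge0 //.
by rewrite lerXn2r ?nnegrE ?nc_ge0 ?gM // (le_trans (nc_ge0 _) (gM _ p1)).
Qed.

Lemma sqM f g M : dmeas g -> (forall z, nc z < 1 -> nc (g z) <= M) -> L2f f ->
  sq (fun z => g z * f z) <= M ^+ 2 * sq f.
Proof.
move=> mg gM Lf; rewrite /sq -RintegralZl; [|exact: measurable_disk|exact: Lf.2].
apply: le_Rintegral; [exact: measurable_disk|exact: (L2fM mg gM Lf).2|exact: (drintZ _ Lf.2)|].
move=> p; rewrite diskR2E => p1; rewrite ncM exprMn ler_wpM2r ?sqr_ge0 //.
by rewrite lerXn2r ?nnegrE ?nc_ge0 ?gM // (le_trans (nc_ge0 _) (gM _ p1)).
Qed.

Lemma nrmM f g M : dmeas g -> (forall z, nc z < 1 -> nc (g z) <= M) -> L2f f ->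
  nrm (fun z => g z * f z) <= M * nrm f.
Proof.
move=> mg gM Lf; have M0 : 0 <= M by apply: le_trans (nc_ge0 _) (gM 0 _); rewrite nc0.
rewrite -(@ler_pXn2r _ 2) ?nnegrE ?nrm_ge0 ?mulr_ge0 ?nrm_ge0 // exprMn !nrm_sqr.
exact: sqM.
Qed.

Lemma nrmZ k f : L2f f -> nrm (fun z => k * f z) = nc k * nrm f.
Proof.
move=> Lf; rewrite /nrm -[nc k]ger0_norm ?nc_ge0 // -sqrtr_sqr -sqrtrM ?sqr_ge0 //; congr Num.sqrt.
rewrite /sq -RintegralZl; [|exact: measurable_disk|exact: Lf.2].
by apply: eq_Rintegral => p _; rewrite ncM exprMn.
Qed.

Lemma L2fZ k f : L2f f -> L2f (fun z => k * f z).
Proof. by apply: (L2fM (M := nc k)); [exact: cmeas_cst|]. Qed.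

Lemma nrmD f g : L2f f -> L2f g -> nrm (fun z => f z + g z) <= nrm f + nrm g.
Proof.
move=> Lf Lg; apply/ler_addgt0Pl => e e0.
(* The added e/2 makes both numbers positive, so that their ratio can be used as t. *)
pose a := nrm f + e / 2; pose b := nrm g + e / 2.
have e20 : 0 < e / 2 by rewrite divr_gt0.
have a0 : 0 < a by rewrite ltr_wpDl // nrm_ge0.
have b0 : 0 < b by rewrite ltr_wpDl // nrm_ge0.
suff : nrm (fun z => f z + g z) <= a + b by rewrite /a /b; lra.
have ab0 : 0 <= a + b by rewrite ltW // addr_gt0.
rewrite -(@ler_pXn2r _ 2) ?nnegrE ?nrm_ge0 // nrm_sqr.
pose t := b / a; have t0 : 0 < t by rewrite divr_gt0.
apply: (@le_trans _ _ ((1 + t) * sq f + (1 + t^-1) * sq g)).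
  rewrite /sq -!RintegralZl; [|exact: measurable_disk|exact: Lg.2|exact: measurable_disk|exact: Lf.2].
  rewrite -RintegralD; [|exact: measurable_disk|exact: (drintZ _ Lf.2)|exact: (drintZ _ Lg.2)].
  apply: le_Rintegral; [exact: measurable_disk|exact: (L2fD Lf Lg).2|exact: (drintD (drintZ _ Lf.2) (drintZ _ Lg.2))|].
  by move=> p _; exact: nc_sqrD.
apply: (@le_trans _ _ ((1 + t) * a ^+ 2 + (1 + t^-1) * b ^+ 2)).
  have fa : sq f <= a ^+ 2 by rewrite -nrm_sqr lerXn2r ?nnegrE ?nrm_ge0 ?(ltW a0) // /a lerDl ltW.
  have gb : sq g <= b ^+ 2 by rewrite -nrm_sqr lerXn2r ?nnegrE ?nrm_ge0 ?(ltW b0) // /b lerDl ltW.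
  by apply: lerD; apply: ler_wpM2l => //; rewrite addr_ge0 // ?invr_ge0 ltW.
rewrite le_eqVlt; apply/orP; left; apply/eqP; rewrite /t; field.
by rewrite (gt_eqF a0) (gt_eqF b0).
Qed.

Lemma L2fB f g : L2f f -> L2f g -> L2f (fun z => f z - g z).
Proof. by move=> Lf /(L2fZ (-1)) Lg; apply: L2f_eq (L2fD Lf Lg) => z _; rewrite mulN1r. Qed.

Lemma nrmBC f g : nrm (fun z => f z - g z) = nrm (fun z => g z - f z).
Proof. by congr Num.sqrt; apply: eq_Rintegral => p _; rewrite ncBC. Qed.

Lemma nrm_dist f g h : L2f f -> L2f g -> L2f h ->
  nrm (fun z => f z - h z) <= nrm (fun z => f z - g z) + nrm (fun z => g z - h z).
Proof.
move=> Lf Lg Lh; apply: le_trans (nrmD (L2fB Lf Lg) (L2fB Lg Lh)).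
by rewrite le_eqVlt; apply/orP; left; apply/eqP/nrm_eq => z _; ring.
Qed.

Lemma nrm_bnd f M : (forall z, nc z < 1 -> nc (f z) <= M) -> dmeas f -> nrm f <= M.
Proof.
move=> fM mf; have M0 : 0 <= M by apply: le_trans (nc_ge0 _) (fM 0 _); rewrite nc0.
rewrite -(@ler_pXn2r _ 2) ?nnegrE ?nrm_ge0 // nrm_sqr -(RI_cst (M ^+ 2)).
apply: le_Rintegral; [exact: measurable_disk|exact: (L2f_bnd mf fM).2|exact: rint_cst|].
by move=> p; rewrite diskR2E => p1; rewrite lerXn2r ?nnegrE ?nc_ge0 ?fM.
Qed.

(** The inequality 2 m |f| <= |f|^2 + m^2 is integrated with m the mean of |f|; the disk has mass
    1. *)
Lemma nrm_int f : L2f f -> \int[dA R]_(p in DD) nc (f (cx p)) <= nrm f.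
Proof.
move=> Lf; have inf := dcint_nc (L2f_int Lf).
set m := \int[dA R]_(p in DD) nc (f (cx p)).
have m0 : 0 <= m by apply: Rintegral_ge0 => p _; exact: nc_ge0.
rewrite -(@ler_pXn2r _ 2) ?nnegrE ?nrm_ge0 // nrm_sqr.
have : \int[dA R]_(p in DD) (2 * m * nc (f (cx p))) <= \int[dA R]_(p in DD) (nc (f (cx p)) ^+ 2 + m ^+ 2).
  apply: le_Rintegral; [exact: measurable_disk|exact: (drintZ _ inf)|exact: (drintD Lf.2 (rint_cst _))|].
  by move=> p _; have := sqr_ge0 (nc (f (cx p)) - m); rewrite !expr2; lra.
rewrite RintegralZl //; [|exact: measurable_disk].
rewrite RintegralD; [|exact: measurable_disk|exact: Lf.2|exact: rint_cst].
by rewrite RI_cst -/m /sq expr2; lra.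
Qed.

(** Lets norm bounds pass to limits that are known only pointwise: Taylor polynomials here, the
    partial sums of the universal vector later. *)
Lemma sq_fatou (F : nat -> C -> C) f A : (forall n, L2f (F n)) ->
  (forall z, nc z < 1 -> ncvg (fun n => F n z) (f z)) -> (forall n, sq (F n) <= A) ->
  L2f f /\ sq f <= A.
Proof.
move=> LF Ff FA.
have mf : dmeas f.
  apply: (cmeas_cvg (F := fun n p => F n (cx p))) => [n|p]; first exact: (LF n).1.
  by rewrite diskR2E => /Ff.
have mF n : measurable_fun DD (fun p => (nc (F n (cx p)) ^+ 2)%:E).
  by apply/measurable_EFinP; exact: cmeas_nc2 (LF n).1.
have F0 n p : DD p -> (0 <= (nc (F n (cx p)) ^+ 2)%:E)%E by move=> _; rewrite lee_fin sqr_ge0.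
have := fatou (dA R) (@measurable_disk R) mF F0.
have -> : (\int[dA R]_(p in DD) limn_einf (fun n => (nc (F n (cx p)) ^+ 2)%:E) =
          \int[dA R]_(p in DD) (nc (f (cx p)) ^+ 2)%:E)%E.
  apply: eq_integral => p; rewrite inE diskR2E => /Ff H.
  have cv : (fun n => (nc (F n (cx p)) ^+ 2)%:E) @ \oo --> (nc (f (cx p)) ^+ 2)%:E.
    apply: cvg_EFin; first exact: nearW.
    under eq_fun do rewrite /= nc_sqr.
    rewrite nc_sqr; apply: cvgD; rewrite expr2; under eq_fun do rewrite expr2; apply: cvgM;
      try exact: ncvg_Re; exact: ncvg_Im.
  by rewrite is_cvg_limn_einfE; [apply/cvg_lim|apply/cvg_ex; eexists; exact: cv].
have le : (limn_einf (fun n => \int[dA R]_(p in DD) (nc (F n (cx p)) ^+ 2)%:E) <= A%:E)%E.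
  rewrite limn_einf_lim; apply: lime_le; first exact: is_cvg_einfs.
  apply: nearW => n; rewrite /einfs.
  apply: (@le_trans _ _ (\int[dA R]_(p in DD) (nc (F n (cx p)) ^+ 2)%:E)%E).
    by apply: ereal_inf_lbound; exists n => //=.
  by rewrite rint_fin; [rewrite lee_fin; exact: FA|exact: (LF n).2].
move=> /le_trans /(_ le) fin.
have Lf : L2f f.
  split=> //; apply/integrableP; split; first by apply/measurable_EFinP; exact: cmeas_nc2.
  under eq_integral do rewrite /= ger0_norm ?sqr_ge0 //.
  by apply: le_lt_trans fin _; exact: ltry.
split=> //; rewrite -lee_fin /sq -rint_fin //; exact: Lf.2.
Qed.

End L2.

(** * Derivatives, Taylor expansion and continuity of the projection *)

Section Proj.
Variable R : realType.
Notation C := R[i].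
Local Notation cx := (@cplx R).
Local Notation DD := (@diskR2 R).
Local Notation CI f := (Cintegral (dA R) DD (fun p => f (cx p))).
Local Notation dint f := (cint (dA R) DD (fun p => f (cx p))).
Local Notation dmeas f := (cmeas DD (fun p => f (cx p))).
Local Notation P := (@bergman_proj R).
Implicit Types (f g h : C -> C).

Lemma nc_le1M (a b : C) y : nc a <= 1 -> nc b <= y -> nc (a * b) <= y.
Proof. by move=> h1 h2; rewrite -[y]mul1r; exact: nc_leM. Qed.
Lemma nc_leX1 (a : C) n : nc a <= 1 -> nc (a ^+ n) <= 1.
Proof. by move=> h; rewrite -(expr1n _ n); exact: nc_leX. Qed.

Lemma dintMb f g M : dint f -> dmeas g -> (forall z, nc z < 1 -> nc (g z) <= M) ->
  dint (fun z => f z * g z).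
Proof.
move=> If mg gM.
apply: (dcint_dom (cmeasM (cint_meas If) mg) (drintZ M (dcint_nc If))) => p.
by rewrite diskR2E ncM mulrC => p1; rewrite ler_wpM2r ?nc_ge0 // gM.
Qed.

Lemma kinv_cj_le (w z : C) : nc w < 1 -> nc z < 1 -> nc (1 - cj w * z)^-1 <= (1 - nc z)^-1.
Proof. by move=> w1 z1; apply: kinv_le => //; rewrite ncJ ltW. Qed.

Lemma kden_cj_neq0 (w z : C) : nc w < 1 -> nc z < 1 -> 1 - cj w * z != 0.
Proof. by move=> w1 z1; apply: kden_neq0 => //; rewrite ncJ ltW. Qed.

Lemma kinv_meas z : nc z < 1 -> dmeas (fun w => (1 - cj w * z)^-1).
Proof.
move=> z1; have mA : ncopen [set w : C | nc w < 1] := @ncopen_disk R.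
have -> : DD = cx @^-1` [set w | nc w < 1] by apply/funext => q; rewrite diskR2E.
apply: (nccont_meas (f := fun w => (1 - cj w * z)^-1) mA) => w w1 d d0.
have := wderiv_comp (wderiv_cj w) (cderiv_kinv (kden_cj_neq0 w1 z1)).
by move/wderiv_cont => /(_ _ d0)[r r0 hh]; exists r.
Qed.

Lemma cmeas_cj : dmeas (fun w => cj w).
Proof. by apply: cmeasJ; exact: cmeas_cx. Qed.

(** The n-th derivative of P f divided by (n+1)!. *)
Definition kmom f n z := CI (fun w => f w * (cj w ^+ n * (1 - cj w * z)^-1 ^+ n.+2)).

Lemma projE f z : P f z = kmom f 0 z.
Proof.
rewrite /bergman_proj /kmom; apply: CI_eqD => p _.
by rewrite expr0 mul1r exprVn.
Qed.

Lemma kmom_int f n z : dint f -> nc z < 1 ->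
  dint (fun w => f w * (cj w ^+ n * (1 - cj w * z)^-1 ^+ n.+2)).
Proof.
move=> If z1; apply: (@dintMb f (fun w => cj w ^+ n * (1 - cj w * z)^-1 ^+ n.+2) (1 ^+ n * (1 - nc z)^-1 ^+ n.+2)) => //.
  by apply: cmeasM; apply: cmeasX; [exact: cmeas_cj|exact: kinv_meas].
move=> w w1; apply: nc_leM; apply: nc_leX; first by rewrite ncJ ltW.
exact: kinv_cj_le.
Qed.

Lemma cderiv_kinvr (c z : C) : 1 - c * z != 0 -> cderiv (fun z => (1 - c * z)^-1) z (c * (1 - c * z)^-1 ^+ 2).
Proof.
rewrite mulrC => n0; apply: (@cderiv_near _ (fun z => (1 - z * c)^-1) _ _ _ 1) => //.
  by move=> w _; rewrite [w * c]mulrC.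
exact: cderiv_kinv.
Qed.

Lemma cderiv_kinvrX (c z : C) m : 1 - c * z != 0 ->
  cderiv (fun z => (1 - c * z)^-1 ^+ m) z (m%:R * (c * (1 - c * z)^-1 ^+ m.+1)).
Proof.
move=> n0; apply: cderiv_eq (cderiv_comp (cderiv_kinvr n0) (cderivX _ m)) _.
by case: m => [|m]; [rewrite !mul0r|rewrite /= !exprS; ring].
Qed.

Lemma half_disk (z0 z : C) : nc z0 < 1 -> nc (z - z0) < (1 - nc z0) / 2 ->
  nc z < 1 /\ (1 - nc z)^-1 <= ((1 - nc z0) / 2)^-1.
Proof.
move=> z1 h.
have hz : nc z <= nc z0 + nc (z - z0).
  by rewrite (_ : nc z = nc (z0 + (z - z0))) ?ncD //; congr nc; ring.
split; first lra.
by rewrite lef_pV2 ?posrE; lra.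
Qed.

Lemma kmom_cderiv f n z : dint f -> nc z < 1 -> cderiv (kmom f n) z (n.+2%:R * kmom f n.+1 z).
Proof.
(* On the disc of radius r about z the factor 1 / (1 - conj(w) z) is at most 1/r, which bounds the
   second derivative uniformly. *)
move=> If z1; pose r := (1 - nc z) / 2.
have r0 : 0 < r by rewrite divr_gt0 // subr_gt0.
have -> : n.+2%:R * kmom f n.+1 z =
    CI (fun w => f w * (cj w ^+ n * (n.+2%:R * (cj w * (1 - cj w * z)^-1 ^+ n.+3)))).
  rewrite /kmom -dCIZ; last exact: kmom_int.
  by apply: CI_eqD => p _; rewrite [_ ^+ n.+1]exprS; ring.
apply: (@dCI_cderiv R (fun p z => f (cx p) * (cj (cx p) ^+ n * (1 - cj (cx p) * z)^-1 ^+ n.+2))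
  (fun p z => f (cx p) * (cj (cx p) ^+ n * (n.+2%:R * (cj (cx p) * (1 - cj (cx p) * z)^-1 ^+ n.+3))))
  (fun p z => f (cx p) * (cj (cx p) ^+ n * (n.+2%:R * (cj (cx p) * (n.+3%:R * (cj (cx p) * (1 - cj (cx p) * z)^-1 ^+ n.+4))))))
  z r (fun p => (n.+2%:R * (n.+3%:R * r^-1 ^+ n.+4)) * nc (f (cx p))) r0).
- move=> p w; rewrite diskR2E => p1 /half_disk[//|w1 _].
  by do 2 apply: cderivZ; apply: cderiv_kinvrX; exact: kden_cj_neq0.
- move=> p w; rewrite diskR2E => p1 /half_disk[//|w1 _].
  by do 4 apply: cderivZ; apply: cderiv_kinvrX; exact: kden_cj_neq0.
- move=> p w; rewrite diskR2E => p1 /half_disk[//|w1 wr].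
  have p1' : nc (cj (cx p)) <= 1 by rewrite ncJ ltW.
  rewrite mulrC; apply: nc_leM => //.
  apply: nc_le1M; first exact: nc_leX1.
  apply: nc_leM; first by rewrite nc_nat.
  apply: nc_le1M => //.
  apply: nc_leM; first by rewrite nc_nat.
  apply: nc_le1M => //.
  by apply: nc_leX; apply: le_trans (kinv_cj_le p1 w1) wr.
- by move=> w /half_disk[//|w1 _]; exact: kmom_int.
- have := dcintZ n.+2%:R (kmom_int n.+1 If z1); apply: dint_eqD => p _.
  by rewrite [_ ^+ n.+1]exprS; ring.
- exact: (drintZ _ (dcint_nc If)).
Qed.

Lemma proj_cderiv f z : dint f -> nc z < 1 -> cderiv (P f) z (2 * kmom f 1 z).
Proof.
move=> If z1; apply: (@cderiv_near _ (kmom f 0) _ _ _ 1) => //.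
  by move=> w _; rewrite projE.
exact: kmom_cderiv.
Qed.

Lemma kmom_bnd f n z : dint f -> nc z < 1 ->
  nc (kmom f n z) <= (1 - nc z)^-1 ^+ n.+2 * \int[dA R]_(p in DD) nc (f (cx p)).
Proof.
move=> If z1.
have inf := dcint_nc If.
rewrite -RintegralZl; [|exact: measurable_disk|exact: inf].
apply: dCI_le; [exact: kmom_int|exact: (drintZ _ inf)|].
move=> p; rewrite diskR2E => p1; rewrite mulrC; apply: nc_leM => //.
apply: nc_le1M; first by apply: nc_leX1; rewrite ncJ ltW.
by apply: nc_leX; exact: kinv_cj_le.
Qed.

(** A primitive of P f, as z / (1 - conj(w) z) is a primitive of the kernel. Reproduced functions
    thus get primitives without Cauchy's theorem. *)
Definition proj_prim f z := CI (fun w => f w * (z * (1 - cj w * z)^-1)).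

Lemma proj_prim_cderiv f z : dint f -> nc z < 1 -> cderiv (proj_prim f) z (P f z).
Proof.
move=> If z1; pose r := (1 - nc z) / 2.
have r0 : 0 < r by rewrite divr_gt0 // subr_gt0.
have mk w : nc w < 1 -> dint (fun p => f p * (w * (1 - cj p * w)^-1)).
  move=> w1; apply: (@dintMb f (fun p => w * (1 - cj p * w)^-1) (1 * (1 - nc w)^-1)) => //.
    by apply: cmeasZ; exact: kinv_meas.
  by move=> p p1; apply: nc_leM; [exact: ltW|exact: kinv_cj_le].
rewrite projE /kmom.
apply: (@dCI_cderiv R (fun p z => f (cx p) * (z * (1 - cj (cx p) * z)^-1))
  (fun p z => f (cx p) * (cj (cx p) ^+ 0 * (1 - cj (cx p) * z)^-1 ^+ 2))
  (fun p z => f (cx p) * (cj (cx p) ^+ 0 * (2 * (cj (cx p) * (1 - cj (cx p) * z)^-1 ^+ 3))))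
  z r (fun p => (2 * r^-1 ^+ 3) * nc (f (cx p))) r0).
- move=> p w; rewrite diskR2E => p1 /half_disk[//|w1 _].
  apply: cderivZ; have n0 := kden_cj_neq0 p1 w1.
  by apply: cderiv_eq (cderivM (cderiv_id w) (cderiv_kinvr n0)) _; field.
- move=> p w; rewrite diskR2E => p1 /half_disk[//|w1 _].
  by do 2 apply: cderivZ; apply: cderiv_kinvrX; exact: kden_cj_neq0.
- move=> p w; rewrite diskR2E => p1 /half_disk[//|w1 wr].
  rewrite expr0 mul1r mulrC; apply: nc_leM => //.
  apply: nc_leM; first by rewrite nc_nat.
  apply: nc_le1M; first by rewrite ncJ ltW.
  by apply: nc_leX; apply: le_trans (kinv_cj_le p1 w1) wr.
- by move=> w /half_disk[//|w1 _]; exact: mk.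
- exact: kmom_int.
- exact: (drintZ _ (dcint_nc If)).
Qed.

Lemma proj_prim0 f : proj_prim f 0 = 0.
Proof.
rewrite /proj_prim -[RHS](CI_cst 0); apply: CI_eqD => p _.
by rewrite mul0r mulr0.
Qed.

(** The geometric sum (1 - s^(N+1)) / (1 - s) has N+1 terms, each at least s^N. *)
Lemma nat_pow_bound (s : R) N : 0 <= s < 1 -> N.+1%:R * s ^+ N * (1 - s) <= 1 - s ^+ N.+1.
Proof.
move=> /andP[s0 s1]; elim: N => [|N IH]; first by rewrite expr0 !mul1r expr1.
have sN : s ^+ N.+1 * (1 - s) <= 1 * (1 - s).
  by rewrite ler_wpM2r ?subr_ge0 ?(ltW s1) // exprn_ile1 // ltW.
have := ler_wpM2l s0 IH.
rewrite -[N.+2%:R]natr1 [s ^+ N.+2]exprS [s ^+ N.+1]exprS in sN *.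
move: (N.+1%:R) (s ^+ N) sN => x y sN h.
by move: sN h; rewrite !mulrBr !mulrDl; lra.
Qed.

(** With s = sqrt r one has r^N = s^N s^N: one factor absorbs N+1, the other tends to 0. *)
Lemma nat_pow_small (r e : R) : 0 <= r < 1 -> 0 < e -> exists N0, forall N, (N0 <= N)%N -> N.+1%:R * r ^+ N < e.
Proof.
move=> /andP[r0 r1] e0; pose s := Num.sqrt r.
have s0 : 0 <= s by exact: sqrtr_ge0.
have s1 : s < 1 by rewrite -sqrtr1 ltr_sqrt.
have e1 : 0 < e * (1 - s) by rewrite mulr_gt0 // subr_gt0.
have := @cvg_expr R s; rewrite ger0_norm // => /(_ s1) /cvgrPdist_lt /(_ _ e1)[N0 _ H].
exists N0 => N /H /=; rewrite sub0r normrN ger0_norm ?exprn_ge0 // => h.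
have -> : r ^+ N = s ^+ N * s ^+ N by rewrite -exprMn -expr2 sqr_sqrtr.
rewrite mulrA; have := @nat_pow_bound s N; rewrite s0 s1 => /(_ isT) hb.
have s1' : 0 < 1 - s by rewrite subr_gt0.
rewrite -(ltr_pM2r s1') mulrAC; apply: le_lt_trans h.
rewrite -[leRHS]mul1r; apply: ler_wpM2r; first exact: exprn_ge0.
by apply: le_trans hb _; rewrite gerBl exprn_ge0.
Qed.

(* Partial sums of the expansion of (1 - x)^-2. *)
Definition kpart N (x : C) := \sum_(k < N) k.+1%:R * x ^+ k.

Lemma kpartE N x : (1 - x) ^+ 2 * kpart N x = 1 - N.+1%:R * x ^+ N + N%:R * x ^+ N.+1.
Proof.
elim: N => [|N IH]; first by rewrite /kpart big_ord0 mulr0 expr0 mul0r addr0 mul1r subrr.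
rewrite /kpart big_ord_recr /= mulrDr IH -[N.+2%:R]natr1 -[N.+1%:R]natr1 !exprS; ring.
Qed.

Lemma kpart_tail N (x : C) (r : R) : nc x <= r -> r < 1 ->
  nc ((1 - x)^-1 ^+ 2 - kpart N x) <= (1 - r)^-1 ^+ 2 * (2 * (N.+1%:R * r ^+ N)).
Proof.
move=> xr r1.
have x1 : nc x < 1 by exact: le_lt_trans r1.
have n0 : 1 - x != 0 by rewrite -[x]mul1r; apply: kden_neq0 => //; rewrite nc1.
have -> : (1 - x)^-1 ^+ 2 - kpart N x = (1 - x)^-1 ^+ 2 * (N.+1%:R * x ^+ N - N%:R * x ^+ N.+1).
  have -> : N.+1%:R * x ^+ N - N%:R * x ^+ N.+1 = 1 - (1 - x) ^+ 2 * kpart N x.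
    by rewrite kpartE; ring.
  by field.
apply: nc_leM.
  apply: nc_leX; rewrite -[x]mul1r; apply: le_trans (kinv_le _ x1) _; first by rewrite nc1.
  by rewrite lef_pV2 ?posrE ?subr_gt0 // lerD2l lerN2.
rewrite [leRHS](_ : _ = N.+1%:R * r ^+ N + N.+1%:R * r ^+ N); last by ring.
apply: nc_leB; first by apply: nc_leM; [rewrite nc_nat|exact: nc_leX].
apply: nc_leM; first by rewrite nc_nat ler_nat.
apply: le_trans (nc_leX _ xr) _; rewrite ler_wiXn2l //; last exact: ltW.
by apply: le_trans (nc_ge0 _) xr.
Qed.

Definition coef f k := CI (fun w => f w * cj w ^+ k).
Definition pol (a : nat -> C) N (z : C) := \sum_(k < N) a k * z ^+ k.
(** As z^k has squared norm 1/(k+1), this is the orthogonal projection of f onto the polynomials of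
    degree below N; it is also the Taylor polynomial of P f. *)
Definition spart f N := pol (fun k => k.+1%:R * coef f k) N.

Lemma coef_int f k : dint f -> dint (fun w => f w * cj w ^+ k).
Proof.
move=> If; apply: (@dintMb f (fun w => cj w ^+ k) (1 ^+ k)) => //.
  by apply: cmeasX; exact: cmeas_cj.
by move=> w w1; apply: nc_leX; rewrite ncJ ltW.
Qed.

Lemma pol_bnd a N z : nc z < 1 -> nc (pol a N z) <= \sum_(k < N) nc (a k).
Proof.
move=> z1; apply: le_trans (nc_sum _) _; apply: ler_sum => k _.
rewrite -[leRHS]mulr1 -(expr1n _ k); apply: nc_leM => //; apply: nc_leX; exact: ltW.
Qed.

Lemma pol_meas a N : dmeas (pol a N).
Proof.
elim: N => [|N IH].
  by under eq_fun do rewrite /pol big_ord0; exact: cmeas_cst.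
under eq_fun do rewrite /pol big_ord_recr /=.
by apply: cmeasD => //; apply: cmeasZ; apply: cmeasX; exact: cmeas_cx.
Qed.

Lemma pol_L2 a N : L2f (pol a N).
Proof. by apply: L2f_bnd; [exact: pol_meas|move=> z; exact: pol_bnd]. Qed.

Lemma proj_spart f N z : dint f -> nc z < 1 ->
  P f z - spart f N z = CI (fun w => f w * ((1 - cj w * z)^-1 ^+ 2 - kpart N (cj w * z))).
Proof.
move=> If z1.
have Ik : dint (fun w => \sum_(k < N) (k.+1%:R * z ^+ k) * (f w * cj w ^+ k)).
  by apply: dcint_sum => k; apply: dcintZ; exact: coef_int.
have -> : spart f N z = CI (fun w => \sum_(k < N) (k.+1%:R * z ^+ k) * (f w * cj w ^+ k)).
  rewrite dCI_sum; last by move=> k; apply: dcintZ; exact: coef_int.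
  apply: eq_bigr => k _; rewrite dCIZ; last exact: coef_int.
  by rewrite /coef; ring.
rewrite projE /kmom -dCIB; [|exact: kmom_int|exact: Ik].
apply: CI_eqD => p _; rewrite expr0 mul1r mulrBr; congr (_ - _).
by rewrite /kpart big_distrr /=; apply: eq_bigr => k _; rewrite exprMn; ring.
Qed.

Lemma spart_tail f N z (r : R) : dint f -> nc z <= r -> r < 1 ->
  nc (P f z - spart f N z) <=
    (1 - r)^-1 ^+ 2 * (2 * (N.+1%:R * r ^+ N)) * \int[dA R]_(p in DD) nc (f (cx p)).
Proof.
move=> If zr r1; have z1 : nc z < 1 by exact: le_lt_trans r1.
have inf := dcint_nc If.
rewrite proj_spart // -RintegralZl; [|exact: measurable_disk|exact: inf].
apply: dCI_le; [|exact: (drintZ _ inf)|].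
  have := dcintB (kmom_int 0 If z1) (dcint_sum (fun k => dcintZ (k.+1%:R * z ^+ k) (coef_int k If))).
  move=> /(_ N); apply: dint_eqD => p _; rewrite expr0 mul1r mulrBr; congr (_ - _).
  by rewrite /kpart big_distrr /=; apply: eq_bigr => k _; rewrite exprMn; ring.
move=> p; rewrite diskR2E => p1; rewrite mulrC; apply: nc_leM => //.
apply: kpart_tail => //; apply: nc_le1M => //; rewrite ncJ; exact: ltW.
Qed.

Lemma spart_cvg f z : dint f -> nc z < 1 -> ncvg (fun N => spart f N z) (P f z).
Proof.
move=> If z1 e e0.
pose A := (1 - nc z)^-1 ^+ 2 * 2 * \int[dA R]_(p in DD) nc (f (cx p)) + 1.
have I0 : 0 <= \int[dA R]_(p in DD) nc (f (cx p)) by apply: Rintegral_ge0 => p _; exact: nc_ge0.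
have A0 : 0 < A by rewrite ltr_wpDl // mulr_ge0 // mulr_ge0 // sqr_ge0.
have [N0 H] := @nat_pow_small (nc z) (e / A) ltac:(by rewrite nc_ge0 z1) ltac:(by rewrite divr_gt0).
exists N0 => N /H; rewrite ltr_pdivlMr // => h.
rewrite ncBC; apply: le_lt_trans (spart_tail N If (lexx _) z1) _; apply: le_lt_trans h.
have t0 : 0 <= N.+1%:R * nc z ^+ N by rewrite mulr_ge0 // exprn_ge0 // nc_ge0.
rewrite /A mulrDr mulr1; apply: le_trans (_ : _ <= N.+1%:R * nc z ^+ N * ((1 - nc z)^-1 ^+ 2 * 2 * \int[dA R]_(p in DD) nc (f (cx p)))) _; last by rewrite lerDl.
by rewrite le_eqVlt; apply/orP; left; apply/eqP; ring.
Qed.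

Lemma L2f_prod f g : L2f f -> L2f g -> dint (fun z => f z * cj (g z)).
Proof.
move=> [mf If] [mg Ig].
apply: (dcint_dom (cmeasM mf (cmeasJ mg)) (drintD If Ig)) => p _.
rewrite ncM ncJ; have := sqr_ge0 (nc (f (cx p)) - nc (g (cx p))).
move: (nc_ge0 (f (cx p))) (nc_ge0 (g (cx p))); move: (nc _) (nc _) => x y; rewrite !expr2; nra.
Qed.

Lemma sqC g : L2f g -> CI (fun z => g z * cj (g z)) = (sq g)%:C.
Proof.
move=> Lg; rewrite /Cintegral /sq; apply/eqP; rewrite eq_complex /=; apply/andP; split; apply/eqP.
  by apply: eq_Rintegral => p _; rewrite mulJ.
by rewrite -[RHS](RI_cst 0); apply: eq_Rintegral => p _; rewrite mulJ.
Qed.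

Lemma CI_spart f g N : L2f g -> CI (fun z => g z * cj (spart f N z)) =
  \sum_(k < N) (k.+1%:R * cj (coef f k)) * coef g k.
Proof.
move=> Lg; have Ig := L2f_int Lg.
transitivity (CI (fun w => \sum_(k < N) (k.+1%:R * cj (coef f k)) * (g w * cj w ^+ k))).
  apply: CI_eqD => p _; rewrite /spart /pol rmorph_sum big_distrr /=; apply: eq_bigr => k _.
  by rewrite !rmorphM /= rmorphXn /= conjc_nat; ring.
rewrite dCI_sum; last by move=> k; apply: dcintZ; exact: coef_int.
by apply: eq_bigr => k _; rewrite dCIZ //; exact: coef_int.
Qed.

Lemma coef_pol a N k : coef (pol a N) k = if (k < N)%N then a k / k.+1%:R else 0.
Proof.
rewrite /coef; transitivity (CI (fun w => \sum_(j < N) a j * (w ^+ j * cj w ^+ k))).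
  by apply: CI_eqD => p _; rewrite /pol big_distrl /=; apply: eq_bigr => j _; ring.
rewrite dCI_sum; last by move=> j; apply: dcintZ; exact: mono_int.
transitivity (\sum_(j < N) a j * (if (j : nat) == k then j.+1%:R^-1 else 0)).
  by apply: eq_bigr => j _; rewrite dCIZ ?moment //; exact: mono_int.
case: ifPn => kN.
  rewrite (bigD1 (Ordinal kN)) //= eqxx big1 ?addr0 // => j jk.
  by case: eqP => [jk'|_]; [move: jk; rewrite -val_eqE /= jk' eqxx|rewrite mulr0].
rewrite big1 // => j _; case: eqP => [jk|_]; last by rewrite mulr0.
by move: kN; rewrite -jk ltn_ord.
Qed.

Definition bes f N := \sum_(k < N) k.+1%:R * nc (coef f k) ^+ 2.

Lemma besC f N : \sum_(k < N) (k.+1%:R * cj (coef f k)) * coef f k = (bes f N)%:C.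
Proof.
rewrite /bes rmorph_sum /=; apply: eq_bigr => k _.
by rewrite rmorphM /= rmorph_nat -mulrA; congr (_ * _); rewrite mulrC; exact: mulJ.
Qed.

Lemma sq_spart f N : sq (spart f N) = bes f N.
Proof.
apply: (@complexI R); rewrite -sqC; last exact: pol_L2.
rewrite CI_spart; last exact: pol_L2.
rewrite -besC; apply: eq_bigr => k _; congr (_ * _).
rewrite coef_pol ltn_ord mulrC mulKf // pnatr_eq0 //.
Qed.

Lemma sq_sub_spart f N : L2f f -> sq (fun z => f z - spart f N z) = sq f - bes f N.
Proof.
move=> Lf; have LS : L2f (spart f N) := pol_L2 _ _.
apply: (@complexI R); rewrite -sqC; last exact: L2fB.
have i1 := L2f_prod Lf Lf; have i2 := L2f_prod Lf LS.
have i3 := L2f_prod LS Lf; have i4 := L2f_prod LS LS.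
transitivity (CI (fun z => f z * cj (f z)) - CI (fun z => f z * cj (spart f N z)) -
  (CI (fun z => spart f N z * cj (f z)) - CI (fun z => spart f N z * cj (spart f N z)))).
  rewrite -!dCIB //; try exact: dcintB.
  by apply: CI_eqD => p _; rewrite rmorphB /=; ring.
have E : CI (fun z => spart f N z * cj (f z)) = (bes f N)%:C.
  transitivity (cj (CI (fun z => f z * cj (spart f N z)))).
    by rewrite -dCIJ //; apply: CI_eqD => p _; rewrite rmorphM /= conjcK mulrC.
  by rewrite CI_spart // besC conjc_real.
rewrite E (sqC LS) sq_spart (CI_spart _ _ Lf) besC sqC // rmorphB /=; ring.
Qed.

Lemma bessel f N : L2f f -> bes f N <= sq f.
Proof. by move=> Lf; rewrite -subr_ge0 -sq_sub_spart // sq_ge0. Qed.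

(** The Taylor polynomials of P f converge pointwise and have norm at most that of f by Bessel;
    Fatou passes the bound to P f. *)
Lemma proj_L2 f : L2f f -> L2f (P f) /\ nrm (P f) <= nrm f.
Proof.
move=> Lf; have If := L2f_int Lf.
have [|||h1 h2] := @sq_fatou R (spart f) (P f) (sq f).
- by move=> n; exact: pol_L2.
- by move=> z z1; exact: spart_cvg.
- by move=> n; rewrite sq_spart bessel.
by split=> //; rewrite /nrm ler_wsqrtr.
Qed.

(* By Fatou the partial Bessel sums of f reach the norm of P f. *)
Lemma spart_dense f e : L2f f -> (forall z, nc z < 1 -> P f z = f z) -> 0 < e ->
  exists N, nrm (fun z => f z - spart f N z) < e.
Proof.
move=> Lf Pf e0; apply: contrapT => /forallNP H.
have If := L2f_int Lf.
have [||n|_] := @sq_fatou R (spart f) f (sq f - e ^+ 2).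
- by move=> n; exact: pol_L2.
- by move=> z z1; rewrite -Pf //; exact: spart_cvg.
- rewrite sq_spart lerBrDr -lerBrDl -sq_sub_spart // -nrm_sqr.
  by rewrite lerXn2r ?nnegrE ?nrm_ge0 ?(ltW e0) // leNgt; apply/negP; exact: H.
by have := exprn_gt0 2 e0; lra.
Qed.

Lemma proj_eval f z : L2f f -> nc z < 1 -> nc (P f z) <= (1 - nc z)^-1 ^+ 2 * nrm f.
Proof.
move=> Lf z1; rewrite projE; apply: le_trans (kmom_bnd 0 (L2f_int Lf) z1) _.
by rewrite ler_wpM2l ?sqr_ge0 // nrm_int.
Qed.

Lemma projD f g z : dint f -> dint g -> nc z < 1 -> P (fun w => f w + g w) z = P f z + P g z.
Proof.
move=> If Ig z1; rewrite !projE /kmom -dCID; [|exact: kmom_int|exact: kmom_int].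
by apply: CI_eqD => p _; rewrite mulrDl.
Qed.

Lemma projZ k f z : dint f -> nc z < 1 -> P (fun w => k * f w) z = k * P f z.
Proof.
move=> If z1; rewrite !projE /kmom -dCIZ; last exact: kmom_int.
by apply: CI_eqD => p _; rewrite -mulrA.
Qed.

Lemma proj_eq f g z : (forall w, nc w < 1 -> f w = g w) -> P f z = P g z.
Proof. by move=> fg; apply: CI_eqD => p p1; rewrite /= fg. Qed.

End Proj.

(** * The complex exponential and segment integrals *)

Section Seg.
Variable R : realType.
Notation C := R[i].
Local Notation mu := (@lebesgue_measure R).

Lemma cexp0 : cexp (0 : C) = 1.
Proof. by rewrite /cexp /= expR0 cos0 sin0 mul1r. Qed.

Lemma cexpD (z w : C) : cexp (z + w) = cexp z * cexp w.
Proof.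
case: z w => a b [c d]; rewrite /cexp /= expRD cosD sinD.
by apply/eqP; rewrite eq_complex /=; apply/andP; split; apply/eqP; ring.
Qed.

Lemma nc_cexp (z : C) : nc (cexp z) = expR (Re z).
Proof.
rewrite /cexp ncM nc_real ger0_norm ?expR_ge0 //= cos2Dsin2 sqrtr1 mulr1 //.
Qed.

Lemma nc_cexp_le (z : C) (B : R) : nc z <= B -> nc (cexp z) <= expR B.
Proof.
move=> h; rewrite nc_cexp ler_expR; apply: le_trans h; apply: le_trans (ler_norm _) (normRe_nc _).
Qed.

Lemma cderiv_cexp0 : cderiv (@cexp R) (0 : C) 1.
Proof.
(* The four error terms below contribute 1, 2, 4 and 1 times k |h|, in all 8 k |h|. The bound k <= 1
   absorbs products of small terms. *)
move=> e e0; pose k := Num.min (e / 8) 1.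
have k0 : 0 < k by rewrite lt_min divr_gt0 //= ltr01.
have ke : 8 * k <= e by rewrite mulrC -ler_pdivlMr // /k ge_min lexx.
have k1 : k <= 1 by rewrite /k ge_min lexx orbT.
clearbody k.
have [d1 d10 H1] := (rderivP (@expR R) 0 1).2 ltac:(by have := is_derive_expR (0 : R); rewrite expR0) k k0.
have [d2 d20 H2] := (rderivP (@cos R) 0 0).2 ltac:(by have := is_derive_cos (0 : R); rewrite sin0 oppr0) k k0.
have [d3 d30 H3] := (rderivP (@sin R) 0 1).2 ltac:(by have := is_derive_sin (0 : R); rewrite cos0) k k0.
exists (Num.min k (Num.min d1 (Num.min d2 d3))); first by rewrite !lt_min k0 d10 d20 d30.
move=> [a b] h; set n := nc (a +i* b) in h *.
have an : `|a| <= n := normRe_nc (a +i* b).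
have bn : `|b| <= n := normIm_nc (a +i* b).
move: h; rewrite !lt_min => /andP[nk /andP[n1 /andP[n2 n3]]].
have := H1 a (le_lt_trans an n1); have := H2 b (le_lt_trans bn n2); have := H3 b (le_lt_trans bn n3).
rewrite !add0r expR0 cos0 sin0 mul0r !mul1r !subr0 => h3 h2 h1.
rewrite cexp0; apply: le_trans (nc_ReIm _) _.
have -> : Re (cexp (a +i* b) - 1 - (a +i* b)) = (expR a - 1 - a) * cos b + (1 + a) * (cos b - 1).
  by rewrite /cexp /=; ring.
have -> : Im (cexp (a +i* b) - 1 - (a +i* b)) = (expR a - 1) * sin b + (sin b - b).
  by rewrite /cexp /=; ring.
have n0 : 0 <= n := nc_ge0 _.
have c1 : `|cos b| <= 1 by rewrite ler_norml cos_geN1 cos_le1.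
have kn : k * `|a| <= k * n by rewrite ler_wpM2l // ltW.
have kn' : k * `|b| <= k * n by rewrite ler_wpM2l // ltW.
have A1 : `|(expR a - 1 - a) * cos b| <= k * n * 1.
  by rewrite normrM; apply: ler_pM => //; exact: le_trans h1 kn.
have A2 : `|(1 + a) * (cos b - 1)| <= 2 * (k * n).
  rewrite normrM; apply: ler_pM => //; last exact: le_trans h2 kn'.
  by apply: le_trans (ler_normD _ _) _; rewrite normr1; lra.
have ea : `|expR a - 1| <= 2 * n.
  rewrite (_ : expR a - 1 = (expR a - 1 - a) + a); last by ring.
  apply: le_trans (ler_normD _ _) _.
  have : k * n <= 1 * n by rewrite ler_wpM2r.
  by lra.
have sb : `|sin b| <= 2 * k.
  rewrite (_ : sin b = (sin b - b) + b); last by ring.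
  apply: le_trans (ler_normD _ _) _.
  have : k * n <= 1 * n by rewrite ler_wpM2r.
  by lra.
have A3 : `|(expR a - 1) * sin b| <= 2 * n * (2 * k) by rewrite normrM; apply: ler_pM.
apply: (@le_trans _ _ (8 * k * n)); last by rewrite ler_wpM2r.
have := ler_normD ((expR a - 1 - a) * cos b) ((1 + a) * (cos b - 1)).
have := ler_normD ((expR a - 1) * sin b) (sin b - b).
have := le_trans h3 kn'.
lra.
Qed.

Lemma cderiv_cexp (z : C) : cderiv (@cexp R) z (cexp z).
Proof.
move=> e e0; have z0 : 0 < expR (Re z) by exact: expR_gt0.
have [d d0 H] := cderiv_cexp0 (divr_gt0 e0 z0).
exists d => // h /H; rewrite add0r cexp0 mul1r => hh.
rewrite cexpD (_ : _ - _ - _ = cexp z * (cexp h - 1 - h)); last by ring.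
rewrite ncM nc_cexp mulrC -ler_pdivlMr // mulrAC.
exact: hh.
Qed.

Lemma rderiv_continuous (f : R -> R) x l : rderiv f x l -> {for x, continuous f}.
Proof. by move=> /rderivP H; apply: differentiable_continuous; apply/derivable1_diffP; exact: ex_derive. Qed.

Lemma segment_cint (g : C -> C) v : (forall t : R, 0 <= t <= 1 -> nccont g (t%:C * v)) ->
  cint mu `[(0 : R), 1]%classic (fun t : R => g (t%:C * v)).
Proof.
move=> cg.
have main (h : C -> R) : (forall z w, `|h z - h w| <= nc (z - w)) ->
    rint mu `[(0 : R), 1]%classic (fun t : R => h (g (t%:C * v))).
  move=> hh; apply: continuous_compact_integrable; first exact: segment_compact.
  apply: continuous_in_subspaceT => t; rewrite inE /= in_itv /= => t01.
  apply/cvgrPdist_lt => e e0; have [d d0 H] := cg _ t01 e e0.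
  have v1 : 0 < nc v + 1 by rewrite ltr_wpDl // nc_ge0.
  near=> s.
  rewrite distrC; apply: le_lt_trans (hh _ _) _; apply: H.
  rewrite -mulrBl -(rmorphB (real_complex R)) ncM nc_real.
  apply: (@le_lt_trans _ _ (`|s - t| * (nc v + 1))); first by rewrite ler_wpM2l // lerDl.
  rewrite -ltr_pdivlMr // distrC.
  near: s; apply: cvgr_dist_lt; first exact: cvg_id.
  by rewrite divr_gt0.
split.
  by apply: main => z w; rewrite -(raddfB (@complex.Re R)); exact: normRe_nc.
by apply: main => z w; rewrite -(raddfB (@complex.Im R)); exact: normIm_nc.
Unshelve. all: end_near. Qed.

Lemma segment_prim (g J : C -> C) v :
  (forall t : R, 0 <= t <= 1 -> cderiv J (t%:C * v) (g (t%:C * v))) ->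
  (forall t : R, 0 <= t <= 1 -> nccont g (t%:C * v)) ->
  segment_integral g v = J v - J 0.
Proof.
move=> dJ cg; rewrite /segment_integral.
have m01 : measurable (`[(0 : R), 1]%classic : set (measurableTypeR R)) by exact: measurable_itv.
rewrite -(CIZ m01); last exact: segment_cint.
have ftc k : \int[mu]_(t in `[(0 : R), 1]) Re (k * (v * g (t%:C * v))) = Re (k * J v) - Re (k * J 0).
  pose F (t : R) := Re (k * J (t%:C * v)).
  have dF (t : R) : 0 <= t <= 1 -> rderiv F t (Re (k * (g (t%:C * v) * v))).
    move=> t01; have := @wderiv_line R J 0 v t (g (t%:C * v)) 0 k.
    rewrite add0r mul0r addr0 => /(_ ((cderivW _ _ _).1 (dJ _ t01))).
    by under eq_fun do rewrite add0r.
  have cF : {in `[(0 : R), 1], forall t, {for t, continuous F}}.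
    by move=> t; rewrite in_itv /= => /dF /rderiv_continuous.
  rewrite /Rintegral (continuous_FTC2 (F := F) ltr01).
  - by rewrite /F mul1r mul0r.
  - have := segment_cint cg => /(cintZ m01 (k * v))[]; move=> _ _.
    apply: continuous_in_subspaceT => t; rewrite inE /= in_itv /= => t01.
    have cc := cg _ t01.
    apply/cvgrPdist_lt => e e0.
    have K0 : 0 < nc (k * v) + 1 by rewrite ltr_wpDl // nc_ge0.
    have [d d0 H] := cc _ (divr_gt0 e0 K0).
    have v1 : 0 < nc v + 1 by rewrite ltr_wpDl // nc_ge0.
    near=> s.
    rewrite -(raddfB (@complex.Re R)); apply: le_lt_trans (normRe_nc _) _.
    rewrite (_ : _ - _ = (k * v) * (g (t%:C * v) - g (s%:C * v))); last by ring.
    rewrite ncM; apply: (@le_lt_trans _ _ ((nc (k * v) + 1) * nc (g (t%:C * v) - g (s%:C * v)))).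
      by rewrite ler_wpM2r ?nc_ge0 // lerDl.
    rewrite mulrC -ltr_pdivlMr // ncBC; apply: H.
    rewrite -mulrBl -(rmorphB (real_complex R)) ncM nc_real.
    apply: (@le_lt_trans _ _ (`|s - t| * (nc v + 1))); first by rewrite ler_wpM2l // lerDl.
    rewrite -ltr_pdivlMr // distrC.
    near: s; apply: cvgr_dist_lt; first exact: cvg_id.
    by rewrite divr_gt0.
  - split.
    + move=> t; rewrite in_itv /= => /andP[/ltW t0 /ltW t1].
      by have /rderivP := dF t ltac:(by rewrite t0 t1); case.
    + by apply: cvg_at_right_filter; apply: cF; rewrite in_itv /= lexx ler01.
    + by apply: cvg_at_left_filter; apply: cF; rewrite in_itv /= lexx ler01.
  - move=> t; rewrite in_itv /= => /andP[/ltW t0 /ltW t1].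
    have /rderivP [_ E] := dF t ltac:(by rewrite t0 t1).
    by rewrite derive1E E; congr Re; ring.
apply/eqP; rewrite eq_complex /Cintegral /=; apply/andP; split; apply/eqP.
  by have := ftc 1; rewrite !mul1r raddfB /= => <-; apply: eq_Rintegral => t _; rewrite mul1r.
have := ftc (- 'i); rewrite !ReMi raddfB /= => <-; apply: eq_Rintegral => t _; by rewrite ReMi.
Unshelve. all: end_near. Qed.

(** Here g' is bounded only on smaller discs, so g is first rescaled to h w = g (r w) with |z| < r <
    1. Then h is reproduced by the kernel, [proj_prim] yields a primitive of g on the disc of radius
    r, and the segment integral is its increment. *)
Lemma segment_integral_cderiv (g g' : C -> C) (B : R) :
  (forall z, nc z < 1 -> cderiv g z (g' z)) ->
  (forall r : R, 0 <= r < 1 -> exists M, forall z, nc z <= r -> nc (g' z) <= M) ->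
  (forall z, nc z < 1 -> nc (g z) <= B) ->
  forall z, nc z < 1 -> cderiv (segment_integral g) z (g z) /\ nc (segment_integral g z) <= B.
Proof.
move=> dg g'M gB z z1.
pose r := (1 + nc z) / 2.
have zr : nc z < r by rewrite /r; lra.
have r1 : r < 1 by rewrite /r; lra.
have r0 : 0 < r by apply: le_lt_trans zr; exact: nc_ge0.
have rc0 : r%:C != 0 :> C by rewrite -nc_gt0 nc_real gtr0_norm.
pose h w := g (r%:C * w).
have wr w : nc w < 1 -> nc (r%:C * w) <= r.
  by move=> w1; rewrite ncM nc_real gtr0_norm // ler_piMr ?(ltW r0) // ltW.
have [M HM] := g'M r ltac:(by rewrite ltW).
have dh w : nc w < 1 -> cderiv h w (g' (r%:C * w) * r%:C).
  move=> w1; have gw : nc (r%:C * w) < 1 by apply: le_lt_trans (wr _ w1) r1.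
  by apply: cderiv_eq (cderiv_comp (cderivZ r%:C (cderiv_id w)) (dg _ gw)) _; rewrite mulr1.
have hB w : nc w < 1 -> nc (h w) <= B.
  by move=> w1; apply: gB; apply: le_lt_trans (wr _ w1) r1.
have hM w : nc w < 1 -> nc (g' (r%:C * w) * r%:C) <= M * r.
  by move=> w1; apply: nc_leM; [apply: HM; exact: wr|rewrite nc_real gtr0_norm].
have ih : cint (dA R) (@diskR2 R) (fun p => h (cplx p)).
  by apply: (@dint_bnd _ _ B); [exact: holo_cmeas dh|move=> p; exact: hB].
pose J w := r%:C * proj_prim h (r%:C^-1 * w).
have dJ w : nc w < r -> cderiv J w (g w).
  move=> wlt; have w1 : nc (r%:C^-1 * w) < 1.
    by rewrite ncM ncV nc_real gtr0_norm // mulrC ltr_pdivrMr // mul1r.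
  apply: cderiv_eq (cderivZ r%:C (cderiv_comp (cderivZ r%:C^-1 (cderiv_id w)) (proj_prim_cderiv ih w1))) _.
  have E : r%:C * (r%:C^-1 * w) = w by rewrite mulrA mulfV // mul1r.
  by rewrite (repr_proj dh hB hM w1) /h E; field.
have J0 : J 0 = 0 by rewrite /J mulr0 proj_prim0 mulr0.
have tv (v : C) (t : R) : nc v < r -> 0 <= t <= 1 -> nc (t%:C * v) < r.
  move=> vr /andP[t0 t1]; rewrite ncM nc_real ger0_norm //; apply: le_lt_trans vr.
  by rewrite ler_piMl ?nc_ge0.
have SJ v : nc v < r -> segment_integral g v = J v.
  move=> vr; rewrite (segment_prim (J := J)) ?J0 ?subr0 //.
    by move=> t t01; apply: dJ; exact: tv.
  by move=> t t01; apply: (@cderiv_nccont _ _ _ (g' (t%:C * v))); apply: dg; apply: lt_trans r1; exact: tv.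
split.
  apply: (@cderiv_near _ J _ _ _ (r - nc z)); [by rewrite subr_gt0| |exact: dJ].
  move=> w hw; rewrite SJ // (_ : nc w = nc (z + (w - z))); last by congr nc; ring.
  by apply: le_lt_trans (ncD _ _) _; lra.
rewrite SJ // -[J z]subr0 -J0.
have B0 : 0 <= B by apply: le_trans (nc_ge0 _) (gB 0 _); rewrite nc0.
apply: (@le_trans _ _ (B * nc (z - 0))).
  apply: (@nc_mvt _ J g) => t t01; rewrite add0r subr0.
    by apply: dJ; exact: tv.
  by apply: gB; apply: lt_trans r1; exact: tv.
by rewrite subr0 ler_piMr // ltW.
Qed.
End Seg.

(** * Eigenfunctions *)

Section Eigen.
Variable R : realType.
Notation C := R[i].
Local Notation cx := (@cplx R).
Local Notation DD := (@diskR2 R).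
Local Notation CI f := (Cintegral (dA R) DD (fun p => f (cx p))).
Local Notation dint f := (cint (dA R) DD (fun p => f (cx p))).
Local Notation dmeas f := (cmeas DD (fun p => f (cx p))).
Local Notation P := (@bergman_proj R).

Lemma moebius_id (a w : C) : nc (1 - cj a * w) ^+ 2 - nc (w - a) ^+ 2 = (1 - nc a ^+ 2) * (1 - nc w ^+ 2).
Proof. by case: a => x y; case: w => u v; rewrite !nc_sqr /=; ring. Qed.

(** The pseudohyperbolic distance is at most 1. In [den_lower] this lets gamma (1 - conj(a) w)
    dominate w (psi w - psi a). *)
Lemma moebius_le (a w : C) : nc a < 1 -> nc w < 1 -> nc (w - a) <= nc (1 - cj a * w).
Proof.
move=> a1 w1; rewrite -(@ler_pXn2r _ 2) ?nnegrE ?nc_ge0 // -subr_ge0 moebius_id.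
by rewrite mulr_ge0 // subr_ge0 exprn_ile1 ?nc_ge0 // ltW.
Qed.

Variables (gamma : C) (psi psi' : C -> C).
Hypothesis gamma0 : gamma != 0.
Hypothesis dpsi : forall z, nc z < 1 -> cderiv psi z (psi' z).
Hypothesis psi'_lt : forall z, nc z < 1 -> nc (psi' z) < nc gamma.

Let Bpsi := nc (psi 0) + nc gamma.

Lemma psi_lip z w : nc z < 1 -> nc w < 1 -> nc (psi w - psi z) <= nc gamma * nc (w - z).
Proof.
move=> z1 w1; apply: (@nc_mvt _ psi psi') => t t01.
  by apply: dpsi; exact: disk_segment.
by apply/ltW/psi'_lt; exact: disk_segment.
Qed.

Lemma psi_bnd z : nc z < 1 -> nc (psi z) <= Bpsi.
Proof.
move=> z1; have := psi_lip (z := 0) (w := z); rewrite nc0 subr0 => /(_ ltr01 z1) h.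
rewrite (_ : psi z = psi 0 + (psi z - psi 0)); last by ring.
apply: le_trans (ncD _ _) _; rewrite lerD2l; apply: le_trans h _.
by rewrite ler_piMr ?nc_ge0 // ltW.
Qed.

Lemma psi_proj z : nc z < 1 -> P psi z = psi z.
Proof.
by move=> z1; apply: (repr_proj dpsi psi_bnd (fun w w1 => ltW (psi'_lt w1)) z1).
Qed.

Lemma psi_int : dint psi.
Proof. by apply: (@dint_bnd _ _ Bpsi); [exact: holo_cmeas dpsi|move=> p; exact: psi_bnd]. Qed.

(** The second derivative of psi, read off from the kernel through psi = P psi. *)
Definition psi'' z := 2 * (3 * kmom psi 2 z).

Lemma psi'E z : nc z < 1 -> psi' z = 2 * kmom psi 1 z.
Proof.
move=> z1; apply: (@cderiv_unique _ psi z); first exact: dpsi.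
have [r r0 H] := ncopen_disk z1.
apply: (@cderiv_near _ (P psi) _ _ _ r) => //; first by move=> w /H; exact: psi_proj.
exact: proj_cderiv psi_int z1.
Qed.

Lemma dpsi' z : nc z < 1 -> cderiv psi' z (psi'' z).
Proof.
move=> z1; have [r r0 H] := ncopen_disk z1.
apply: (@cderiv_near _ (fun w => 2 * kmom psi 1 w) _ _ _ r) => //.
  by move=> w /H /= w1; rewrite psi'E.
exact: cderivZ (kmom_cderiv 1 psi_int z1).
Qed.

Lemma psi''_bnd (r : R) : 0 <= r < 1 -> exists M, forall z, nc z <= r -> nc (psi'' z) <= M.
Proof.
move=> /andP[r0 r1].
exists (2 * (3 * ((1 - r)^-1 ^+ 4 * \int[dA R]_(p in DD) nc (psi (cx p))))) => z zr.
have z1 : nc z < 1 by exact: le_lt_trans r1.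
apply: nc_leM; first by rewrite nc_nat.
apply: nc_leM; first by rewrite nc_nat.
apply: le_trans (kmom_bnd 2 psi_int z1) _; apply: ler_wpM2r.
  by apply: Rintegral_ge0 => p _; exact: nc_ge0.
by rewrite lerXn2r ?nnegrE ?invr_ge0 ?subr_ge0 ?(ltW z1) ?(ltW r1) // lef_pV2 ?posrE ?subr_gt0 // lerD2l lerN2.
Qed.

Definition den l w := gamma + w * (psi w - l).

Lemma denB l l' w : den l' w = den l w - w * (l' - l).
Proof. rewrite /den; ring. Qed.

(** For l = Psi(a) the denominator is gamma (1 - conj(a) w) + w (psi w - psi a). Since |psi w - psi
    a| <= |gamma| |w - a| <= |gamma| |1 - conj(a) w|, its modulus is at least a multiple of 1 - |w|,
    which degenerates at the circle. The strict inequality |psi' a| < |gamma| supplies a fixed gain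
    once w is away from a; near a, 1 - |w| is itself bounded below. *)
Lemma den_lower a : nc a < 1 -> exists2 c : R, 0 < c &
  forall w, nc w < 1 -> c <= nc (den (symbol gamma psi a) w).
Proof.
move=> a1.
pose k := (nc (psi' a) + nc gamma) / 2.
have kg : k < nc gamma by have := psi'_lt a1; rewrite /k; lra.
have ka : 0 < k - nc (psi' a) by have := psi'_lt a1; rewrite /k; lra.
have [d d0 Hd] := cderiv_cont (dpsi' a1) ka.
pose al := 1 - nc a; have al0 : 0 < al by rewrite subr_gt0.
(* dl < d makes k a bound for |psi'| on the small disc about a; dl <= al/2 keeps that disc at
   distance al/2 from the circle. *)
pose dl := Num.min (d / 2) (al / 2).
have dl0 : 0 < dl by rewrite lt_min !divr_gt0.
have dld : dl < d by rewrite /dl gt_min; apply/orP; left; lra.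
have dla : dl <= al / 2 by rewrite /dl ge_min lexx orbT.
clearbody dl.
have psik w : nc (w - a) < d -> nc (psi' w) <= k.
  move=> /Hd h; rewrite (_ : psi' w = psi' a + (psi' w - psi' a)); last by ring.
  by apply: le_trans (ncD _ _) _; lra.
(* The segment from a to a distant w runs over a length dl inside the small disc, where |psi'| <= k
   replaces |psi'| <= |gamma|. *)
pose eta := (nc gamma - k) * dl.
have eta0 : 0 < eta by rewrite mulr_gt0 // subr_gt0.
have ng0 : 0 < nc gamma by rewrite nc_gt0.
have denE w : den (symbol gamma psi a) w = gamma * (1 - cj a * w) + w * (psi w - psi a).
  by rewrite /den /symbol; ring.
have al_le w : nc w < 1 -> al <= nc (1 - cj a * w).
  move=> w1; have := ncBl 1 (cj a * w); rewrite nc1 ncM ncJ; apply: le_trans.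
  by rewrite lerD2l lerN2 ler_piMr ?nc_ge0 // ltW.
have lower w (e : R) : 0 <= e -> nc w < 1 -> nc (psi w - psi a) <= nc gamma * nc (w - a) - e ->
    nc gamma * al * (1 - nc w) + e * nc w <= nc (den (symbol gamma psi a) w).
  move=> e0 w1 h; rewrite denE.
  have := ncBl (gamma * (1 - cj a * w)) (- (w * (psi w - psi a))).
  rewrite opprK ncN !ncM; apply: le_trans.
  have m1 : nc gamma * nc (w - a) <= nc gamma * nc (1 - cj a * w) by rewrite ler_pM2l // moebius_le.
  have m2 : nc w * nc (psi w - psi a) <= nc w * (nc gamma * nc (1 - cj a * w) - e).
    by rewrite ler_wpM2l ?nc_ge0 //; lra.
  have m3 : nc gamma * al * (1 - nc w) <= nc gamma * nc (1 - cj a * w) * (1 - nc w).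
    by rewrite ler_wpM2r ?subr_ge0 ?(ltW w1) // ler_pM2l // al_le.
  move: m2 m3; move: (nc gamma * nc _) (nc w * nc _) (nc gamma * al) => x y v.
  by rewrite !mulrBr !mulr1; lra.
exists (Num.min (Num.min (nc gamma * al) eta) (nc gamma * al * (al / 2))).
  by rewrite !lt_min eta0 !mulr_gt0 // divr_gt0.
move=> w w1; have [near|far] := ltP (nc (w - a)) dl.
  apply: (@le_trans _ _ (nc gamma * al * (al / 2))); first by rewrite ge_min lexx orbT.
  apply: le_trans (lower w 0 (lexx _) w1 _); last by rewrite subr0 psi_lip.
  rewrite mul0r addr0 ler_pM2l ?mulr_gt0 //.
  have : nc w <= nc a + nc (w - a) by rewrite (_ : nc w = nc (a + (w - a))) ?ncD //; congr nc; ring.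
  by rewrite /al in dla *; lra.
apply: (@le_trans _ _ (Num.min (nc gamma * al) eta)); first by rewrite ge_min lexx.
have wa0 : 0 < nc (w - a) by exact: lt_le_trans far.
apply: le_trans (lower w eta (ltW eta0) w1 _).
  set m := Num.min _ _.
  have m1 : m <= nc gamma * al by rewrite ge_min lexx.
  have m2 : m <= eta by rewrite ge_min lexx orbT.
  have -> : m = m * (1 - nc w) + m * nc w by ring.
  by apply: lerD; apply: ler_wpM2r; rewrite ?nc_ge0 ?subr_ge0 ?(ltW w1).
pose s := dl / nc (w - a).
have s0 : 0 <= s by rewrite divr_ge0 ?nc_ge0 // ltW.
have s1 : s <= 1 by rewrite ler_pdivrMr // mul1r.
(* The point where the segment from a to w leaves the small disc. *)
pose m := a + s%:C * (w - a).
have m1 : nc m < 1 by apply: disk_segment; rewrite ?s0.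
have ma : nc (m - a) = dl.
  rewrite (_ : m - a = s%:C * (w - a)); last by rewrite /m; ring.
  by rewrite ncM nc_real ger0_norm // /s divfK // gt_eqF.
have wm : nc (w - m) = nc (w - a) - dl.
  rewrite (_ : w - m = (1 - s)%:C * (w - a)); last by rewrite /m rmorphB rmorph1 /=; ring.
  rewrite ncM nc_real ger0_norm ?subr_ge0 // mulrBl mul1r /s divfK // gt_eqF //.
have p1 : nc (psi m - psi a) <= k * nc (m - a).
  apply: (@nc_mvt _ psi psi') => t t01; first by apply: dpsi; exact: disk_segment.
  apply: psik; rewrite addrC addKr ncM nc_real ma ger0_norm; last by case/andP: t01.
  by apply: le_lt_trans dld; rewrite ler_piMl ?(ltW dl0) //; case/andP: t01.
have p2 := psi_lip m1 w1.
rewrite (_ : psi w - psi a = (psi w - psi m) + (psi m - psi a)); last by ring.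
apply: le_trans (ncD _ _) _; rewrite wm in p2; rewrite ma in p1.
apply: le_trans (lerD p2 p1) _.
by rewrite le_eqVlt; apply/orP; left; apply/eqP; rewrite /eta; ring.
Qed.

Section fixed_l.
Variables (l : C) (c : R).
Hypothesis c0 : 0 < c.
Hypothesis cden : forall w, nc w < 1 -> c <= nc (den l w).

Let den0 w : nc w < 1 -> den l w != 0.
Proof. by move=> w1; rewrite -nc_gt0; apply: lt_le_trans (cden w1). Qed.

Let deninv w : nc w < 1 -> nc (den l w)^-1 <= c^-1.
Proof.
by move=> w1; rewrite ncV lef_pV2 ?cden // posrE // nc_gt0 den0.
Qed.

Let dpl w : nc w < 1 -> cderiv (fun w => psi w - l) w (psi' w).
Proof. by move=> w1; apply: cderiv_eq (cderivB (dpsi w1) (cderiv_cst l w)) _; exact: subr0. Qed.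

Definition den' w := (psi w - l) + w * psi' w.

Lemma den_cderiv w : nc w < 1 -> cderiv (den l) w (den' w).
Proof.
move=> w1.
apply: cderiv_eq (cderivD (cderiv_cst gamma w) (cderivM (cderiv_id w) (dpl w1))) _.
by rewrite /den' mul1r add0r.
Qed.

Definition glnum w := w * psi' w + 2 * (psi w - l).
Definition glnum' w := (psi' w + w * psi'' w) + 2 * psi' w.
(** Minus the logarithmic derivative of the eigenfunction. *)
Definition gl w := glnum w / den l w.
Definition gl' w := glnum' w / den l w + glnum w * (- (den' w / den l w ^+ 2)).

Let Bl := nc gamma + 2 * (Bpsi + nc l).
Definition Bgl := Bl / c.

Lemma num_bnd w : nc w < 1 -> nc (glnum w) <= Bl.
Proof.
move=> w1; apply: nc_leD; first by apply: nc_le1M; [exact: ltW|exact/ltW/psi'_lt].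
by apply: nc_leM; [rewrite nc_nat|apply: nc_leB => //; exact: psi_bnd].
Qed.

Lemma gl_bnd w : nc w < 1 -> nc (gl w) <= Bgl.
Proof. by move=> w1; apply: nc_leM; [exact: num_bnd|exact: deninv]. Qed.

Lemma num_cderiv w : nc w < 1 -> cderiv glnum w (glnum' w).
Proof.
move=> w1; apply: cderivD; last by apply: cderivZ; exact: dpl.
by apply: cderiv_eq (cderivM (cderiv_id w) (dpsi' w1)) _; rewrite mul1r.
Qed.

Lemma gl_cderiv w : nc w < 1 -> cderiv gl w (gl' w).
Proof.
move=> w1; apply: cderivM; first exact: num_cderiv.
by apply: cderivV; [exact: den0|exact: den_cderiv].
Qed.

Lemma den'_bnd w : nc w < 1 -> nc (den' w) <= Bpsi + nc l + nc gamma.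
Proof.
move=> w1; apply: nc_leD; first by apply: nc_leB => //; exact: psi_bnd.
by apply: nc_le1M; [exact: ltW|exact/ltW/psi'_lt].
Qed.

Lemma gl'_bnd (r : R) : 0 <= r < 1 -> exists M, forall z, nc z <= r -> nc (gl' z) <= M.
Proof.
move=> r01; have [M HM] := psi''_bnd r01; have /andP[r0 r1] := r01.
exists ((nc gamma + M + 2 * nc gamma) * c^-1 + Bl * ((Bpsi + nc l + nc gamma) * c^-1 ^+ 2)) => z zr.
have z1 : nc z < 1 by exact: le_lt_trans r1.
have pg := ltW (psi'_lt z1).
apply: nc_leD.
  apply: nc_leM; last exact: deninv.
  apply: nc_leD; last by apply: nc_leM => //; rewrite nc_nat.
  by apply: nc_leD => //; apply: nc_le1M; [exact: ltW|exact: HM].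
apply: nc_leM; first exact: num_bnd.
by rewrite ncN; apply: nc_leM; [exact: den'_bnd|rewrite -exprVn; apply: nc_leX; exact: deninv].
Qed.

Definition fl z := cexp (- segment_integral gl z).

Lemma fl_cderiv z : nc z < 1 -> cderiv fl z (- (gl z * fl z)).
Proof.
move=> z1; have [H _] := segment_integral_cderiv gl_cderiv gl'_bnd gl_bnd z1.
by apply: cderiv_eq (cderiv_comp (cderivN H) (cderiv_cexp _)) _; rewrite /fl; ring.
Qed.

Lemma fl_bnd z : nc z < 1 -> nc (fl z) <= expR Bgl.
Proof.
move=> z1; have [_ H] := segment_integral_cderiv gl_cderiv gl'_bnd gl_bnd z1.
by apply: nc_cexp_le; rewrite ncN.
Qed.

Lemma fl'_bnd z : nc z < 1 -> nc (- (gl z * fl z)) <= Bgl * expR Bgl.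
Proof. by move=> z1; rewrite ncN; apply: nc_leM; [exact: gl_bnd|exact: fl_bnd]. Qed.

Lemma fl_L2 : L2f fl.
Proof. by apply: L2f_bnd; [exact: holo_cmeas fl_cderiv|exact: fl_bnd]. Qed.

Lemma fl_proj z : nc z < 1 -> P fl z = fl z.
Proof. exact: (repr_proj fl_cderiv fl_bnd fl'_bnd). Qed.

Lemma symbol_bnd w : nc w < 1 -> nc (symbol gamma psi w) <= nc gamma + Bpsi.
Proof.
move=> w1; apply: nc_leD; last exact: psi_bnd.
by rewrite mulrC; apply: nc_le1M => //; rewrite ncJ ltW.
Qed.

Lemma symbol_meas : dmeas (symbol gamma psi).
Proof. by apply: cmeasD; [apply: cmeasZ; exact: cmeas_cj|exact: holo_cmeas dpsi]. Qed.

(* (symbol - l) f = - d/dw (rho * den * f), which integrates to zero against an antiholomorphic kernel *)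
Lemma toeplitz_fl z : nc z < 1 -> toeplitz (symbol gamma psi) fl z = l * fl z.
Proof.
move=> z1; pose q w := (1 - cj w * z)^-1 ^+ 2; pose Q := (1 - nc z)^-1.
have qQ w : nc w < 1 -> nc (1 - cj w * z)^-1 <= Q by move=> w1; exact: kinv_cj_le.
have wq w : nc w < 1 -> wderiv q w 0 (2 * (z * (1 - cj w * z)^-1 ^+ 3)).
  move=> w1; have n0 := kden_cj_neq0 w1 z1.
  have := wderiv_comp (wderiv_cj w) (cderiv_sqr (cderiv_kinv n0)).
  rewrite mulr0 mulr1 => H; apply: wderiv_eq H _ _ => //; ring.
have Bd w : nc w < 1 -> nc (den l w) <= nc gamma + (Bpsi + nc l).
  move=> w1; apply: nc_leD => //; apply: nc_le1M; first exact: ltW.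
  by apply: nc_leB => //; exact: psi_bnd.
pose G w := den l w * fl w * q w.
have dG w : nc w < 1 -> wderiv G w ((den' w * fl w + den l w * - (gl w * fl w)) * q w)
    (den l w * fl w * (2 * (z * (1 - cj w * z)^-1 ^+ 3))).
  move=> w1; have H := (cderivW _ _ _).1 (cderivM (den_cderiv w1) (fl_cderiv w1)).
  apply: wderiv_eq (wderivM H (wq _ w1)) _ _; ring.
have [||iG _ zero _] := @green_rho R ((nc gamma + (Bpsi + nc l)) * expR Bgl * Q ^+ 2)
  (((Bpsi + nc l + nc gamma) * expR Bgl + (nc gamma + (Bpsi + nc l)) * (Bgl * expR Bgl)) * Q ^+ 2 +
   (nc gamma + (Bpsi + nc l)) * expR Bgl * (2 * (1 * Q ^+ 3))) G _ _ dG.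
- move=> w w1; apply: nc_leM; last by apply: nc_leX; exact: qQ.
  by apply: nc_leM; [exact: Bd|exact: fl_bnd].
- move=> w w1; apply: lerD.
    apply: nc_leM; last by apply: nc_leX; exact: qQ.
    apply: nc_leD; first by apply: nc_leM; [exact: den'_bnd|exact: fl_bnd].
    by apply: nc_leM; [exact: Bd|exact: fl'_bnd].
  apply: nc_leM; first by apply: nc_leM; [exact: Bd|exact: fl_bnd].
  apply: nc_leM; first by rewrite nc_nat.
  by apply: nc_leM; [exact: ltW|apply: nc_leX; exact: qQ].
have Lf := fl_L2.
have Ls : L2f (fun w => symbol gamma psi w * fl w) := L2fM symbol_meas symbol_bnd Lf.
rewrite -fl_proj // -projZ; [|exact: L2f_int|by []].
rewrite /toeplitz !projE /kmom.
apply/eqP; rewrite -subr_eq0 -dCIB; [|exact: kmom_int (L2f_int Ls) z1|exact: kmom_int (L2f_int (L2fZ l Lf)) z1].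
rewrite -oppr_eq0 -dCIN; last by apply: dcintB; [exact: kmom_int (L2f_int Ls) z1|exact: kmom_int (L2f_int (L2fZ l Lf)) z1].
rewrite -[X in _ == X]zero; apply/eqP; apply: CI_eqD => p p1.
have n0 := den0 p1.
(* den' - glnum is - (psi - l), so rho (den' - glnum) - conj(w) den = - (symbol - l): the terms in
   |w|^2 cancel. *)
have E : den l (cx p) * - (gl (cx p) * fl (cx p)) = - (glnum (cx p) * fl (cx p)) by rewrite /gl; field.
rewrite E /G /den' /glnum /den /rho /symbol expr0 /q; ring.
Qed.

End fixed_l.

Lemma eigenfunE l : psi' = derive1 psi -> eigenfun gamma psi l = fl l.
Proof. by move=> h; apply/funext => z; rewrite /eigenfun /fl /gl /glnum h. Qed.

End Eigen.

(** * Interpolation at scaled roots of unity *)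

Section Interp.
Variable R : realType.
Notation C := R[i].
Local Notation cx := (@cplx R).
Local Notation DD := (@diskR2 R).
Local Notation P := (@bergman_proj R).

(** X^n - 1 splits and is separable, so there are n distinct n-th roots of unity, which forces a
    primitive one. *)
Lemma prim_root_exists n : (0 < n)%N -> exists z : C, n.-primitive_root z.
Proof.
move=> n_gt0; pose p : {poly C} := 'X^n - 1; have [r Dp] := closed_field_poly_normal p.
rewrite (monicP _) ?monicXnsubC // scale1r in Dp.
have rn1 : all n.-unity_root r by apply/allP => z; rewrite -root_prod_XsubC -Dp.
have sz_r : (n < (size r).+1)%N by rewrite -(size_prod_XsubC r id) -Dp size_XnsubC.
have [|z] := hasP (cyclic.has_prim_root n_gt0 rn1 _ sz_r); last by exists z.
by rewrite -separable.separable_prod_XsubC -Dp cyclotomic.separable_Xn_sub_1 // pnatr_eq0 -lt0n.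
Qed.

(** A geometric sum whose ratio z^(m-k) is an n-th root of unity, equal to 1 only for m = k because
    both exponents are below n. *)
Lemma sum_prim_root n (z : C) (m k : 'I_n) : n.-primitive_root z ->
  \sum_(j < n) (z ^+ j) ^+ m / (z ^+ j) ^+ k = if m == k then n%:R else 0.
Proof.
move=> pz; have n0 := prim_order_gt0 pz.
have z0 : z != 0.
  by apply/eqP => zE; move: (prim_expr_order pz); rewrite zE expr0n eqn0Ngt n0 => /esym/eqP; rewrite oner_eq0.
pose u := z ^+ m / z ^+ k.
have uj j : (z ^+ j) ^+ m / (z ^+ j) ^+ k = u ^+ j by rewrite /u expr_div_n -!exprM mulnC [(j * k)%N]mulnC.
under eq_bigr do rewrite uj.
case: eqP => [mk|mk].
  rewrite /u mk divff ?expf_neq0 //; under eq_bigr do rewrite expr1n.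
  by rewrite sumr_const card_ord.
have u1 : u - 1 != 0.
  rewrite subr_eq0 /u; apply/eqP => h; apply: mk; apply/val_inj/eqP.
  rewrite -[X in X == _](modn_small (ltn_ord m)) -[X in _ == X](modn_small (ltn_ord k)) -(eq_prim_root_expr pz).
  by rewrite -[z ^+ k]mul1r -h divfK // expf_neq0.
apply: (mulfI u1); rewrite mulr0 -subrX1 /u expr_div_n -!exprM ![(_ * n)%N]mulnC !exprM.
by rewrite (prim_expr_order pz) !expr1n divff ?oner_eq0 // subrr.
Qed.

(* The nodes are the n-th roots of unity scaled to radius [eps]. *)
Lemma pol_interp n (eps rho : R) x : (0 < n)%N -> 0 < eps -> eps <= rho -> nc x <= rho ->
  exists c v : 'I_n -> C, [/\ forall j, nc (v j) = eps, forall j, nc (c j) <= (rho / eps) ^+ n &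
    forall a, \sum_(j < n) c j * pol a n (v j) = pol a n x].
Proof.
move=> n0 e0 er xr; have [z pz] := prim_root_exists n0.
have nz1 : nc z = 1.
  apply/eqP; rewrite -(@pexpr_eq1 _ _ n) ?nc_ge0 // -ncX (prim_expr_order pz) nc1 eqxx //.
pose v (j : 'I_n) : C := eps%:C * z ^+ j.
have nv j : nc (v j) = eps by rewrite ncM ncX nz1 expr1n mulr1 nc_real gtr0_norm.
have v0 j : v j != 0 by rewrite -nc_gt0 nv.
have nR : (n%:R : C) != 0 by rewrite pnatr_eq0 -lt0n.
have ec0 : eps%:C != 0 :> C by rewrite -nc_gt0 nc_real gtr0_norm.
have z0 : z != 0 by rewrite -nc_gt0 nz1.
exists (fun j => n%:R^-1 * \sum_(k < n) x ^+ k / v j ^+ k), v; split=> // [j|a].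
  have q1 : 1 <= rho / eps by rewrite ler_pdivlMr // mul1r.
  rewrite ncM ncV nc_nat mulrC ler_pdivrMr ?ltr0n //.
  apply: le_trans (nc_sum _) _.
  apply: (@le_trans _ _ (\sum_(k < n) (rho / eps) ^+ n)); last first.
    by rewrite sumr_const card_ord mulr_natr.
  apply: ler_sum => k _; rewrite -expr_div_n ncX.
  apply: (@le_trans _ _ ((rho / eps) ^+ k)); last by apply: ler_weXn2l => //; exact: ltnW.
  rewrite lerXn2r ?nnegrE ?nc_ge0 //; first exact: le_trans q1.
  rewrite ncM ncV nv.
  by rewrite ler_pM2r ?invr_gt0.
have mono (m : 'I_n) : \sum_(j < n) (n%:R^-1 * \sum_(k < n) x ^+ k / v j ^+ k) * v j ^+ m = x ^+ m.
  have E j : (n%:R^-1 * \sum_(k < n) x ^+ k / v j ^+ k) * v j ^+ m =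
      \sum_(k < n) (n%:R^-1 * (x ^+ k * (eps%:C ^+ m / eps%:C ^+ k))) * ((z ^+ j) ^+ m / (z ^+ j) ^+ k).
    rewrite big_distrr big_distrl; apply: eq_bigr => k _; rewrite /v !exprMn.
    have := expf_neq0 k ec0; have := expf_neq0 k (expf_neq0 j z0).
    move: (x ^+ k) (eps%:C ^+ m) (eps%:C ^+ k) ((z ^+ j) ^+ m) ((z ^+ j) ^+ k) => a1 a2 a3 a4 a5 h5 h3.
    by rewrite /=; field; rewrite nR h3 h5.
  under eq_bigr do rewrite E.
  rewrite exchange_big /=; under eq_bigr => k _ do rewrite -big_distrr sum_prim_root //.
  rewrite (bigD1 m) //= eqxx big1 ?addr0; last by move=> k /negPf km; rewrite eq_sym km mulr0.
  by field; rewrite nR expf_neq0.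
rewrite /pol; under eq_bigr do rewrite big_distrr.
rewrite exchange_big /=; apply: eq_bigr => m _.
by rewrite -[in RHS](mono m) big_distrr /=; apply: eq_bigr => j _; ring.
Qed.

(** The growth (rho/eps)^N of the weights is compensated by the Taylor remainder at the nodes, of
    order N eps^N; what is left is of order N^2 rho^N. Nodes and weights are fixed before H, as a
    single choice must serve the functions l |-> f_l(z) for all z. *)
Lemma interp (eps rho eta : R) x : 0 < eps -> eps <= rho -> rho < 1 -> nc x <= rho -> 0 < eta ->
  exists n (c v : 'I_n -> C), (forall j, nc (v j) <= eps) /\
    forall H H' B M, (forall z, nc z < 1 -> cderiv H z (H' z)) ->
      (forall z, nc z < 1 -> nc (H z) <= B) -> (forall z, nc z < 1 -> nc (H' z) <= M) ->
      nc (H x - \sum_(j < n) c j * H (v j)) <= eta * B.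
Proof.
move=> e0 er r1 xr eta0.
have rho0 : 0 < rho by exact: lt_le_trans er.
pose s := Num.sqrt rho.
have s01 : 0 <= s < 1 by rewrite sqrtr_ge0 -sqrtr1 ltr_sqrt.
pose q := (1 - rho)^-1; have q0 : 0 < q by rewrite invr_gt0 subr_gt0.
(* The quantity to be made small is the square of (N+1) s^N, which is at most (N+1) s^N as soon as
   the latter is at most 1. *)
pose e := Num.min 1 (eta / (q ^+ 2 * 2)).
have e'0 : 0 < e by rewrite lt_min ltr01 divr_gt0 // mulr_gt0 // exprn_gt0.
have [N0 HN] := nat_pow_small s01 e'0.
pose N := N0.+1.
have hN : q ^+ 2 * 2 * (N.+1%:R * s ^+ N) ^+ 2 <= eta.
  have hle := ltW (HN N (leqnSn _)).
  have t0 : 0 <= N.+1%:R * s ^+ N by rewrite mulr_ge0 // exprn_ge0 //; case/andP: s01.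
  rewrite mulrC -ler_pdivlMr ?mulr_gt0 ?exprn_gt0 //.
  have h1 : N.+1%:R * s ^+ N <= 1 by apply: le_trans hle _; rewrite /e ge_min lexx.
  have h2 : N.+1%:R * s ^+ N <= eta / (q ^+ 2 * 2) by apply: le_trans hle _; rewrite /e ge_min lexx orbT.
  by apply: le_trans h2; rewrite expr2 ler_piMl.
have [c [v [nv nC ex]]] := @pol_interp N eps rho x (ltn0Sn _) e0 er xr.
exists N, c, v; split=> [j|H H' B M dH hB hM]; first by rewrite nv.
have B0 : 0 <= B by apply: le_trans (nc_ge0 _) (hB 0 _); rewrite nc0.
have LH : L2f H by apply: L2f_bnd hB; exact: holo_cmeas dH.
have IH := L2f_int LH.
have IB : \int[dA R]_(p in DD) nc (H (cx p)) <= B.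
  by apply: le_trans (nrm_int LH) _; apply: nrm_bnd => //; exact: holo_cmeas dH.
have v1 j : nc (v j) < 1 by rewrite nv; exact: le_lt_trans r1.
have tail z (r : R) : nc z <= r -> r <= rho -> nc (H z - spart H N z) <= q ^+ 2 * (2 * (N.+1%:R * r ^+ N)) * B.
  move=> zr rr; have r1' : r < 1 by exact: le_lt_trans r1.
  have r0 : 0 <= r by apply: le_trans (nc_ge0 _) zr.
  have z1 : nc z < 1 by exact: le_lt_trans r1'.
  rewrite -{1}(repr_proj dH hB hM z1); apply: le_trans (spart_tail N IH zr r1') _.
  have t0 : 0 <= 2 * (N.+1%:R * r ^+ N) by rewrite !mulr_ge0 // exprn_ge0.
  apply: ler_pM => //.
  - by rewrite mulr_ge0 // sqr_ge0.
  - by apply: Rintegral_ge0 => p _; exact: nc_ge0.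
  apply: ler_wpM2r => //; rewrite lerXn2r ?nnegrE ?invr_ge0 ?subr_ge0 ?(ltW r1') ?(ltW r1) //.
  by rewrite lef_pV2 ?posrE ?subr_gt0 // lerD2l lerN2.
have -> : H x - \sum_(j < N) c j * H (v j) =
    (H x - spart H N x) - \sum_(j < N) c j * (H (v j) - spart H N (v j)).
  have <- : \sum_(j < N) c j * spart H N (v j) = spart H N x := ex _.
  have -> : \sum_(j < N) c j * (H (v j) - spart H N (v j)) =
      \sum_(j < N) c j * H (v j) - \sum_(j < N) c j * spart H N (v j).
    by rewrite -sumrB; apply: eq_bigr => j _; rewrite mulrBr.
  ring.
apply: (@le_trans _ _ (q ^+ 2 * (2 * (N.+1%:R * rho ^+ N)) * B +
    N%:R * ((rho / eps) ^+ N * (q ^+ 2 * (2 * (N.+1%:R * eps ^+ N)) * B)))).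
  apply: nc_leB; first exact: tail.
  apply: le_trans (nc_sum _) _; rewrite -[N in N%:R * _]card_ord mulr_natl -sumr_const.
  by apply: ler_sum => j _; apply: nc_leM => //; apply: tail => //; rewrite nv.
(* Both contributions together equal this: (N+1) rho^N + N (N+1) rho^N = (N+1)^2 rho^N, and eps has
   cancelled. *)
apply: (@le_trans _ _ (q ^+ 2 * 2 * (N.+1%:R * s ^+ N) ^+ 2 * B)); last by rewrite ler_wpM2r.
rewrite le_eqVlt; apply/orP; left; apply/eqP.
have -> : (N.+1%:R * s ^+ N) ^+ 2 = N.+1%:R ^+ 2 * rho ^+ N.
  by rewrite exprMn [_ ^+ N ^+ 2]exprAC sqr_sqrtr // ltW.
rewrite expr_div_n -natr1; field; rewrite expf_neq0 //; exact: lt0r_neq0.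
Qed.
End Interp.

(** * Holomorphic dependence on the eigenvalue *)

Section EigenPath.
Variable R : realType.
Notation C := R[i].
Local Notation mu := (@lebesgue_measure R).
Variables (gamma : C) (psi psi' : C -> C).
Hypothesis gamma0 : gamma != 0.
Hypothesis dpsi : forall z, nc z < 1 -> cderiv psi z (psi' z).
Hypothesis psi'_lt : forall z, nc z < 1 -> nc (psi' z) < nc gamma.
Let Bpsi := nc (psi 0) + nc gamma.
Local Notation den := (den gamma psi).
Local Notation num := (glnum psi psi').
Local Notation gl := (gl gamma psi psi').
Local Notation fl := (fl gamma psi psi').

Definition den_ge c l := forall w, nc w < 1 -> c <= nc (den l w).

Lemma den_ge_near (c r : R) l l' : den_ge c l -> nc (l' - l) <= r -> den_ge (c - r) l'.
Proof.
move=> h hr w w1; rewrite (denB gamma psi l).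
apply: le_trans (ncBl _ _); apply: lerB; first exact: h.
by apply: nc_le1M => //; exact: ltW.
Qed.

Lemma rint01_cst (k : R) : rint mu `[(0 : R), 1]%classic (fun=> k).
Proof.
have h := @segment_cint R (fun=> k%:C) 0 (fun t _ => cderiv_nccont (cderiv_cst _ _)).
by case: h.
Qed.

(** The derivatives of [gl] and [fl] with respect to l; the second comes from differentiation under
    the segment integral. *)
Definition dgl l w := - (2 * (den l w)^-1) + num l w * (w * (den l w)^-1 ^+ 2).
Definition dfl z l := - (z * Cintegral mu `[(0 : R), 1]%classic (fun t : R => dgl l (t%:C * z))) * fl l z.

Section lambda.
Variables (l0 : C) (c : R).
Hypothesis c0 : 0 < c.
Hypothesis cden : den_ge c l0.
(** As |w| < 1, moving l by less than c/2 keeps the denominators above c/2. *)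
Let h := c / 2.
Let h0 : 0 < h. Proof. by rewrite divr_gt0. Qed.

Let cden' l : nc (l - l0) < h -> den_ge h l.
Proof. by move=> ll; have := den_ge_near cden (ltW ll); rewrite (_ : c - h = h) // /h; lra. Qed.

Let Bn := nc gamma + 2 * (Bpsi + (nc l0 + h)).

Let num_le l w : nc (l - l0) < h -> nc w < 1 -> nc (num l w) <= Bn.
Proof.
move=> ll w1; apply: le_trans (num_bnd dpsi psi'_lt l w1) _.
have : nc l <= nc l0 + nc (l - l0) by rewrite (_ : nc l = nc (l0 + (l - l0))) ?ncD //; congr nc; ring.
by rewrite /Bn /Bpsi; lra.
Qed.

Let den0 l w : nc (l - l0) < h -> nc w < 1 -> den l w != 0.
Proof. by move=> ll w1; rewrite -nc_gt0; apply: lt_le_trans (cden' ll w1). Qed.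

Let deninv l w : nc (l - l0) < h -> nc w < 1 -> nc (den l w)^-1 <= h^-1.
Proof.
by move=> ll w1; rewrite ncV lef_pV2 ?cden' // posrE // nc_gt0 den0.
Qed.

Let dden l w : nc (l - l0) < h -> nc w < 1 -> cderiv (fun l => (den l w)^-1) l (w * (den l w)^-1 ^+ 2).
Proof.
move=> ll w1; have n0 := den0 ll w1.
have H := cderivB (cderiv_cst (psi w) l) (cderiv_id l).
have := @cderivV _ (fun l => den l w) l _ n0 (cderivD (cderiv_cst gamma l) (cderivZ w H)).
by move/cderiv_eq; apply; field.
Qed.

Let dnum l w : cderiv (fun l => num l w) l (- 2).
Proof.
have H := cderivB (cderiv_cst (psi w) l) (cderiv_id l).
by apply: cderiv_eq (cderivD (cderiv_cst (w * psi' w) l) (cderivZ 2 H)) _; ring.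
Qed.

Let dglE l w : nc (l - l0) < h -> nc w < 1 -> cderiv (fun l => gl l w) l (dgl l w).
Proof.
move=> ll w1; apply: cderiv_eq (cderivM (dnum l w) (dden ll w1)) _.
by rewrite /dgl; ring.
Qed.

Let dgl2 l w := - (2 * (w * (den l w)^-1 ^+ 2)) +
  (- 2 * (w * (den l w)^-1 ^+ 2) + num l w * (w * (2 * (den l w)^-1 * (w * (den l w)^-1 ^+ 2)))).

Let ddgl l w : nc (l - l0) < h -> nc w < 1 -> cderiv (fun l => dgl l w) l (dgl2 l w).
Proof.
move=> ll w1; have D := dden ll w1.
apply: cderivD; first by apply: cderivN; apply: cderivZ.
by apply: cderivM (dnum l w) (cderivZ w (cderiv_sqr D)).
Qed.

Let K1 := 2 * h^-1 + Bn * (1 * h^-1 ^+ 2).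
Let K2 := 2 * (1 * h^-1 ^+ 2) + (2 * (1 * h^-1 ^+ 2) + Bn * (1 * (2 * h^-1 * (1 * h^-1 ^+ 2)))).

Let dgl_le l w : nc (l - l0) < h -> nc w < 1 -> nc (dgl l w) <= K1.
Proof.
move=> ll w1; have q := deninv ll w1; apply: nc_leD.
  by rewrite ncN; apply: nc_leM => //; rewrite nc_nat.
apply: nc_leM; first exact: num_le.
by apply: nc_leM; [exact: ltW|exact: nc_leX].
Qed.

Let dgl2_le l w : nc (l - l0) < h -> nc w < 1 -> nc (dgl2 l w) <= K2.
Proof.
move=> ll w1; have q := deninv ll w1.
have q2 : nc (w * (den l w)^-1 ^+ 2) <= 1 * h^-1 ^+ 2.
  by apply: nc_leM; [exact: ltW|exact: nc_leX].
apply: nc_leD; first by rewrite ncN; apply: nc_leM => //; rewrite nc_nat.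
apply: nc_leD; first by apply: nc_leM => //; rewrite ncN nc_nat.
apply: nc_leM; first exact: num_le.
apply: nc_leM; first exact: ltW.
by apply: nc_leM => //; apply: nc_leM => //; rewrite nc_nat.
Qed.

Let tz (t : R) z : 0 <= t <= 1 -> nc z < 1 -> nc (t%:C * z) < 1.
Proof.
move=> /andP[t0 t1] z1; rewrite ncM nc_real ger0_norm //; apply: le_lt_trans z1.
by rewrite ler_piMl ?nc_ge0.
Qed.

Let dgl_int l z : nc (l - l0) < h -> nc z < 1 ->
  cint mu `[(0 : R), 1]%classic (fun t : R => dgl l (t%:C * z)).
Proof.
move=> ll z1; apply: (segment_cint (g := dgl l)) => t t01.
have w1 := tz t01 z1; have n0 := den0 ll w1.
have Dq := cderivV n0 (den_cderiv gamma dpsi l w1).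
have Dn := num_cderiv dpsi psi'_lt l w1.
exact: cderiv_nccont (cderivD (cderivN (cderivZ 2 Dq)) (cderivM Dn (cderivM (cderiv_id _) (cderiv_sqr Dq)))).
Qed.

(** B and M are chosen before z: this uniformity is what turns interpolation in l into approximation
    in supremum norm. *)
Lemma fl_dlambda : exists B M, forall z, nc z < 1 -> forall l, nc (l - l0) < h ->
  [/\ cderiv (fun l => fl l z) l (dfl z l), nc (fl l z) <= B & nc (dfl z l) <= M].
Proof.
exists (expR (Bn / h)), (K1 * expR (Bn / h)) => z z1 l ll.
have c' := cden' ll.
have fB : nc (fl l z) <= expR (Bn / h).
  apply: le_trans (fl_bnd dpsi psi'_lt h0 c' z1) _; rewrite ler_expR /Bgl ler_pM2r ?invr_gt0 //.
  have : nc l <= nc l0 + nc (l - l0) by rewrite (_ : nc l = nc (l0 + (l - l0))) ?ncD //; congr nc; ring.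
  by rewrite /Bn /Bpsi; lra.
have inD (t : R) : `[(0 : R), 1]%classic t -> nc (t%:C * z) < 1.
  by rewrite /= in_itv /= => t01; exact: tz.
have m01 : measurable (`[(0 : R), 1]%classic : set (measurableTypeR R)) by exact: measurable_itv.
have IB : nc (Cintegral mu `[(0 : R), 1]%classic (fun t : R => dgl l (t%:C * z))) <= K1.
  have -> : K1 = \int[mu]_(t in `[(0 : R), 1]%classic) K1.
    rewrite Rintegral_cst //= lebesgue_measure_itv /= lte_fin ltr01 /= subr0 mulr1 //.
  apply: CI_le => //; [exact: dgl_int|exact: rint01_cst|].
  by move=> t /inD; exact: dgl_le.
have r0 : 0 < h - nc (l - l0) by rewrite subr_gt0.
have near l' : nc (l' - l) < h - nc (l - l0) -> nc (l' - l0) < h.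
  move=> H; rewrite (_ : l' - l0 = (l' - l) + (l - l0)); last by ring.
  by apply: le_lt_trans (ncD _ _) _; lra.
have D : cderiv (fun l => segment_integral (gl l) z) l
    (z * Cintegral mu `[(0 : R), 1]%classic (fun t : R => dgl l (t%:C * z))).
  apply: cderivZ.
  apply: (@CI_cderiv R _ _ mu _ m01 (fun (t : R) l => gl l (t%:C * z))
    (fun t l => dgl l (t%:C * z)) (fun t l => dgl2 l (t%:C * z)) l _ (fun=> K2) r0).
  - by move=> t l' /inD w1 /near l1; exact: dglE.
  - by move=> t l' /inD w1 /near l1; exact: ddgl.
  - by move=> t l' /inD w1 /near l1; exact: dgl2_le.
  - move=> l' /near l1; apply: (segment_cint (g := gl l')) => t t01.
    exact: cderiv_nccont (gl_cderiv dpsi psi'_lt h0 (cden' l1) (tz t01 z1)).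
  - exact: dgl_int.
  - exact: rint01_cst.
split=> //.
  apply: cderiv_eq (cderiv_comp (cderivN D) (cderiv_cexp _)) _.
  by rewrite /dfl mulrC.
by apply: nc_leM => //; rewrite ncN; apply: nc_le1M => //; exact: ltW.
Qed.
End lambda.
End EigenPath.

(** * Spans of eigenfunctions along segments *)

Section Span.
Variables (R : realType) (I : Type) (A : set I) (F : I -> R[i] -> R[i]).
Notation C := R[i].

Lemma lin_span0 : lin_span A F (fun=> 0).
Proof.
(* [I] may be empty, so the empty family of indices is built by eliminating the absurd bound of an
   ordinal below 0. *)
exists 0%N, (fun=> 0), (fun k : 'I_0 => False_rect I (let: Ordinal _ mk := k in Bool.diff_false_true mk)).
by split=> [[]//|]; apply/funext => z; rewrite big_ord0.
Qed.

Lemma lin_span_cons i k h : A i -> lin_span A F h -> lin_span A F (fun z => k * F i z + h z).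
Proof.
move=> Ai [n [c [l [Al ->]]]].
exists n.+1, (fun j => oapp c k (unlift ord0 j)), (fun j => oapp l i (unlift ord0 j)); split.
  by move=> j; case: unliftP => [j' _|_] /=.
apply/funext => z; rewrite big_ord_recl unlift_none /=; congr (_ + _).
by apply: eq_bigr => j _; rewrite liftK.
Qed.

Lemma lin_span_ind (Q : (C -> C) -> Prop) : Q (fun=> 0) ->
  (forall i k h, A i -> lin_span A F h -> Q h -> Q (fun z => k * F i z + h z)) ->
  forall h, lin_span A F h -> Q h.
Proof.
move=> Q0 Qc h [n [c [l [Al ->]]]]; elim: n c l Al => [|n IH] c l Al.
  by under eq_fun do rewrite big_ord0.
under eq_fun do rewrite big_ord_recl.
have Al' (j : 'I_n) : A (l (lift ord0 j)) by exact: Al.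
apply: Qc; [exact: Al| |exact: IH].
by exists n, (fun j => c (lift ord0 j)), (fun j => l (lift ord0 j)).
Qed.

Lemma lin_spanZD k g h : lin_span A F g -> lin_span A F h -> lin_span A F (fun z => k * g z + h z).
Proof.
move=> + sh; move: g; apply: lin_span_ind => [|i k' g Ai _ IH].
  by under eq_fun do rewrite mulr0 add0r.
under eq_fun do rewrite mulrDr -addrA mulrA.
exact: lin_span_cons.
Qed.

(** Closure in the supremum norm on the disk, which dominates [nrm] because the disk has mass 1. *)
Definition supcl g := forall e : R, 0 < e -> exists2 h, lin_span A F h &
  forall z, nc z < 1 -> nc (g z - h z) <= e.

Lemma span_supcl h : lin_span A F h -> supcl h.
Proof. by move=> sh e e0; exists h => // z _; rewrite subrr nc0 ltW. Qed.

Lemma supclZD k g h : supcl g -> supcl h -> supcl (fun z => k * g z + h z).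
Proof.
move=> cg ch e e0.
have k1 : 0 < nc k + 1 by exact: ncS_gt0.
have [g' sg Hg] := cg (e / 2 / (nc k + 1)) ltac:(by rewrite !divr_gt0).
have [h' sh Hh] := ch (e / 2) ltac:(by rewrite divr_gt0).
exists (fun z => k * g' z + h' z); first exact: lin_spanZD.
move=> z z1; rewrite (_ : _ - _ = k * (g z - g' z) + (h z - h' z)); last by ring.
rewrite (_ : e = e / 2 + e / 2); last by field.
apply: nc_leD; last exact: Hh.
rewrite ncM; apply: le_trans (ler_wpM2l (nc_ge0 _) (Hg _ z1)) _.
by rewrite mulrA ler_pdivrMr // mulrC ler_pM2l ?divr_gt0 // lerDl.
Qed.

Lemma supcl_sum n (c : 'I_n -> C) (g : 'I_n -> C -> C) : (forall j, supcl (g j)) ->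
  supcl (fun z => \sum_(j < n) c j * g j z).
Proof.
elim: n c g => [|n IH] c g H.
  by under eq_fun do rewrite big_ord0; apply: span_supcl; exact: lin_span0.
under eq_fun do rewrite big_ord_recl.
by apply: supclZD => //; apply: IH.
Qed.

Lemma supcl_lim g : (forall e : R, 0 < e -> exists2 h, supcl h & forall z, nc z < 1 -> nc (g z - h z) <= e) ->
  supcl g.
Proof.
move=> H e e0; have e20 : 0 < e / 2 by rewrite divr_gt0.
have [h /(_ _ e20)[h' sh' Hh'] Hh] := H _ e20.
exists h' => // z z1; rewrite (_ : _ - _ = (g z - h z) + (h z - h' z)); last by ring.
by rewrite (_ : e = e / 2 + e / 2); [apply: nc_leD; [exact: Hh|exact: Hh']|field].
Qed.

End Span.

(** * Propagation along a path of eigenvalues *)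

Section Path.
Variable R : realType.
Notation C := R[i].
Variables (gamma : C) (psi psi' : C -> C).
Hypothesis gamma0 : gamma != 0.
Hypothesis dpsi : forall z, nc z < 1 -> cderiv psi z (psi' z).
Hypothesis psi'_lt : forall z, nc z < 1 -> nc (psi' z) < nc gamma.
Local Notation den := (den gamma psi).
Local Notation fl := (fl gamma psi psi').
Local Notation den_ge := (den_ge gamma psi).

(* For such l, in the range of the symbol or not, [fl l] is an eigenfunction. *)
Definition reg l := exists2 c : R, 0 < c & den_ge c l.

(** The radius dl on which approximation is known may be tiny, but the radius c/16 reached depends
    on c alone; so a path can be followed by steps that do not shrink. *)
Lemma supcl_local (A : set C) l0 (c dl : R) s m : 0 < c -> den_ge c l0 -> nc (s - l0) < c / 16 -> 0 < dl ->
  (forall u, nc (u - s) < dl -> supcl A fl (fl u)) -> nc (m - l0) < c / 16 -> supcl A fl (fl m).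
Proof.
move=> c0 cl sl dl0 H ml; apply: supcl_lim => e e0.
have [B [M HB]] := fl_dlambda dpsi psi'_lt c0 cl.
(* The disc of radius r about s stays within c/2 of l0, where [fl_dlambda] applies, and |m - s| <
   c/8 = r/2, so m has relative position at most 1/2. *)
pose r := c / 4; have r0 : 0 < r by rewrite divr_gt0.
have rc0 : r%:C != 0 :> C by rewrite -nc_gt0 nc_real gtr0_norm.
have inb u : nc u < 1 -> nc (s + r%:C * u - l0) < c / 2.
  move=> u1; rewrite (_ : _ - l0 = (s - l0) + r%:C * u); last by ring.
  apply: le_lt_trans (ncD _ _) _; rewrite ncM nc_real gtr0_norm //.
  have : r * nc u <= r by rewrite ler_piMr ?(ltW u1) // ltW.
  by rewrite /r in r0 *; lra.
pose x := (m - s) / r%:C.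
have nx : nc x <= 2^-1.
  rewrite ncM ncV nc_real gtr0_norm // ler_pdivrMr //.
  have : nc (m - s) <= nc (m - l0) + nc (s - l0) by rewrite [nc (s - _)]ncBC; exact: nc_dist.
  by move=> h; rewrite mulrC ler_pdivlMr // /r; lra.
have half1 : 2^-1 < 1 :> R by rewrite invf_lt1 // ltr1n.
pose eps := Num.min 2^-1 (dl / (2 * r)).
have eps0 : 0 < eps by rewrite lt_min invr_gt0 ltr0n divr_gt0 // mulr_gt0.
have eps_half : eps <= 2^-1 by rewrite /eps ge_min lexx.
have eps_dl : r * eps < dl.
  have : eps <= dl / (2 * r) by rewrite /eps ge_min lexx orbT.
  rewrite ler_pdivlMr ?mulr_gt0 // => h; lra.
clearbody eps.
have B0 : 0 <= B.
  have [_ h _] := HB 0 ltac:(by rewrite nc0) l0 ltac:(by rewrite subrr nc0 divr_gt0).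
  by apply: le_trans h; exact: nc_ge0.
have B1 : 0 < B + 1 by rewrite ltr_wpDl.
have eta0 : 0 < e / (B + 1) by rewrite divr_gt0.
have [n [k [v [nv Hn]]]] := interp eps0 eps_half half1 nx eta0.
exists (fun z => \sum_(j < n) k j * fl (s + r%:C * v j) z).
  apply: supcl_sum => j; apply: H.
  rewrite addrC addKr ncM nc_real gtr0_norm //; apply: le_lt_trans eps_dl.
  by rewrite ler_pM2l.
move=> z z1.
have := Hn (fun u => fl (s + r%:C * u) z) (fun u => dfl gamma psi psi' z (s + r%:C * u) * r%:C) B (M * r).
have -> : s + r%:C * x = m by rewrite /x mulrC divfK // addrC subrK.
move=> h; apply: le_trans (h _ _ _) _.
- move=> u u1; have [D _ _] := HB z z1 _ (inb _ u1).
  apply: cderiv_eq (cderiv_comp (f := fun l => fl l z) (cderivD (cderiv_cst s u) (cderivZ r%:C (cderiv_id u))) D) _.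
  by rewrite add0r mulr1.
- by move=> u u1; have [_ D _] := HB z z1 _ (inb _ u1).
- move=> u u1; have [_ _ D] := HB z z1 _ (inb _ u1); apply: nc_leM => //.
  by rewrite nc_real gtr0_norm.
by rewrite mulrAC ler_pdivrMr // ler_pM2l // lerDl.
Qed.

(** A supremum argument: at the last parameter S reached, [supcl_local] started from a slightly
    earlier point covers a disc about lam S, hence S = 1. *)
Lemma supcl_path (lam : R -> C) (L ep : R) : 0 < ep -> 0 <= L ->
  (forall t t', 0 <= t <= 1 -> 0 <= t' <= 1 -> nc (lam t - lam t') <= L * `|t - t'|) ->
  (forall t, 0 <= t <= 1 -> reg (lam t)) ->
  supcl [set u | nc (u - lam 0) < ep /\ reg u] fl (fl (lam 1)).
Proof.
move=> ep0 L0 lip rg; set A := [set u | _].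
(* A whole neighbourhood of lam t is demanded because the interpolation nodes fill a small circle
   around it. *)
pose E := [set t : R | 0 <= t <= 1 /\ exists2 d : R, 0 < d & forall u, nc (u - lam t) < d -> supcl A fl (fl u)].
have E0 : E 0.
  split; first by rewrite lexx ler01.
  have [c c0 Hc] := rg 0 ltac:(by rewrite lexx ler01).
  exists (Num.min ep (c / 2)); first by rewrite lt_min ep0 divr_gt0.
  move=> u; rewrite lt_min => /andP[u1 u2]; apply: span_supcl.
  exists 1%N, (fun=> 1), (fun=> u); split; last by apply/funext => z; rewrite big_ord1 mul1r.
  move=> _; split=> //; exists (c - c / 2); first by lra.
  exact: den_ge_near Hc (ltW u2).
have ubE : ubound E 1 by move=> t [/andP[]].
have hs : has_sup E by split; [exists 0|exists 1].
pose S := sup E.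
have S1 : S <= 1 by apply: ge_sup => //; exists 0.
have S0 : 0 <= S by apply: ub_le_sup => //; exists 1.
have [c c0 Hc] := rg S ltac:(by rewrite S0 S1).
(* Within parameter distance tau of S the path stays within c/16 of lam S, the range of
   [supcl_local]. *)
pose tau := c / 16 / (L + 1).
have tau0 : 0 < tau by rewrite !divr_gt0 // ltr_wpDl.
have Ltau : L * tau < c / 16.
  have : tau * (L + 1) = c / 16 by rewrite /tau divfK // gt_eqF // ltr_wpDl.
  by lra.
have [t Et tS] := sup_adherent tau0 hs.
have tS' : t <= S by apply: ub_le_sup => //; exists 1.
case: Et => t01 [d d0 Hd].
have ltS : nc (lam t - lam S) < c / 16.
  apply: le_lt_trans (lip _ _ t01 _) _; first by rewrite S0 S1.
  apply: le_lt_trans Ltau; rewrite ler_wpM2l // ler0_norm; last by lra.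
  by rewrite /S; lra.
have HS u : nc (u - lam S) < c / 16 -> supcl A fl (fl u).
  exact: (supcl_local c0 Hc ltS d0 Hd).
have [S1'|S1'] := ltP S 1; last first.
  have -> : lam 1 = lam S by congr lam; lra.
  by apply: HS; rewrite subrr nc0 divr_gt0.
exfalso; pose t' := Num.min 1 (S + tau / 2).
have t'1 : t' <= 1 by rewrite /t' ge_min lexx.
have t'S : S < t' by rewrite /t' lt_min S1' /=; lra.
have t'tau : t' - S <= tau.
  have : t' <= S + tau / 2 by rewrite /t' ge_min lexx orbT.
  by lra.
have t'01 : 0 <= t' <= 1 by rewrite t'1 andbT; lra.
have lt' : nc (lam t' - lam S) < c / 16.
  apply: le_lt_trans (lip _ _ t'01 _) _; first by rewrite S0 S1.
  by apply: le_lt_trans Ltau; rewrite ler_wpM2l // gtr0_norm // subr_gt0.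
have : t' <= S.
  apply: ub_le_sup; first by exists 1.
  split=> //; exists (c / 16 - nc (lam t' - lam S)); first by rewrite subr_gt0.
  move=> u hu; apply: HS; apply: le_lt_trans (nc_dist _ _ (lam t')) _; lra.
by rewrite leNgt t'S.
Qed.

Lemma symbol_lip z w : nc z < 1 -> nc w < 1 ->
  nc (symbol gamma psi w - symbol gamma psi z) <= 2 * nc gamma * nc (w - z).
Proof.
move=> z1 w1; rewrite (_ : _ - _ = gamma * cj (w - z) + (psi w - psi z)); last first.
  by rewrite /symbol rmorphB /=; ring.
rewrite -mulrA mulr_natl mulr2n; apply: nc_leD; last exact: psi_lip dpsi psi'_lt _ _ z1 w1.
by rewrite ncM ncJ.
Qed.

Lemma supcl_symbol a0 a1 (ep : R) : nc a0 < 1 -> nc a1 < 1 -> 0 < ep ->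
  supcl [set u | nc (u - symbol gamma psi a0) < ep /\ reg u] fl (fl (symbol gamma psi a1)).
Proof.
move=> h0 h1 ep0.
pose seg (t : R) := a0 + t%:C * (a1 - a0).
have seg1 t : 0 <= t <= 1 -> nc (seg t) < 1 by move=> t01; exact: disk_segment.
have segB t t' : nc (seg t - seg t') = nc (a1 - a0) * `|t - t'|.
  rewrite (_ : seg t - seg t' = (t - t')%:C * (a1 - a0)); last by rewrite /seg rmorphB /=; ring.
  by rewrite ncM nc_real mulrC.
have E0 : seg 0 = a0 by rewrite /seg mul0r addr0.
have E1 : seg 1 = a1 by rewrite /seg mul1r addrC subrK.
clearbody seg; rewrite -E0 -E1.
apply: (@supcl_path (fun t => symbol gamma psi (seg t)) (2 * nc gamma * nc (seg 1 - seg 0))) => //.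
- by rewrite !mulr_ge0 ?nc_ge0.
- move=> t t' /seg1 t1 /seg1 t'1; apply: le_trans (symbol_lip t'1 t1) _.
  by rewrite segB E0 E1 mulrA.
- by move=> t /seg1 t1; apply: den_lower gamma0 dpsi psi'_lt _ t1.
Qed.

End Path.

(** * Construction of a universal vector *)

Section Complete.
Variable R : realType.
Notation C := R[i].
Local Notation P := (@bergman_proj R).
Implicit Types (f g h : C -> C).

(** The limit is the supremum of the lower bounds u j - b j, each of which is at most every upper
    bound u k + b k. *)
Lemma real_cauchy (u b : nat -> R) : (forall j m, `|u (j + m)%N - u j| <= b j) ->
  exists l, forall j, `|l - u j| <= b j.
Proof.
move=> H.
have b0 j : 0 <= b j by apply: le_trans (H j 0%N).
have le j k : u j - b j <= u k + b k.
  case: (leqP j k) => [jk|/ltnW kj].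
    by have := H j (k - j)%N; have := b0 k; rewrite subnKC // ler_norml; move=> ? /andP[]; lra.
  by have := H k (j - k)%N; have := b0 j; rewrite subnKC // ler_norml; move=> ? /andP[]; lra.
pose E := range (fun j => u j - b j).
have ub k : ubound E (u k + b k) by move=> _ [j _ <-].
have E0 : E !=set0 by exists (u 0%N - b 0%N), 0%N.
exists (sup E) => j; rewrite ler_norml; apply/andP; split.
  suff : u j - b j <= sup E by lra.
  by apply: ub_le_sup; [exists (u 0%N + b 0%N)|exists j].
suff : sup E <= u j + b j by lra.
exact: ge_sup.
Qed.

Lemma cplx_cauchy (u : nat -> C) (b : nat -> R) : (forall j m, nc (u (j + m)%N - u j) <= b j) ->
  exists l, forall j, nc (l - u j) <= 2 * b j.
Proof.
move=> H.
have [a Ha] := @real_cauchy (fun j => complex.Re (u j)) b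
  (fun j m => ltac:(rewrite -raddfB; exact: le_trans (normRe_nc _) (H j m))).
have [c Hc] := @real_cauchy (fun j => complex.Im (u j)) b
  (fun j m => ltac:(rewrite -raddfB; exact: le_trans (normIm_nc _) (H j m))).
exists (a +i* c) => j; apply: le_trans (nc_ReIm _) _.
rewrite !raddfB /= mulr_natl mulr2n; exact: lerD.
Qed.

(** Evaluation is bounded on functions fixed by P, so the sequence converges pointwise; Fatou in m
    keeps the bound b j for the limit, and P x = x follows by comparison with some W j. *)
Lemma bergman_complete (W : nat -> C -> C) (b : nat -> R) :
  (forall j, L2f (W j)) -> (forall j z, nc z < 1 -> P (W j) z = W j z) ->
  (forall e : R, 0 < e -> exists j0, forall j, (j0 <= j)%N -> b j <= e) ->
  (forall j m, nrm (fun z => W (j + m)%N z - W j z) <= b j) ->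
  exists x, [/\ L2f x, forall z, nc z < 1 -> P x z = x z & forall j, nrm (fun z => x z - W j z) <= b j].
Proof.
move=> LW PW b_small cau.
have cauz z j m : nc z < 1 -> nc (W (j + m)%N z - W j z) <= (1 - nc z)^-1 ^+ 2 * b j.
  move=> z1; pose d w := W (j + m)%N w - W j w.
  have Ld : L2f d by exact: L2fB.
  have Pd : P d z = d z.
    have -> : P d z = P (fun w => -1 * W j w + W (j + m)%N w) z.
      by apply: proj_eq => w _; rewrite /d mulN1r addrC.
    rewrite projD ?projZ //; [|exact: L2f_int|exact: L2f_int (L2fZ _ _)|exact: L2f_int].
    by rewrite !PW // mulN1r addrC.
  rewrite -/(d z) -Pd; apply: le_trans (proj_eval Ld z1) _; rewrite ler_wpM2l ?sqr_ge0 //; exact: cau.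
have /choice[x Hx] : forall z, exists l, nc z < 1 -> forall j, nc (l - W j z) <= 2 * ((1 - nc z)^-1 ^+ 2 * b j).
  move=> z; have [z1|z1] := ltP (nc z) 1; last by exists 0.
  have [l Hl] := @cplx_cauchy (fun j => W j z) (fun j => (1 - nc z)^-1 ^+ 2 * b j) (fun j m => cauz z j m z1).
  by exists l.
have cvx z : nc z < 1 -> ncvg (fun j => W j z) (x z).
  move=> z1 e e0; pose k := 2 * (1 - nc z)^-1 ^+ 2.
  have k0 : 0 < k by rewrite mulr_gt0 // exprn_gt0 // invr_gt0 subr_gt0.
  have [j0 Hj] := b_small (e / 2 / k) ltac:(by rewrite !divr_gt0).
  exists j0 => j /Hj h; rewrite ncBC; apply: le_lt_trans (Hx z z1 j) _.
  by move: h; rewrite ler_pdivlMr // /k mulrC mulrA => h; lra.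
have far j : L2f (fun z => x z - W j z) /\ nrm (fun z => x z - W j z) <= b j.
  have b0 : 0 <= b j by apply: le_trans (cau j 0%N); exact: nrm_ge0.
  have [|||h1 h2] := @sq_fatou R (fun m z => W (j + m)%N z - W j z) (fun z => x z - W j z) (b j ^+ 2).
  - by move=> m; exact: L2fB.
  - move=> z z1 e /(cvx z z1)[m0 H]; exists m0 => m mm.
    rewrite opprB addrA subrK; exact: (H (j + m)%N (leq_trans mm (leq_addl _ _))).
  - by move=> m; rewrite -nrm_sqr lerXn2r ?nnegrE ?nrm_ge0.
  by split=> //; rewrite -(@ler_pXn2r _ 2) ?nnegrE ?nrm_ge0 // nrm_sqr.
have Lx : L2f x by apply: L2f_eq (L2fD (far 0%N).1 (LW 0%N)) => z _; rewrite subrK.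
exists x; split=> // [z z1|j]; last exact: (far j).2.
apply/eqP; rewrite -subr_eq0 -nc_eq0 eq_le nc_ge0 andbT; apply/ler_addgt0Pl => e e0; rewrite addr0.
pose k := (1 - nc z)^-1 ^+ 2.
have k0 : 0 < k by rewrite exprn_gt0 // invr_gt0 subr_gt0.
have [j0 Hj] := b_small (e / 3 / k) ltac:(by apply: divr_gt0 => //; apply: divr_gt0).
have hb := Hj j0 (leqnn _); rewrite ler_pdivlMr // in hb.
have E : P x z - W j0 z = P (fun w => x w - W j0 w) z.
  have -> : P (fun w => x w - W j0 w) z = P (fun w => -1 * W j0 w + x w) z.
    by apply: proj_eq => w _; rewrite mulN1r addrC.
  rewrite projD ?projZ //; [|exact: L2f_int|exact: L2f_int (L2fZ _ _)|exact: L2f_int].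
  by rewrite !PW // mulN1r addrC.
have h1 : nc (P x z - W j0 z) <= k * b j0.
  rewrite E; apply: le_trans (proj_eval (far j0).1 z1) _.
  by rewrite ler_wpM2l ?(ltW k0) //; exact: (far j0).2.
have h2 := Hx z z1 j0; rewrite -/k in h2.
apply: le_trans (nc_dist _ _ (W j0 z)) _; rewrite [nc (W j0 z - _)]ncBC; lra.
Qed.
End Complete.

(** * Universal vectors of a bounded operator *)

Section Universal.
Variable R : realType.
Notation C := R[i].
Local Notation P := (@bergman_proj R).
Implicit Types (f g h : C -> C).

Variables (T : (C -> C) -> (C -> C)) (K : R).
Hypothesis K1 : 1 <= K.
Hypothesis T_L2 : forall f, L2f f -> L2f (T f).
Hypothesis T_nrm : forall f, L2f f -> nrm (T f) <= K * nrm f.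
Hypothesis T_lin : forall k f g, L2f f -> L2f g -> forall z, nc z < 1 ->
  T (fun w => k * f w + g w) z = k * T f z + T g z.
Hypothesis T_ext : forall f g, (forall z, nc z < 1 -> f z = g z) -> forall z, nc z < 1 -> T f z = T g z.

Let K0 n : 0 <= K ^+ n. Proof. by rewrite exprn_ge0 // (le_trans ler01). Qed.

Lemma iter_L2 n f : L2f f -> L2f (iter n T f).
Proof. by elim: n => [//|n IH] /IH /T_L2. Qed.

Lemma iter_nrm n f : L2f f -> nrm (iter n T f) <= K ^+ n * nrm f.
Proof.
move=> Lf; elim: n => [|n IH]; first by rewrite mul1r.
apply: le_trans (T_nrm (iter_L2 n Lf)) _; rewrite exprS -mulrA ler_wpM2l //.
exact: le_trans ler01 K1.
Qed.

Lemma iter_lin n k f g : L2f f -> L2f g -> forall z, nc z < 1 ->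
  iter n T (fun w => k * f w + g w) z = k * iter n T f z + iter n T g z.
Proof.
move=> Lf Lg; elim: n => [//|n IH] z z1 /=.
rewrite (T_ext IH) // T_lin //; exact: iter_L2.
Qed.

Lemma iterD n f g : L2f f -> L2f g -> forall z, nc z < 1 ->
  iter n T (fun w => f w + g w) z = iter n T f z + iter n T g z.
Proof. by move=> Lf Lg z z1; have := iter_lin n 1 Lf Lg z1; rewrite mul1r; under eq_fun do rewrite mul1r. Qed.

Lemma iterB n f g : L2f f -> L2f g -> forall z, nc z < 1 ->
  iter n T (fun w => f w - g w) z = iter n T f z - iter n T g z.
Proof.
move=> Lf Lg z z1; have := iter_lin n (-1) Lg Lf z1; rewrite mulN1r addrC => <-.
by congr (iter _ _ _ _); apply/funext => w; rewrite mulN1r addrC.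
Qed.

Variables (X0 : set (C -> C)) (q : nat -> C -> C).
Hypothesis X00 : X0 (fun=> 0).
Hypothesis X0D : forall g h, X0 g -> X0 h -> X0 (fun z => g z + h z).
Hypothesis X0L : forall h, X0 h -> L2f h /\ forall z, nc z < 1 -> P h z = h z.
Hypothesis qL : forall j, L2f (q j).
(** m stands for the last exponent already used: smallness of T^i v for all i <= m protects the
    approximations obtained so far. *)
Hypothesis step : forall w m j (e : R), X0 w -> 0 < e -> exists v n,
  [/\ X0 v, (m <= n)%N, nrm (iter n T w) <= e, forall i, (i <= m)%N -> nrm (iter i T v) <= e &
      nrm (fun z => iter n T v z - q j z) <= e].

Let r j : R := 2^-1 ^+ j.
Let r0 j : 0 < r j. Proof. by rewrite exprn_gt0 // invr_gt0. Qed.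
Let rS j : r j.+1 = r j / 2. Proof. by rewrite /r exprS mulrC. Qed.

Lemma half_pow_small (e : R) : 0 < e -> exists j0, forall j, (j0 <= j)%N -> r j <= e.
Proof.
move=> e0; have [N0 H] := @nat_pow_small R 2^-1 e ltac:(by rewrite invr_ge0 ler0n invf_lt1 // ltr1n) e0.
exists N0 => j /H /ltW; apply: le_trans; rewrite -/(r j) -[leLHS]mul1r.
by apply: ler_wpM2r; [exact: ltW|rewrite ler1n].
Qed.

(* The vector is the sum of the corrections v_j: T^(n_(j+1)) nearly kills the
   partial sum w_j, sends v_j close to q_j, and the later corrections are too
   small to matter up to the power n_(j+1). *)
Lemma universal_vector : exists x, [/\ L2f x, forall z, nc z < 1 -> P x z = x z &
  forall j, exists n, nrm (fun z => iter n T x z - q j z) <= 5 * r j].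
Proof.
(* A state consists of the partial sum, the current exponent and the stage. Outside X0 the value of
   the choice function is arbitrary. *)
have /choice[F HF] : forall s : (C -> C) * nat * nat, exists p : (C -> C) * nat, X0 s.1.1 ->
    [/\ X0 p.1, (s.1.2 <= p.2)%N, nrm (iter p.2 T s.1.1) <= r s.2,
        forall i, (i <= s.1.2)%N -> nrm (iter i T p.1) <= r s.2 &
        nrm (fun z => iter p.2 T p.1 z - q s.2 z) <= r s.2].
  move=> [[w m] j] /=; have [Xw|nXw] := pselect (X0 w); last by exists (w, m).
  by have [v [n H]] := step m j Xw (r0 j); exists (v, n).
pose st := fix st j : (C -> C) * nat := if j is j'.+1 then
  let p := F (st j', j') in (fun z => (st j').1 z + p.1 z, p.2) else (fun=> 0, 0%N).
pose W j := (st j).1; pose N j := (st j).2; pose V j := (F (st j, j)).1.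
have WS j : W j.+1 = (fun z => W j z + V j z) by [].
have XW j : X0 (W j).
  elim: j => [//|j IH]; rewrite WS; apply: X0D => //.
  by have [] := HF (st j, j) IH.
have stp j : [/\ X0 (V j), (N j <= N j.+1)%N, nrm (iter (N j.+1) T (W j)) <= r j,
    forall i, (i <= N j)%N -> nrm (iter i T (V j)) <= r j &
    nrm (fun z => iter (N j.+1) T (V j) z - q j z) <= r j] := HF (st j, j) (XW j).
have LW j : L2f (W j) := (X0L (XW j)).1.
have LV j : L2f (V j) by have [/X0L[]] := stp j.
have Nle j m : (N j <= N (j + m)%N)%N.
  by elim: m => [|m IH]; rewrite ?addn0 // addnS; have [_ h _ _ _] := stp (j + m)%N; exact: leq_trans IH h.
have tail i j m : (i <= N j)%N -> nrm (fun z => iter i T (W (j + m)%N) z - iter i T (W j) z) <= 2 * r j.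
  (* The stronger bound 2 r_j - 2 r_(j+m) telescopes: the correction at stage j+m costs r_(j+m) = 2
     r_(j+m) - 2 r_(j+m+1). *)
  move=> ij; suff : nrm (fun z => iter i T (W (j + m)%N) z - iter i T (W j) z) <= 2 * r j - 2 * r (j + m)%N.
    by have := r0 (j + m)%N; lra.
  elim: m => [|m IH].
    rewrite addn0 subrr; apply: nrm_bnd => [z _|]; first by rewrite subrr nc0.
    by apply: (L2fB (iter_L2 i (LW j)) (iter_L2 i (LW j))).1.
  have h1 := nrmD (L2fB (iter_L2 i (LW (j + m)%N)) (iter_L2 i (LW j))) (iter_L2 i (LV (j + m)%N)).
  rewrite (_ : nrm _ = nrm (fun z => iter i T (W (j + m)%N) z - iter i T (W j) z + iter i T (V (j + m)%N) z)).
    have [_ _ _ h2 _] := stp (j + m)%N; have := h2 i (leq_trans ij (Nle j m)).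
    by rewrite addnS rS; lra.
  apply: nrm_eq => z z1; rewrite addnS WS iterD //; ring.
have b_small (e : R) : 0 < e -> exists j0, forall j, (j0 <= j)%N -> 2 * r j <= e.
  move=> e0; have [j0 H] := half_pow_small (divr_gt0 e0 (ltr0n R 2)); exists j0 => j /H; lra.
have [x [Lx Px Wx]] := bergman_complete LW (fun j => (X0L (XW j)).2) b_small
  (fun j m => tail 0%N j m (leq0n _)).
exists x; split=> // j; exists (N j.+1); set n := N j.+1.
have [_ _ s1 _ s2] := stp j; rewrite -/n in s1 s2.
have Kn : 0 < K ^+ n by rewrite exprn_gt0 // (lt_le_trans ltr01).
(* T^n may expand distances by K^n, so x is compared with a partial sum late enough for K^n times
   the remainder to be small. *)
have [m0 Hm] := b_small (r j.+1 / K ^+ n) ltac:(by rewrite divr_gt0).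
have hm := Hm (j.+1 + m0)%N (leq_addl _ _); rewrite ler_pdivlMr // in hm.
pose m := (j.+1 + m0)%N.
have d1 : nrm (fun z => iter n T x z - iter n T (W m) z) <= r j.+1.
  rewrite -(nrm_eq (iterB n Lx (LW m))).
  apply: le_trans (iter_nrm n (L2fB Lx (LW m))) _; apply: le_trans hm.
  by rewrite mulrC ler_wpM2r.
have d2 := tail n j.+1 m0 (leqnn _); rewrite -/m in d2.
have d3 : nrm (fun z => iter n T (W j.+1) z - q j z) <= 2 * r j.
  have h := nrmD (iter_L2 n (LW j)) (L2fB (iter_L2 n (LV j)) (qL j)).
  apply: le_trans (_ : _ <= r j + r j) _; last by lra.
  apply: le_trans (lerD s1 s2); apply: le_trans h; rewrite le_eqVlt; apply/orP; left; apply/eqP.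
  by apply: nrm_eq => z z1; rewrite WS iterD // addrA.
have t1 := nrm_dist (iter_L2 n Lx) (iter_L2 n (LW m)) (qL j).
have t2 := nrm_dist (iter_L2 n (LW m)) (iter_L2 n (LW j.+1)) (qL j).
(* The three errors amount to (1/2 + 1 + 2) r_j. *)
by rewrite rS in d1 d2; have := r0 j; lra.
Qed.
End Universal.

(** * Toeplitz operators *)

Section RatPoly.
Variable R : realType.
Notation C := R[i].
Local Notation P := (@bergman_proj R).

Definition ratc (x : rat * rat) : C := ratr x.1 +i* ratr x.2.
(** Indexing by sequences of pairs of rationals makes the family countable through [pickle]. *)
Definition ratpol (s : seq (rat * rat)) : C -> C := pol (fun k => ratc (nth 0 s k)) (size s).

Lemma ratc_dense (a : C) (d : R) : 0 < d -> exists x, nc (a - ratc x) <= d.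
Proof.
move=> d0; have near (t : R) : exists x : rat, `|t - ratr x| <= d / 2.
  have [|x] := @rat_in_itvoo R (t - d / 2) (t + d / 2); first by lra.
  by rewrite in_itv /= => /andP[h1 h2]; exists x; rewrite ler_norml; apply/andP; split; lra.
have [x Hx] := near (complex.Re a); have [y Hy] := near (complex.Im a).
exists (x, y); apply: le_trans (nc_ReIm _) _; rewrite !raddfB /=; lra.
Qed.

Lemma ratpol_dense h (e : R) : L2f h -> (forall z, nc z < 1 -> P h z = h z) -> 0 < e ->
  exists s, nrm (fun z => h z - ratpol s z) < e.
Proof.
move=> Lh Ph e0; have e20 : 0 < e / 2 by rewrite divr_gt0.
have [N HN] := spart_dense Lh Ph e20.
pose a k := k.+1%:R * coef h k.
have d0 : 0 < e / 2 / N.+1%:R by rewrite divr_gt0.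
have /choice[x Hx] : forall k, exists x, nc (a k - ratc x) <= e / 2 / N.+1%:R.
  by move=> k; exact: ratc_dense.
exists (mkseq x N).
have E z : ratpol (mkseq x N) z = pol (ratc \o x) N z.
  rewrite /ratpol size_mkseq; apply: eq_bigr => k _; by rewrite nth_mkseq.
have Ls : L2f (spart h N) := pol_L2 _ _.
have Lp : L2f (ratpol (mkseq x N)) := pol_L2 _ _.
apply: le_lt_trans (nrm_dist Lh Ls Lp) _.
suff : nrm (fun z => spart h N z - ratpol (mkseq x N) z) <= e / 2 by lra.
apply: nrm_bnd (L2fB Ls Lp).1 => z z1.
rewrite E /spart /pol -sumrB; apply: le_trans (nc_sum _) _.
apply: (@le_trans _ _ (\sum_(k < N) e / 2 / N.+1%:R)).
  apply: ler_sum => k _; rewrite -mulrBl.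
  by apply: le_trans (nc_leM (Hx k) (nc_leX k (ltW z1))) _; rewrite expr1n mulr1.
rewrite sumr_const card_ord -[leLHS]mulr_natr mulrAC ler_pdivrMr ?ltr0n //.
by rewrite ler_pM2l // ler_nat.
Qed.

Lemma ratpol_cderiv s z : exists l, cderiv (ratpol s) z l.
Proof.
rewrite /ratpol; move: (fun k => _) (size s) => a; elim=> [|n [l IH]].
  by exists 0; apply: (@cderiv_near _ (fun=> 0) _ _ _ 1) (cderiv_cst _ _) => // w _; rewrite /pol big_ord0.
exists (l + a n * (n%:R * z ^+ n.-1)).
apply: (@cderiv_near _ (fun w => pol a n w + a n * w ^+ n) _ _ _ 1) (cderivD IH (cderivZ _ (cderivX _ _))) => // w _.
by rewrite /pol big_ord_recr.
Qed.
End RatPoly.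

(** * Iterates on spans of eigenfunctions *)

Section Toeplitz.
Variable R : realType.
Notation C := R[i].
Local Notation P := (@bergman_proj R).
Implicit Types (f g h : C -> C).
Variables (gamma : C) (psi psi' : C -> C).
Hypothesis gamma0 : gamma != 0.
Hypothesis dpsi : forall z, nc z < 1 -> cderiv psi z (psi' z).
Hypothesis psi'_lt : forall z, nc z < 1 -> nc (psi' z) < nc gamma.
Local Notation fl := (fl gamma psi psi').
Local Notation reg := (reg gamma psi).
Local Notation sym := (symbol gamma psi).
Local Notation T := (toeplitz sym).

(** A bound for the symbol, raised by 1 so that its powers increase. *)
Definition opb := 1 + (nc gamma + (nc (psi 0) + nc gamma)).

Lemma opb1 : 1 <= opb. Proof. by rewrite lerDl !addr_ge0 ?nc_ge0. Qed.

Let sL f : L2f f -> L2f (fun w => sym w * f w).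
Proof. exact: L2fM (symbol_meas gamma dpsi) (symbol_bnd dpsi psi'_lt). Qed.

Lemma toeplitz_L2 f : L2f f -> L2f (T f).
Proof. by move=> /sL /proj_L2[]. Qed.

Lemma toeplitz_nrm f : L2f f -> nrm (T f) <= opb * nrm f.
Proof.
move=> Lf; have [_] := proj_L2 (sL Lf) => /le_trans; apply.
apply: le_trans (nrmM (symbol_meas gamma dpsi) (symbol_bnd dpsi psi'_lt) Lf) _.
by rewrite ler_wpM2r ?nrm_ge0 // lerDr.
Qed.

Lemma toeplitz_lin k f g : L2f f -> L2f g -> forall z, nc z < 1 ->
  T (fun w => k * f w + g w) z = k * T f z + T g z.
Proof.
move=> Lf Lg z z1; have If := L2f_int (sL Lf); have Ig := L2f_int (sL Lg).
rewrite /toeplitz -projZ // -projD //; last exact: L2f_int (L2fZ _ (sL Lf)).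
by apply: proj_eq => w _; ring.
Qed.

Lemma toeplitz_ext f g : (forall z, nc z < 1 -> f z = g z) -> forall z, nc z < 1 -> T f z = T g z.
Proof. by move=> fg z _; apply: proj_eq => w /fg ->. Qed.

Lemma toeplitz_cderiv f z : L2f f -> nc z < 1 -> exists l, cderiv (T f) z l.
Proof. by move=> /sL /L2f_int If z1; eexists; exact: proj_cderiv If z1. Qed.

Let itL2 n f : L2f f -> L2f (iter n T f) := @iter_L2 R T toeplitz_L2 n f.

Lemma fl_reg_L2 u : reg u -> L2f (fl u).
Proof. by move=> [c c0 H]; have := fl_L2 dpsi psi'_lt c0 H. Qed.

Lemma iter_fl n u z : reg u -> nc z < 1 -> iter n T (fl u) z = u ^+ n * fl u z.
Proof.
move=> ru; have Lu := fl_reg_L2 ru; have [c c0 H] := ru.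
elim: n z => [|n IH] z z1 /=; first by rewrite mul1r.
rewrite (toeplitz_ext IH) //.
(* Linearity is stated for k f + g, so a zero multiple of [fl u] plays the part of g. *)
have := @toeplitz_lin (u ^+ n) _ _ Lu (L2fZ 0 Lu) z z1.
rewrite (toeplitz_ext (g := fun w => u ^+ n * fl u w)) //; last by move=> w _; ring.
move=> ->; rewrite (toeplitz_fl dpsi psi'_lt c0 H z1).
have -> : T (fun w => 0 * fl u w) z = 0.
  rewrite /toeplitz -[RHS](mul0r (T (fl u) z)) -projZ //; last exact: L2f_int (sL Lu).
  by apply: proj_eq => w _; ring.
by rewrite exprS; ring.
Qed.

Lemma span_L2 (A : set C) h : A `<=` reg -> lin_span A fl h ->
  [/\ L2f h, forall z, nc z < 1 -> P h z = h z & forall z, nc z < 1 -> exists l, cderiv h z l].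
Proof.
move=> Areg; move: h; apply: lin_span_ind => [|u k h /Areg ru _ [Lh Ph dh]].
  split=> [|z z1|z _]; last by exists 0; exact: cderiv_cst.
    by apply: (@L2f_bnd _ _ 0) => [|z _]; [exact: cmeas_cst|rewrite nc0].
  rewrite projE /kmom -[RHS](CI_cst 0); apply: CI_eqD => p _; exact: mul0r.
have Lu := fl_reg_L2 ru; have [c c0 H] := ru.
split=> [|z z1|z z1]; first exact: L2fD (L2fZ _ Lu) Lh.
  rewrite projD ?projZ ?Ph ?(fl_proj dpsi psi'_lt c0 H) //; try exact: L2f_int.
  exact: L2f_int (L2fZ _ Lu).
have [l Hl] := dh z z1; exists (k * - (gl gamma psi psi' u z * fl u z) + l).
exact: cderivD (cderivZ k (fl_cderiv dpsi psi'_lt c0 H z1)) Hl.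
Qed.

Lemma pow_small (x B e : R) : 0 <= x < 1 -> 0 <= B -> 0 < e ->
  exists N, forall n, (N <= n)%N -> B * x ^+ n <= e.
Proof.
move=> x01 B0 e0; have B1 : 0 < B + 1 by rewrite ltr_wpDl.
have [N H] := @nat_pow_small R x (e / (B + 1)) x01 ltac:(by rewrite divr_gt0).
exists N => n /H; rewrite ltr_pdivlMr // => /ltW h; apply: le_trans h.
have /andP[x0 _] := x01; have xn : 0 <= x ^+ n by rewrite exprn_ge0.
rewrite mulrC; apply: ler_pM => //; last by rewrite lerDl.
by rewrite ler_peMl // ler1n.
Qed.

Lemma span_contracts (A : set C) h : A `<=` reg -> (forall u, A u -> nc u < 1) ->
  lin_span A fl h -> forall e : R, 0 < e -> exists N, forall n, (N <= n)%N -> nrm (iter n T h) <= e.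
Proof.
move=> Areg A1; move: h.
apply: lin_span_ind => [|u k h Au sh IH] e e0.
  exists 0%N => n _; have L0 : L2f (fun _ : C => 0 : C) by have [] := span_L2 Areg (lin_span0 A fl).
  apply: le_trans (@iter_nrm R T _ opb1 toeplitz_L2 toeplitz_nrm n _ L0) _.
  suff -> : nrm (fun _ : C => 0 : C) = 0 by rewrite mulr0 ltW.
  by apply/eqP; rewrite eq_le nrm_ge0 andbT; apply: nrm_bnd => [z _|]; [rewrite nc0|exact: cmeas_cst].
have ru := Areg _ Au; have Lu := fl_reg_L2 ru; have [Lh _ _] := span_L2 Areg sh.
have e20 : 0 < e / 2 by rewrite divr_gt0.
have [N1 H1] := IH _ e20.
have [N2 H2] := @pow_small (nc u) (nc k * nrm (fl u)) _ ltac:(by rewrite nc_ge0 A1)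
   ltac:(by rewrite mulr_ge0 ?nc_ge0 ?nrm_ge0) e20.
exists (maxn N1 N2) => n; rewrite geq_max => /andP[/H1 h1 /H2 h2].
rewrite (nrm_eq (g := fun z => (k * u ^+ n) * fl u z + iter n T h z)); last first.
  move=> z z1; rewrite (iter_lin toeplitz_L2 toeplitz_lin toeplitz_ext n k Lu Lh z1).
  by rewrite iter_fl // mulrA.
apply: le_trans (nrmD (L2fZ _ Lu) (itL2 n Lh)) _; rewrite nrmZ // ncM ncX.
by rewrite mulrAC in h2; lra.
Qed.
End Toeplitz.

(** * One step of Kitai's construction *)

Section Step.
Variable R : realType.
Notation C := R[i].
Local Notation P := (@bergman_proj R).
Implicit Types (f g h : C -> C).
Variables (gamma : C) (psi psi' : C -> C).
Hypothesis gamma0 : gamma != 0.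
Hypothesis dpsi : forall z, nc z < 1 -> cderiv psi z (psi' z).
Hypothesis psi'_lt : forall z, nc z < 1 -> nc (psi' z) < nc gamma.
Local Notation fl := (fl gamma psi psi').
Local Notation reg := (reg gamma psi).
Local Notation sym := (symbol gamma psi).
Local Notation T := (toeplitz sym).
Local Notation K := (opb gamma psi).

Let TL2 := @toeplitz_L2 R gamma psi psi' dpsi psi'_lt.
Let Tnrm := @toeplitz_nrm R gamma psi psi' dpsi psi'_lt.
Let Tlin := @toeplitz_lin R gamma psi psi' dpsi psi'_lt.
Let Text := @toeplitz_ext R gamma psi.
Let itL2 n f : L2f f -> L2f (iter n T f) := @iter_L2 R T TL2 n f.

(** Each coefficient is divided by u^n. The vector S depends on the combination chosen for h, so
    nothing has to be well defined on the span. *)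
Lemma span_backward (A : set C) m h : A `<=` reg -> (forall u, A u -> 1 < nc u) ->
  lin_span A fl h -> forall e : R, 0 < e -> exists N, forall n, (N <= n)%N -> exists S,
    [/\ lin_span A fl S, forall i, (i <= m)%N -> nrm (iter i T S) <= e &
        forall z, nc z < 1 -> iter n T S z = h z].
Proof.
move=> Areg A1; move: h; apply: lin_span_ind => [|u k h Au sh IH] e e0.
  exists 0%N => n _; exists (fun=> 0).
  have s0 := lin_span0 A fl; have [L0 _ _] := span_L2 dpsi psi'_lt Areg s0.
  split=> // [i _|z z1].
    apply: le_trans (@iter_nrm R T _ (opb1 gamma psi) TL2 Tnrm i _ L0) _.
    suff -> : nrm (fun _ : C => 0 : C) = 0 by rewrite mulr0 ltW.
    by apply/eqP; rewrite eq_le nrm_ge0 andbT; apply: nrm_bnd => [z _|]; [rewrite nc0|exact: cmeas_cst].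
  by have := iterB TL2 Tlin Text n L0 L0 z1; rewrite subrr subrr.
have ru := Areg _ Au; have Lu := fl_reg_L2 dpsi psi'_lt ru; have [Lh _ _] := span_L2 dpsi psi'_lt Areg sh.
have u1 := A1 _ Au; have u0 : u != 0 by rewrite -nc_gt0; exact: lt_trans u1.
have e20 : 0 < e / 2 by rewrite divr_gt0.
have [N1 H1] := IH _ e20.
(* For i <= m and |u| > 1 one has |u|^i <= |u|^m, so a single n serves all i. *)
pose B := nc k * nrm (fl u) * nc u ^+ m.
have [N2 H2] := @pow_small R (nc u)^-1 B _
  ltac:(by rewrite invr_ge0 nc_ge0 invf_lt1 // nc_gt0)
  ltac:(by rewrite !mulr_ge0 ?exprn_ge0 ?nc_ge0 ?nrm_ge0) e20.
exists (maxn N1 N2) => n; rewrite geq_max => /andP[/H1[S [sS S1 S2]] /H2 h2].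
have [LS _ _] := span_L2 dpsi psi'_lt Areg sS.
have E i z : nc z < 1 -> iter i T (fun z => k / u ^+ n * fl u z + S z) z =
    (k / u ^+ n * u ^+ i) * fl u z + iter i T S z.
  by move=> z1; rewrite (iter_lin TL2 Tlin Text) // (iter_fl dpsi psi'_lt) // mulrA.
exists (fun z => k / u ^+ n * fl u z + S z); split=> [|i im|z z1]; first exact: lin_span_cons.
  rewrite (nrm_eq (E i)); apply: le_trans (nrmD (L2fZ _ Lu) (itL2 i LS)) _.
  have h1 := S1 _ im; rewrite nrmZ // !ncM ncV !ncX.
  suff : nc k / nc u ^+ n * nc u ^+ i * nrm (fl u) <= e / 2 by lra.
  apply: le_trans h2; rewrite /B exprVn.
  have -> : nc k / nc u ^+ n * nc u ^+ i * nrm (fl u) = nc k * nrm (fl u) * nc u ^+ i / nc u ^+ n.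
    by move: (_^-1) => v; ring.
  rewrite ler_wpM2r ?invr_ge0 ?exprn_ge0 ?nc_ge0 // ler_wpM2l ?mulr_ge0 ?nc_ge0 ?nrm_ge0 //.
  by apply: ler_weXn2l => //; exact: ltW.
by rewrite E // S2 // divfK // expf_neq0.
Qed.

Definition near_eigen a (ep : R) := [set u | nc (u - sym a) < ep /\ reg u].

Hypothesis eigen_dense : forall g, L2f g -> (forall z, nc z < 1 -> exists l, cderiv g z l) ->
  forall e : R, 0 < e -> exists2 h, lin_span (sym @` [set a | nc a < 1]) fl h &
    nrm (fun z => g z - h z) < e.

(** First an approximation with eigenvalues anywhere in Psi(D), then each eigenfunction in it is
    replaced by ones with eigenvalues near Psi(a). *)
Lemma near_eigen_dense a (ep : R) g (e : R) : nc a < 1 -> 0 < ep ->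
  L2f g -> (forall z, nc z < 1 -> exists l, cderiv g z l) -> 0 < e ->
  exists2 h, lin_span (near_eigen a ep) fl h & nrm (fun z => g z - h z) <= e.
Proof.
move=> a1 ep0 Lg dg e0; have e20 : 0 < e / 2 by rewrite divr_gt0.
have [h sh gh] := eigen_dense Lg dg e20.
have sreg : sym @` [set a | nc a < 1] `<=` reg.
  by move=> _ [b b1 <-]; exact: den_lower gamma0 dpsi psi'_lt _ b1.
have [Lh _ _] := span_L2 dpsi psi'_lt sreg sh.
have : supcl (near_eigen a ep) fl h.
  move: sh; apply: lin_span_ind => [|_ k h' [b b1 <-] _ IH]; first by apply: span_supcl; exact: lin_span0.
  apply: supclZD => //; exact: (supcl_symbol gamma0 dpsi psi'_lt a1 b1 ep0).
move=> /(_ _ e20)[h' sh' hh']; exists h' => //.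
have [Lh' _ _] := span_L2 dpsi psi'_lt (fun u (H : near_eigen a ep u) => H.2) sh'.
have := nrm_bnd hh' (L2fB Lh Lh').1.
have := nrm_dist Lg Lh Lh'; lra.
Qed.

Variables (a0 a1 : C) (q : nat -> C -> C).
Hypothesis a0D : nc a0 < 1.
Hypothesis a1D : nc a1 < 1.
Hypothesis sym0 : nc (sym a0) < 1.
Hypothesis sym1 : 1 < nc (sym a1).
Hypothesis qL : forall j, L2f (q j).
Hypothesis dq : forall j z, nc z < 1 -> exists l, cderiv (q j) z l.

(** The radii keep the eigenvalues strictly inside, respectively outside, the unit circle. *)
Let A0 := near_eigen a0 (1 - nc (sym a0)).
Let A1 := near_eigen a1 (nc (sym a1) - 1).
Let A0reg : A0 `<=` reg. Proof. by move=> u []. Qed.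
Let A1reg : A1 `<=` reg. Proof. by move=> u []. Qed.
Let A0lt u : A0 u -> nc u < 1.
Proof.
move=> [h _]; rewrite (_ : u = sym a0 + (u - sym a0)); last by ring.
by apply: le_lt_trans (ncD _ _) _; lra.
Qed.
Let A1gt u : A1 u -> 1 < nc u.
Proof.
move=> [h _]; have := ncBl (sym a1) (sym a1 - u); rewrite [nc (sym a1 - u)]ncBC subKr; lra.
Qed.

(** The backward vector S of an approximation y of q j lies in the span of A1, while the
    construction has to stay in the span of A0. So S is approximated there by v within (e/2) / K^n,
    and no power up to n can separate v from S by more than e/2. *)
Lemma kitai_step w m j (e : R) : lin_span A0 fl w -> 0 < e -> exists v n,
  [/\ lin_span A0 fl v, (m <= n)%N, nrm (iter n T w) <= e,
      forall i, (i <= m)%N -> nrm (iter i T v) <= e &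
      nrm (fun z => iter n T v z - q j z) <= e].
Proof.
move=> sw e0; have e20 : 0 < e / 2 by rewrite divr_gt0.
have ep0 : 0 < 1 - nc (sym a0) by rewrite subr_gt0.
have ep1 : 0 < nc (sym a1) - 1 by rewrite subr_gt0.
have [y sy qy] := near_eigen_dense a1D ep1 (qL j) (@dq j) e20.
have [N1 H1] := span_contracts dpsi psi'_lt A0reg A0lt sw e0.
have [N2 H2] := span_backward m A1reg A1gt sy e20.
pose n := maxn m (maxn N1 N2).
have [S [sS Sm Sn]] := H2 n ltac:(by rewrite !leq_max leqnn !orbT).
have [LS _ dS] := span_L2 dpsi psi'_lt A1reg sS; have [Ly _ _] := span_L2 dpsi psi'_lt A1reg sy.
have K1 := opb1 gamma psi; have Kn : 0 < K ^+ n by rewrite exprn_gt0 // (lt_le_trans ltr01).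
have [v sv Sv] := near_eigen_dense a0D ep0 LS dS (divr_gt0 e20 Kn).
have [Lv _ _] := span_L2 dpsi psi'_lt A0reg sv.
have close i : (i <= n)%N -> nrm (fun z => iter i T v z - iter i T S z) <= e / 2.
  move=> im; rewrite nrmBC -(nrm_eq (iterB TL2 Tlin Text i LS Lv)).
  apply: le_trans (iter_nrm K1 TL2 Tnrm i (L2fB LS Lv)) _.
  rewrite ler_pdivlMr // in Sv; apply: le_trans Sv; rewrite mulrC ler_wpM2l ?nrm_ge0 //.
  exact: ler_weXn2l.
exists v, n; split=> //.
- by rewrite leq_max leqnn.
- by apply: H1; rewrite !leq_max leqnn !orbT.
- move=> i im; have h1 := Sm _ im.
  have h2 : nrm (fun z => iter i T v z - iter i T S z) <= e / 2.
    by apply: close; apply: leq_trans im _; rewrite leq_max leqnn.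
  have := nrmD (L2fB (itL2 i Lv) (itL2 i LS)) (itL2 i LS).
  by under eq_fun do rewrite subrK; lra.
have h2 := close n (leqnn _).
rewrite (nrm_eq (g := fun z => iter n T v z - y z)) in h2; last by move=> z z1; rewrite Sn.
have := nrm_dist (itL2 n Lv) Ly (qL j); rewrite nrmBC in qy; lra.
Qed.

End Step.

(** * Hypercyclicity *)

Section Final.
Variable R : realType.
Notation C := R[i].

Lemma unit_disk_closureP (l : C) : nc l <= 1 -> closure (unit_disk R) l.
Proof.
move=> l1 B /nbhs_ncP[d d0 HB].
pose s := Num.min 1 (d / 2).
have s0 : 0 < s by rewrite lt_min ltr01 divr_gt0.
have s1 : s <= 1 by rewrite /s ge_min lexx.
have sd : s < d by rewrite /s gt_min; apply/orP; right; lra.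
clearbody s.
exists ((1 - s)%:C * l); split.
  rewrite unit_diskE ncM nc_real ger0_norm ?subr_ge0 //.
  by apply: le_lt_trans (_ : _ <= (1 - s) * 1) _; [rewrite ler_wpM2l // subr_ge0|lra].
apply: HB; rewrite (_ : _ - l = (- s)%:C * l); last by rewrite rmorphB rmorphN rmorph1 /=; ring.
rewrite ncM nc_real normrN gtr0_norm //; apply: le_lt_trans sd.
by rewrite ler_piMr // ltW.
Qed.

Lemma bergmanP (f : C -> C) : bergman f <-> L2f f /\ forall z, nc z < 1 -> exists l, cderiv f z l.
Proof.
split=> [[/L2diskP Lf hf]|[Lf df]]; split=> //; first by move=> z; rewrite -unit_diskE => /hf /derivable_cderiv; exists (derive1 f z).
  exact/L2diskP.
by move=> z; rewrite unit_diskE => /df[l]; exact: cderiv_derivable.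
Qed.
End Final.

Theorem theorem3p5 (R : realType) (gamma : R[i]) (psi : R[i] -> R[i])
  (gamma_neq0 : gamma != 0)
  (psi_analytic : exists U : set R[i],
    [/\ open U, closure (unit_disk R) `<=` U & holomorphic_on U psi])
  (sense_reversing : forall z : R[i], closure (unit_disk R) z ->
    `|derive1 psi z| < `|gamma|)
  (eigenfun_dense : bergman_dense
    (lin_span (symbol gamma psi @` unit_disk R) (eigenfun gamma psi)))
  (meets_disk : unit_disk R `&` (symbol gamma psi @` unit_disk R) !=set0)
  (meets_exterior :
    ~` closure (unit_disk R) `&` (symbol gamma psi @` unit_disk R) !=set0) :
  hypercyclic (toeplitz (symbol gamma psi)).
Proof.
have disk_cl (z : R[i]) : nc z < 1 -> closure (unit_disk R) z by move=> /ltW; exact: unit_disk_closureP.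
have dpsi z : nc z < 1 -> cderiv psi z (derive1 psi z).
  by have [U [_ clU hU]] := psi_analytic; move=> /disk_cl/clU/hU; exact: derivable_cderiv.
have psi'_lt z : nc z < 1 -> nc (derive1 psi z) < nc gamma.
  by move=> /disk_cl/sense_reversing; rewrite !normcE ltcR.
have diskE : unit_disk R = [set z | nc z < 1] by apply/funext => z; rewrite unit_diskE.
have eigE : eigenfun gamma psi = fl gamma psi (derive1 psi).
  by apply/funext => l; exact: eigenfunE.
rewrite eigE in eigenfun_dense.
have [l0 [sym0 [a0 a0D aE]]] := meets_disk; rewrite unit_diskE in a0D; rewrite -aE unit_diskE in sym0.
have [l1 [nsym1 [a1 a1D bE]]] := meets_exterior; rewrite unit_diskE in a1D; rewrite -bE in nsym1.
have sym1 : 1 < nc (symbol gamma psi a1).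
  by rewrite ltNge; apply/negP => /unit_disk_closureP /nsym1.
rewrite diskE in eigenfun_dense.
have sreg : symbol gamma psi @` [set a | nc a < 1] `<=` reg gamma psi.
  by move=> _ [b b1 <-]; exact: den_lower gamma_neq0 dpsi psi'_lt _ b1.
have eigen_dense g : L2f g -> (forall z, nc z < 1 -> exists l, cderiv g z l) ->
    forall e : R, 0 < e -> exists2 h, lin_span (symbol gamma psi @` [set a | nc a < 1])
      (fl gamma psi (derive1 psi)) h & nrm (fun z => g z - h z) < e.
  move=> Lg dg e e0; have /bergmanP bg := conj Lg dg.
  have [h sh gh] := eigenfun_dense g bg e e0; exists h => //.
  have [Lh _ _] := span_L2 dpsi psi'_lt sreg sh.
  by move: gh; rewrite L2norm_nrm ?lte_fin //; exact: L2fB.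
pose T := toeplitz (symbol gamma psi).
have TL := toeplitz_L2 dpsi psi'_lt.
split.
  split=> [f /bergmanP[Lf _]|a f g /bergmanP[Lf _] /bergmanP[Lg _] z|].
  - by apply/bergmanP; split; [exact: TL|move=> z; exact: (toeplitz_cderiv dpsi psi'_lt Lf)].
  - by rewrite unit_diskE; exact: (toeplitz_lin dpsi psi'_lt a Lf Lg).
  exists (opb gamma psi) => f /bergmanP[Lf _].
  rewrite !L2norm_nrm //; last exact: TL.
  by rewrite -EFinM lee_fin; exact: (toeplitz_nrm dpsi psi'_lt Lf).
(* [logn 2] takes every value at arbitrarily large arguments, so each target recurs. *)
pose q j := @ratpol R (odflt [::] (unpickle (logn 2 j))).
have qL j : L2f (q j) by exact: pol_L2.
have dq j z : nc z < 1 -> exists l, cderiv (q j) z l by move=> _; exact: ratpol_cderiv.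
set A0 := near_eigen gamma psi a0 (1 - nc (symbol gamma psi a0)).
have A0reg : A0 `<=` reg gamma psi by move=> u [].
have X0D g h : lin_span A0 (fl gamma psi (derive1 psi)) g -> lin_span A0 (fl gamma psi (derive1 psi)) h ->
    lin_span A0 (fl gamma psi (derive1 psi)) (fun z => g z + h z).
  by move=> sg sh; have := lin_spanZD 1 sg sh; under eq_fun do rewrite mul1r.
have X0L h : lin_span A0 (fl gamma psi (derive1 psi)) h -> L2f h /\ forall z, nc z < 1 -> bergman_proj h z = h z.
  by move=> /(span_L2 dpsi psi'_lt A0reg)[].
have [x [Lx Px Hx]] := universal_vector (opb1 gamma psi) TL (toeplitz_nrm dpsi psi'_lt)
  (toeplitz_lin dpsi psi'_lt) (@toeplitz_ext R gamma psi) (lin_span0 A0 _) X0D X0L qL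
  (kitai_step gamma_neq0 dpsi psi'_lt eigen_dense a0D a1D sym0 sym1 qL dq).
exists x.
  apply/bergmanP; split=> // z z1; exists (2 * kmom x 1 z).
  have [r r0 H] := ncopen_disk z1.
  by apply: (cderiv_near r0 _ (proj_cderiv (L2f_int Lx) z1)) => w /H; exact: Px.
move=> g /bergmanP[Lg dg] e e0.
(* Three errors of at most e/4: from g to h, from h to a rational polynomial, and 5 r_j from that
   polynomial to the orbit. *)
have e40 : 0 < e / 4 by rewrite divr_gt0.
have ep0 : 0 < 1 - nc (symbol gamma psi a0) by rewrite subr_gt0.
(* [ratpol_dense] applies to functions fixed by the projection; this is established for spans of
   eigenfunctions, hence the passage from g to h. *)
have [h sh gh] := near_eigen_dense gamma_neq0 dpsi psi'_lt eigen_dense a0D ep0 Lg dg e40.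
have [Lh Ph _] := span_L2 dpsi psi'_lt A0reg sh.
have [s hs] := ratpol_dense Lh Ph e40.
have [j0 Hj] := half_pow_small (divr_gt0 e40 (ltr0n R 5)).
(* The odd factor leaves the 2-adic valuation equal to [pickle s] and pushes j beyond j0. *)
pose j := (2 ^ pickle s * (2 * j0).+1)%N.
have jj0 : (j0 <= j)%N.
  apply: (@leq_trans (2 * j0).+1); first by rewrite ltnW // ltnS leq_pmull.
  by rewrite leq_pmull // expn_gt0.
have lj : logn 2 j = pickle s.
  by rewrite /j lognM ?expn_gt0 // pfactorK // logn_coprime ?coprime2n /= ?oddM // addn0.
have qj : q j = @ratpol R s by rewrite /q lj pickleK.
have [n Hn] := Hx j; rewrite qj in Hn.
exists (iter n T x); first by exists n.
have Ln : L2f (iter n T x) := iter_L2 TL n Lx.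
have Lq : L2f (@ratpol R s) := pol_L2 _ _.
rewrite L2norm_nrm ?lte_fin; last exact: L2fB.
have t1 := nrm_dist Lg Lh Ln; have t2 := nrm_dist Lh Lq Ln.
have := Hj j jj0; rewrite nrmBC in Hn; rewrite ler_pdivlMr // => h5.
rewrite /T in t1 t2 *; lra.
Qed.
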